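(* The reserve at time $t=0$ for a contract with no expiry date (i.e. $n=\infty$), $$Y_0=\mathbb{E}\left[\int_0^\infty e^{-rs}\,dB_s\,\Big|\,\mathcal{F}_0\right],$$ is given by $$Y_0=X_0\left\{r^{-1}\mathcal{L}_{h_1^{(r)}}(-\boldsymbol{T})(\boldsymbol{a}-\boldsymbol{c})+(-\boldsymbol{T})^{-1}\mathcal{L}_{h_2^{(-\boldsymbol{T})}}(r)\left[(\boldsymbol{T}\cdot\boldsymbol{B})\boldsymbol{e}+\boldsymbol{t}\cdot\boldsymbol{b}\right]\right\},$$ where $$h_1^{(r)}(u)=re^{-rg(u)}\frac{dg}{du}(u),\qquad h_2^{(w)}(u)=we^{-wg^{-1}(u)}\frac{dg^{-1}}{du}(u),\qquad u\ge0.$$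
   Context: **The process.** Let $(Z_t)_{t\ge0}$ be a time-homogeneous Markov jump process on $\{1,\dots,p+1\}$ in which states $1,\dots,p$ are transient and $p+1$ is absorbing, with intensity matrix $$\boldsymbol{\Lambda}=\begin{pmatrix}\boldsymbol{T}&\boldsymbol{t}\\ \boldsymbol{0}&0\end{pmatrix},$$ where $\boldsymbol{T}$ is a $p\times p$ sub-intensity matrix and $\boldsymbol{t}=-\boldsymbol{T}\boldsymbol{e}$ ($\boldsymbol{e}$ the $p$-dimensional column vector of ones). Thus the eigenvalues of $\boldsymbol{T}$ have negative real part and $-\boldsymbol{T}$ is invertible. The initial state is transient: $\mathbb{P}(Z_0=p+1)=0$. Let $g:\mathbb{R}_+\to\mathbb{R}_+$ be an increasing function with $g(0)=0$, bijective, with $g$ and $g^{-1}$ differentiable (and equal to the integrals of their derivatives). With $\boldsymbol{e}_k$ the $k$-th unit basis (row) vector of $\mathbb{R}^p$, put $X_t=\boldsymbol{e}_k$ if $Z_{g^{-1}(t)}=k\le p$, and $X_t=\dagger$ if $Z_{g^{-1}(t)}=p+1$. Let $(\mathcal{F}_t)$ be the natural filtration of $(X_t)$. **Payments.** For distinct $i,j\le p$ let $N^{ij}_t$ be the number of jumps of $X$ from $\boldsymbol{e}_i$ to $\boldsymbol{e}_j$ in $(0,t]$, and let $N^{i\dagger}_t$ be the number of jumps from $\boldsymbol{e}_i$ to $\dagger$ in $(0,t]$. Let $\boldsymbol{a},\boldsymbol{c}\in\mathbb{R}^p$ be column vectors (annuity and premium rates in the transient states; none are paid in the absorbing state), $\boldsymbol{B}=(b_{ij})$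 a real $p\times p$ matrix with zero diagonal (lump sums at transitions between transient states), and $\boldsymbol{b}=(b_1,\dots,b_p)$ a column vector (lump sums at absorption from each transient state). The benefits less premiums process is $$dB_t=\sum_{i=1}^p1\{X_t=\boldsymbol{e}_i\}(a_i-c_i)\,dt+\sum_{i\ne j,\ i,j\le p}b_{ij}\,dN_t^{ij}+\sum_{i=1}^pb_i\,dN^{i\dagger}_t .$$ The interest rate $r>0$ is constant. **Notation.** $\mathcal{L}_h(s)=\int_0^\infty e^{-su}h(u)\,du$ is the Laplace transform. The dot $\cdot$ between matrices or vectors of the same dimension is the component-wise product. Functions of matrices are defined by $f(\boldsymbol{A})=\frac{1}{2\pi i}\oint_\gamma f(w)(w\boldsymbol{I}-\boldsymbol{A})^{-1}dw$, with $\gamma$ a simple path enclosing the eigenvalues of $\boldsymbol{A}$ (inside the domain of analyticity of $f$). In particular $\mathcal{L}_{h_1^{(r)}}(-\boldsymbol{T})=\int_0^\infty e^{\boldsymbol{T}u}h_1^{(r)}(u)\,du$, and $\mathcal{L}_{h_2^{(-\boldsymbol{T})}}(r)$ is the function $w\mapsto\mathcal{L}_{h_2^{(w)}}(r)$ evaluated at the matrix $w=-\boldsymbol{T}$. *)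

(* Defs.v *)
From HB Require Import structures.
From mathcomp Require Import all_boot all_order all_algebra.
From mathcomp Require Import complex.
From mathcomp Require Import all_classical all_reals all_analysis.

Set Implicit Arguments.
Unset Strict Implicit.
Unset Printing Implicit Defensive.

Import Order.TTheory GRing.Theory Num.Theory.
Import numFieldNormedType.Exports.

Local Open Scope classical_set_scope.
Local Open Scope ring_scope.
Local Open Scope complex_scope.

Definition hadamard {R : pzRingType} m n (A B : 'M[R]_(m, n)) : 'M[R]_(m, n) :=
  map2_mx *%R A B.

Section ComplexAnalysis.
Context {R : realType}.

Definition imag_unit : R[i] := 0 +i* 1.

Definition cexp (z : R[i]) : R[i] :=
  (expR (complex.Re z))%:C
    * (cos (complex.Im z) +i* sin (complex.Im z)).

Definition cintegral (D : set R) (f : R -> R[i]) : R[i] :=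
  Rintegral lebesgue_measure D (fun u => complex.Re (f u))
  +i* Rintegral lebesgue_measure D (fun u => complex.Im (f u)).

Definition cderive1 (f : R -> R[i]) (u : R) : R[i] :=
  derive1 (fun v => complex.Re (f v)) u
  +i* derive1 (fun v => complex.Im (f v)) u.

Definition C1 (f : R -> R) :=
  (forall u, derivable f u 1) /\ continuous (derive1 f).

Definition cC1 (f : R -> R[i]) :=
  C1 (fun u => complex.Re (f u)) /\ C1 (fun u => complex.Im (f u)).

(* A function is of class C^1 on a segment (with one-sided derivatives at the
   endpoints) iff it is the restriction of a C^1 function on the line. *)
Definition piecewise_C1 (gam : R -> R[i]) :=
  exists (n : nat) (tau : nat -> R),
    [/\ tau 0 = 0, tau n = 1,
        (forall k, (k < n)%N -> tau k < tau k.+1) &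
        (forall k, (k < n)%N ->
           exists2 phi : R -> R[i], cC1 phi &
             forall u, tau k <= u <= tau k.+1 -> gam u = phi u)].

Definition simple_closed_path (gam : R -> R[i]) :=
  [/\ piecewise_C1 gam, gam 0 = gam 1 &
      forall u v : R, 0 <= u < 1 -> 0 <= v < 1 -> gam u = gam v -> u = v].

Definition path_integral (gam : R -> R[i]) (f : R[i] -> R[i]) : R[i] :=
  cintegral `[0, 1] (fun u => f (gam u) * cderive1 gam u).

Definition on_path (gam : R -> R[i]) (z : R[i]) :=
  exists2 u, 0 <= u <= 1 & gam u = z.

Definition winding (gam : R -> R[i]) (z : R[i]) : R[i] :=
  (2 * pi%:C * imag_unit)^-1 * path_integral gam (fun w => (w - z)^-1).

(* gam is a positively oriented simple closed path that encloses the
   eigenvalues of A and that lies, with its inside, in the domain D. *)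
Definition admissible_path (D : set R[i]) n (A : 'M[R[i]]_n)
    (gam : R -> R[i]) :=
  [/\ simple_closed_path gam,
      forall z, on_path gam z -> D z,
      forall z, ~ on_path gam z -> winding gam z != 0 -> D z &
      forall z, eigenvalue A z -> ~ on_path gam z /\ winding gam z = 1].

(* f(A) = (2 pi i)^-1 \oint_gam f(w) (w I - A)^-1 dw *)
Definition mxfun (gam : R -> R[i]) (f : R[i] -> R[i]) n (A : 'M[R[i]]_n) :
    'M[R[i]]_n :=
  \matrix_(i, j) ((2 * pi%:C * imag_unit)^-1 *
    path_integral gam (fun w => f w * invmx (w%:M - A) i j)).

Definition laplace (h : R -> R[i]) (s : R[i]) : R[i] :=
  cintegral `[0, +oo[ (fun u => cexp (- s * u%:C) * h u).

Definition right_half_plane : set R[i] := [set w | 0 < complex.Re w].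

End ComplexAnalysis.

Section Markov.
Context {R : realType}.

Definition sub_intensity n (T : 'M[R]_n) :=
  (forall i j, i != j -> 0 <= T i j) /\ (forall i, \sum_j T i j <= 0).

(* Pt is a standard transition function, with intensity matrix Lam = Pt'(0+) *)
Record transition_function n (Lam : 'M[R]_n) (Pt : R -> 'M[R]_n) : Prop := {
  transition_ge0 : forall (t : R) i j, 0 <= t -> 0 <= Pt t i j ;
  transition_sum1 : forall (t : R) i, 0 <= t -> \sum_j Pt t i j = 1 ;
  transition_0 : Pt 0 = 1%:M ;
  transition_semigroup : forall s t : R, 0 <= s -> 0 <= t ->
    Pt (s + t) = Pt s *m Pt t ;
  transition_intensity : forall i j,
    (fun h : R => h^-1 * (Pt h i j - (i == j)%:R)) @ 0^'+ --> Lam i j }.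

(* finite expected total sojourn time in i of the chain started at i *)
Definition transient n (Pt : R -> 'M[R]_n) (i : 'I_n) :=
  (\int[lebesgue_measure]_(u in `[0%R, +oo[) (Pt u i i)%:E < +oo)%E.

(* Only times t >= 0 are meaningful.  The Markov property conditions on the
   finite-dimensional events {Z_(q.1) = q.2 for all q in past}, which generate
   the past up to time s. *)
Record markov_jump_process d (Omega : measurableType d)
    (P : probability Omega R) n (Pt : R -> 'M[R]_n)
    (Z : R -> Omega -> 'I_n) : Prop := {
  mjp_measurable : forall (t : R) i, 0 <= t ->
    measurable [set om | Z t om = i] ;
  mjp_right_continuous : forall om (t : R), 0 <= t ->
    \forall s \near t^'+, Z s om = Z t om ;
  mjp_left_limit : forall om (t : R), 0 < t ->
    exists i, \forall s \near t^'-, Z s om = i ;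
  mjp_markov : forall (s t : R) (past : seq (R * 'I_n)) (i j : 'I_n),
    0 <= s -> 0 <= t -> (forall q, q \in past -> 0 <= q.1 <= s) ->
    (P [set om | [/\ forall q, q \in past -> Z q.1 om = q.2,
                     Z s om = i & Z (s + t)%R om = j]]
     = P [set om | (forall q, q \in past -> Z q.1 om = q.2) /\ Z s om = i]
       * (Pt t i j)%:E)%E }.

End Markov.

Section TimeChange.
Context {R : realType}.

Definition exit_rates p (T : 'M[R]_p) : 'cV[R]_p := - (T *m const_mx 1).

Definition phase_intensity p (T : 'M[R]_p) : 'M[R]_(p + 1) :=
  block_mx T (exit_rates T) 0 0.

Definition transient_state p (k : 'I_p) : 'I_(p + 1) := lshift 1 k.
Definition absorbing_state p : 'I_(p + 1) := rshift p ord0.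

(* The derivatives are required on ]0, +oo[ only: the (one-sided) derivative
   at the null set {0} plays no role. *)
Record time_change (g ginv : R -> R) : Prop := {
  tc_ge0 : forall u : R, 0 <= u -> 0 <= g u ;
  tc_inv_ge0 : forall u : R, 0 <= u -> 0 <= ginv u ;
  tc_increasing : forall u v : R, 0 <= u -> u < v -> g u < g v ;
  tc_0 : g 0 = 0 ;
  tc_invK : forall u : R, 0 <= u -> ginv (g u) = u ;
  tc_K : forall u : R, 0 <= u -> g (ginv u) = u ;
  tc_derivable : forall u : R, 0 < u -> derivable g u 1 ;
  tc_inv_derivable : forall u : R, 0 < u -> derivable ginv u 1 ;
  tc_integral : forall t : R, 0 <= t ->
    ((g t)%:E = \int[lebesgue_measure]_(u in `[0%R, t])
       (derive1 g u)%:E)%E ;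
  tc_inv_integral : forall t : R, 0 <= t ->
    ((ginv t)%:E = \int[lebesgue_measure]_(u in `[0%R, t])
       (derive1 ginv u)%:E)%E }.

Definition unit_row p (k : 'I_p) : 'rV[R]_p := delta_mx 0 k.

(* None is the cemetery state *)
Definition changed_process p (Omega : Type) (Z : R -> Omega -> 'I_(p + 1))
    (ginv : R -> R) (t : R) (om : Omega) : option 'rV[R]_p :=
  match fintype.split (Z (ginv t) om) with
  | inl k => Some (unit_row k)
  | inr _ => None
  end.

Definition h1 (r : R) (g : R -> R) (u : R) : R[i] :=
  (r * expR (- r * g u) * derive1 g u)%:C.

Definition h2 (w : R[i]) (ginv : R -> R) (u : R) : R[i] :=
  w * cexp (- w * (ginv u)%:C) * (derive1 ginv u)%:C.

End TimeChange.

Section Payments.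
Context {R : realType}.

(* X takes its values in a set that is finite, hence sigma(X_s) is generated
   by the events {X_s = x}. *)
Definition natural_filtration (Omega E : Type) (X : R -> Omega -> E) (t : R) :
    set (set Omega) :=
  <<s [set A | exists (s : R) (x : E), 0 <= s <= t /\
        A = [set om | X s om = x]] >>.

(* Y is a version of the conditional expectation E[V | G] *)
Definition is_cond_exp d (Omega : measurableType d) (P : probability Omega R)
    (G : set (set Omega)) (V : Omega -> \bar R) (Y : Omega -> R) :=
  [/\ P.-integrable setT V,
      P.-integrable setT (EFin \o Y),
      (forall A : set R, measurable A -> G (Y @^-1` A)) &
      forall A, G A ->
        (\int[P]_(om in A) V om = \int[P]_(om in A) (Y om)%:E)%E].

Definition jump_times (Omega E : Type) (X : R -> Omega -> E) (x y : E)
    (om : Omega) : set R :=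
  [set s | [/\ 0 < s, \forall u \near s^'-, X u om = x & X s om = y]].

(* \int_0^oo e^(-r s) dN_s, where N_t is the number of elements in ]0, t] of
   the set of jump times: the Stieltjes integral against the pure jump process
   N is the sum over the jump times. *)
Definition discounted_jumps (Omega E : Type) (X : R -> Omega -> E) (r : R)
    (x y : E) (om : Omega) : \bar R :=
  \esum_(s in jump_times X x y om) (expR (- r * s))%:E.

(* \int_0^oo e^(-r s) dB_s *)
Definition discounted_payments p (Omega : Type)
    (X : R -> Omega -> option 'rV[R]_p) (r : R) (a c : 'cV[R]_p)
    (B : 'M[R]_p) (b : 'cV[R]_p) (om : Omega) : \bar R :=
  (\int[lebesgue_measure]_(s in `[0%R, +oo[)
      (expR (- r * s) * \sum_(i < p)
         (X s om == Some (unit_row i))%:R * (a i 0 - c i 0))%:E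
   + \sum_(i < p) \sum_(j < p | j != i) (B i j)%:E *
       discounted_jumps X r (Some (unit_row i)) (Some (unit_row j)) om
   + \sum_(i < p) (b i 0%R)%:E *
       discounted_jumps X r (Some (unit_row i)) None om)%E.

End Payments.

(* Main.v *)
Require Import Defs.
From HB Require Import structures.
From mathcomp Require Import all_boot all_order all_algebra.
From mathcomp Require Import complex.
From mathcomp Require Import all_classical all_reals all_analysis.
From mathcomp Require Import measurable_realfun.
From mathcomp Require Import ring lra.

(** The block Q(t) of the transition function on the transient states is a
    matrix semigroup with generator T, and absorption occurs from state i at
    rate t_i. Given Z_0 = k, Tonelli's theorem gives the discounted annuity paid
    in state i as int e^(-rs) Q_ki(g^-1(s)) ds. The discounted jumps from i to j
    are, on the clock of Z, a sum of e^(-rg(v)) over the jump times v; it is the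
    limit of its restrictions to the grids m/(n+1), whose expectations are
    Riemann sums of T_ij int e^(-rg(u)) Q_ki(u) du. On a bounded horizon the
    convergence is dominated by the sum over all jumps, which is integrable by
    Fatou's lemma.

    On the analytic side, Fubini's theorem reduces the matrix functions to the
    contour integrals M(t) of e^(-tw) (w - A)^-1, with A = -T. The resolvent is
    expanded in Newton form at the eigenvalues of A, so that only integrals of
    rational functions occur and M(0) = 2 pi i follows from partial fractions
    and winding numbers. As M' = T M, comparison with Q along small steps gives
    M(t) = 2 pi i Q(t); the change of variable s = g(u) then matches the two
    sides. *)

Set Implicit Arguments.
Unset Strict Implicit.
Unset Printing Implicit Defensive.

Import Order.TTheory GRing.Theory Num.Theory.
Import numFieldNormedType.Exports.
Local Open Scope classical_set_scope.
Local Open Scope ring_scope.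
Local Open Scope complex_scope.

(** For [Z] only finite-dimensional laws and path regularity are given; neither an embedded chain
    nor a compensator of the jump counts is at hand. Grid sums look at [Z] at two consecutive grid
    times only, so their expectations follow from the Markov property, and compactness of a bounded
    horizon ties the grid to the actual jumps of a path. How fine the grid must be depends on the
    path, whereas domination has to hold for every mesh. A coarse cell may hide several jumps, and a
    change from i to j need not contain a jump from i to j: this is why the dominating sum runs over
    all pairs of states.

    The contour is compact in the open right half-plane, so the real part has a positive minimum e
    on it. This e gives the decay of e^(-tw), hence that of Q, hence convergence on the half-line
    and the domination behind Fubini's theorem. The Lipschitz bound of Q and its measurability in
    time are also read off M. Closed integrals vanish by explicit primitives, a device that suits
    paths that are merely piecewise smooth. *)

Local Notation Re := complex.Re.
Local Notation Im := complex.Im.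

(** * Complex numbers and complex-valued functions: derivatives, measurability, integrals,
    continuity *)

Section ComplexParts.
Context {R : realType}.
Implicit Types x y z : R[i].

Lemma ReD x y : Re (x + y) = Re x + Re y. Proof. by case: x; case: y. Qed.
Lemma ImD x y : Im (x + y) = Im x + Im y. Proof. by case: x; case: y. Qed.
Lemma ReN x : Re (- x) = - Re x. Proof. by case: x. Qed.
Lemma ImN x : Im (- x) = - Im x. Proof. by case: x. Qed.
Lemma ReM x y : Re (x * y) = Re x * Re y - Im x * Im y.
Proof. by case: x; case: y. Qed.
Lemma ImM x y : Im (x * y) = Re x * Im y + Im x * Re y.
Proof. by case: x; case: y. Qed.
Lemma ReV x : Re x^-1 = Re x / (Re x ^+ 2 + Im x ^+ 2).
Proof. by case: x. Qed.
Lemma ImV x : Im x^-1 = - Im x / (Re x ^+ 2 + Im x ^+ 2).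
Proof. by case: x => a b; rewrite /= mulNr. Qed.

Definition ReImE := (ReD, ImD, ReN, ImN, ReM, ImM).

Lemma complexP x y : Re x = Re y -> Im x = Im y -> x = y.
Proof. by case: x; case: y => a b c d /= -> ->. Qed.

Lemma normc2_gt0 x : x != 0 -> 0 < Re x ^+ 2 + Im x ^+ 2.
Proof.
move=> x0; rewrite lt_neqAle addr_ge0 ?sqr_ge0// andbT eq_sym.
by rewrite paddr_eq0 ?sqr_ge0// !sqrf_eq0; move: x0; rewrite eq_complex.
Qed.

(* Submultiplicative, and with values in R, unlike the norm of R[i]. *)
Definition cabs z : R := `|Re z| + `|Im z|.

Lemma cabs_ge0 z : 0 <= cabs z. Proof. exact: addr_ge0. Qed.

Lemma cabs0 : cabs 0 = 0. Proof. by rewrite /cabs /= normr0 addr0. Qed.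

Lemma cabs_eq0 z : cabs z <= 0 -> z = 0.
Proof.
move=> h; have := normr_ge0 (Re z); have := normr_ge0 (Im z).
move: h; rewrite /cabs => h1 h2 h3.
apply: complexP; apply/eqP; rewrite -normr_eq0 eq_le normr_ge0 andbT; lra.
Qed.

Lemma cabsN z : cabs (- z) = cabs z.
Proof. by rewrite /cabs !ReImE !normrN. Qed.

Lemma cabsD x y : cabs (x + y) <= cabs x + cabs y.
Proof.
rewrite /cabs !ReImE; have := ler_normD (Re x) (Re y).
have := ler_normD (Im x) (Im y); lra.
Qed.

Lemma cabsM x y : cabs (x * y) <= cabs x * cabs y.
Proof.
rewrite /cabs !ReImE; have := ler_normB (Re x * Re y) (Im x * Im y).
have := ler_normD (Re x * Im y) (Im x * Re y); rewrite !normrM; lra.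
Qed.

Lemma cabs_real (a : R) : cabs a%:C = `|a|.
Proof. by rewrite /cabs /= normr0 addr0. Qed.

Lemma normRe_cabs z : `|Re z| <= cabs z. Proof. by rewrite lerDl. Qed.
Lemma normIm_cabs z : `|Im z| <= cabs z. Proof. by rewrite lerDr. Qed.

Lemma cabs_sum (I : Type) (s : seq I) (Q : pred I) (F : I -> R[i]) :
  cabs (\sum_(i <- s | Q i) F i) <= \sum_(i <- s | Q i) cabs (F i).
Proof.
elim/big_rec2: _ => [|i y x _ h]; first by rewrite cabs0.
by rewrite (le_trans (cabsD _ _))// lerD2l.
Qed.

Lemma Re_cexp z : Re (cexp z) = expR (Re z) * cos (Im z).
Proof. by rewrite /cexp ReM /= mul0r subr0. Qed.

Lemma Im_cexp z : Im (cexp z) = expR (Re z) * sin (Im z).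
Proof. by rewrite /cexp ImM /= mul0r addr0. Qed.

Lemma cexp0 : cexp 0 = 1 :> R[i].
Proof.
by apply: complexP; rewrite ?Re_cexp ?Im_cexp/= expR0 ?cos0 ?sin0 ?mulr1 ?mulr0.
Qed.

Lemma cexpD x y : cexp (x + y) = cexp x * cexp y.
Proof.
by apply: complexP; rewrite !(ReImE, Re_cexp, Im_cexp) expRD
  ?cosD ?sinD; ring.
Qed.

(** The factor 2 comes from the l1 form of [cabs]: cosine and sine are bounded by 1 separately. *)
Lemma cabs_cexp z : cabs (cexp z) <= 2 * expR (Re z).
Proof.
rewrite /cabs Re_cexp Im_cexp !normrM (ger0_norm (expR_ge0 _)).
have := expR_ge0 (Re z).
have hc : `|cos (Im z)| <= 1 by rewrite ler_norml cos_geN1 cos_le1.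
have hs : `|sin (Im z)| <= 1 by rewrite ler_norml sin_geN1 sin_le1.
nra.
Qed.

End ComplexParts.

Section ComplexDerivative.
Context {R : realType}.
Implicit Types (h k : R -> R[i]) (u : R) (d e : R[i]).

(** Derivative of a curve in the plane, componentwise. Complex differentiability is not introduced:
    a holomorphic function is handled through its chain rule along such curves. *)
Definition is_cderive h u d :=
  is_derive u 1 (fun v => Re (h v)) (Re d) /\
  is_derive u 1 (fun v => Im (h v)) (Im d).

Lemma is_cderive_cst (z : R[i]) u : is_cderive (fun=> z) u 0.
Proof. by split; exact: is_derive_cst. Qed.

Lemma is_cderive_eq h u d d' : is_cderive h u d -> d = d' -> is_cderive h u d'.
Proof. by move=> ? <-. Qed.

Lemma is_cderive_ext h k u d :
  h =1 k -> is_cderive h u d -> is_cderive k u d.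
Proof. by move=> /funext ->. Qed.

Lemma is_cderiveD h k u d e : is_cderive h u d -> is_cderive k u e ->
  is_cderive (fun v => h v + k v) u (d + e).
Proof.
move=> [h1 h2] [k1 k2]; split.
  rewrite (_ : (fun _ => _) = (fun v => Re (h v)) + (fun v => Re (k v))).
    by rewrite ReD; exact: is_deriveD.
  by apply/funext => v; rewrite ReD.
rewrite (_ : (fun _ => _) = (fun v => Im (h v)) + (fun v => Im (k v))).
  by rewrite ImD; exact: is_deriveD.
by apply/funext => v; rewrite ImD.
Qed.

Lemma is_cderiveM h k u d e : is_cderive h u d -> is_cderive k u e ->
  is_cderive (fun v => h v * k v) u (d * k u + h u * e).
Proof.
move=> [h1 h2] [k1 k2]; split.
  rewrite (_ : (fun _ => _) =
    (fun v => Re (h v)) * (fun v => Re (k v))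
      - (fun v => Im (h v)) * (fun v => Im (k v))); last first.
    by apply/funext => v; rewrite ReM.
  apply: is_derive_eq; rewrite !ReImE /GRing.scale /=; ring.
rewrite (_ : (fun _ => _) =
  (fun v => Re (h v)) * (fun v => Im (k v))
    + (fun v => Im (h v)) * (fun v => Re (k v))); last first.
  by apply/funext => v; rewrite ImM.
apply: is_derive_eq; rewrite !ReImE /GRing.scale /=; ring.
Qed.

Lemma is_cderiveV h u d : h u != 0 -> is_cderive h u d ->
  is_cderive (fun v => (h v)^-1) u (- d / h u ^+ 2).
Proof.
move=> hu [h1 h2].
(* [N] is the squared modulus of h: the real and imaginary parts of the inverse are quotients by
   it. *)
pose N := (fun v => Re (h v)) * (fun v => Re (h v))
      + (fun v => Im (h v)) * (fun v => Im (h v)).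
have Nu : N u != 0.
  by rewrite gt_eqF// /N /= -!expr2; exact: normc2_gt0.
have dN : is_derive u 1 N (2 * (Re (h u) * Re d + Im (h u) * Im d)).
  apply: is_derive_eq; rewrite /GRing.scale /=; ring.
have dV := is_deriveV Nu dN.
have NE : N u = Re (h u) * Re (h u) + Im (h u) * Im (h u) by [].
have [HR HI] : Re (- d / h u ^+ 2) = Re d * (N u)^-1
      - Re (h u) * (2 * (Re (h u) * Re d + Im (h u) * Im d)) * (N u ^+ 2)^-1 /\
   Im (- d / h u ^+ 2) = - Im d * (N u)^-1
      + Im (h u) * (2 * (Re (h u) * Re d + Im (h u) * Im d)) * (N u ^+ 2)^-1.
  move: Nu; rewrite NE expr2 !(ReImE, ReV, ImV).
  case: (h u) => a b; case: d {h1 h2 dN dV} => c e /= ab.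
  (* [field] meets the squared modulus of [h u ^+ 2], which is the square of that of [h u]. *)
  have ab4 : (a * a - b * b) ^+ 2 + (a * b + b * a) ^+ 2 != 0.
    rewrite (_ : _ + _ = (a * a + b * b) ^+ 2); last by ring.
    by rewrite expf_neq0.
  by split; field; rewrite ab ab4.
split.
- rewrite (_ : (fun _ => _) = (fun v => Re (h v)) * (fun v => (N v)^-1)); last first.
    by apply/funext => v; rewrite ReV.
  apply: is_derive_eq; rewrite HR /GRing.scale /=; ring.
- rewrite (_ : (fun _ => _) = - ((fun v => Im (h v)) * (fun v => (N v)^-1))); last first.
    by apply/funext => v; rewrite ImV mulNr.
  apply: is_derive_eq; rewrite HI /GRing.scale /=; ring.
Qed.

Lemma is_cderive_cexp h u d : is_cderive h u d ->
  is_cderive (fun v => cexp (h v)) u (cexp (h u) * d).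
Proof.
move=> [h1 h2].
have dE := is_derive1_comp (is_derive_expR (Re (h u))) h1.
have dC := is_derive1_comp (is_derive_cos (Im (h u))) h2.
have dS := is_derive1_comp (is_derive_sin (Im (h u))) h2.
split.
- rewrite (_ : (fun _ => _) = (expR \o (fun v => Re (h v)))
    * (cos \o (fun v => Im (h v)))); last first.
    by apply/funext => v; rewrite Re_cexp.
  apply: is_derive_eq; rewrite ReM Re_cexp Im_cexp /GRing.scale /=; ring.
- rewrite (_ : (fun _ => _) = (expR \o (fun v => Re (h v)))
    * (sin \o (fun v => Im (h v)))); last first.
    by apply/funext => v; rewrite Im_cexp.
  apply: is_derive_eq; rewrite ImM Re_cexp Im_cexp /GRing.scale /=; ring.
Qed.

Lemma is_cderiveX h u d n : is_cderive h u d ->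
  is_cderive (fun v => h v ^+ n.+1) u (n.+1%:R * h u ^+ n * d).
Proof.
move=> hd; elim: n => [|n ih]; first by rewrite expr0 !mul1r.
apply: (@is_cderive_ext (fun v => h v * h v ^+ n.+1)).
  by move=> v; rewrite [RHS]exprS.
apply: is_cderive_eq (is_cderiveM hd ih) _.
by rewrite [h u ^+ n.+1]exprS -!natr1; ring.
Qed.

End ComplexDerivative.

Section ComplexMeasurable.
Context {R : realType} {d} {T : measurableType d}.
Implicit Types (D : set T) (h k : T -> R[i]) (z : R[i]).

Definition cmeasurable D h :=
  measurable_fun D (fun u => Re (h u)) /\ measurable_fun D (fun u => Im (h u)).

Lemma cmeasurable_cst D z : cmeasurable D (fun=> z).
Proof. by split; exact: measurable_cst. Qed.

Lemma cmeasurableM D h k :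
  cmeasurable D h -> cmeasurable D k -> cmeasurable D (fun u => h u * k u).
Proof.
move=> [h1 h2] [k1 k2]; split; under eq_fun do rewrite ReImE.
  by apply: measurable_funB; exact: measurable_funM.
by apply: measurable_funD; exact: measurable_funM.
Qed.

Lemma cmeasurable_cexp D h : cmeasurable D h -> cmeasurable D (fun u => cexp (h u)).
Proof.
move=> [h1 h2]; split; under eq_fun do rewrite ?Re_cexp ?Im_cexp.
  apply: measurable_funM; apply: measurableT_comp => //.
  by apply: continuous_measurable_fun; exact: continuous_cos.
apply: measurable_funM; apply: measurableT_comp => //.
by apply: continuous_measurable_fun; exact: continuous_sin.
Qed.

Lemma cmeasurable_real D (a : T -> R) :
  measurable_fun D a -> cmeasurable D (fun u => (a u)%:C).
Proof. by split => //; exact: measurable_cst. Qed.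

End ComplexMeasurable.

Section ComplexIntegral.
Context {R : realType}.
Implicit Types (D : set (measurableTypeR R)) (f h k : R -> R[i]) (z : R[i]).
Local Notation mu := (@lebesgue_measure R).

Definition cintegrable D h :=
  mu.-integrable D (EFin \o (fun u => Re (h u))) /\
  mu.-integrable D (EFin \o (fun u => Im (h u))).

Lemma cintegrable_dominated D h (b : R -> R) : measurable D ->
  cmeasurable D h -> mu.-integrable D (EFin \o b) ->
  (forall u, D u -> cabs (h u) <= b u) -> cintegrable D h.
Proof.
move=> mD [h1 h2] ib hb; split; apply: le_integrable ib => //=;
  try by [apply/measurable_EFinP]; move=> u Du; rewrite lee_fin.
  by apply: le_trans (normRe_cabs _) (le_trans (hb _ Du) (ler_norm _)).
by apply: le_trans (normIm_cabs _) (le_trans (hb _ Du) (ler_norm _)).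
Qed.

Lemma cintegrableD D h k : measurable D -> cintegrable D h -> cintegrable D k ->
  cintegrable D (fun u => h u + k u).
Proof.
move=> mD [h1 h2] [k1 k2]; split.
  apply: eq_integrable (integrableD mD h1 k1) => // u _.
  by rewrite /= ReImE EFinD.
apply: eq_integrable (integrableD mD h2 k2) => // u _.
by rewrite /= ReImE EFinD.
Qed.

Lemma cintegrableZ D h z : measurable D -> cintegrable D h ->
  cintegrable D (fun u => z * h u).
Proof.
move=> mD [h1 h2]; split.
  apply: eq_integrable (integrableB mD (integrableZl mD (Re z) h1)
    (integrableZl mD (Im z) h2)) => // u _.
  by rewrite /= ReImE EFinB !EFinM.
apply: eq_integrable (integrableD mD (integrableZl mD (Re z) h2)
  (integrableZl mD (Im z) h1)) => // u _.
by rewrite /= ReImE EFinD !EFinM.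
Qed.

Lemma eq_cintegral D h k : {in D, h =1 k} -> cintegral D h = cintegral D k.
Proof.
by move=> hk; rewrite /cintegral; congr (_ +i* _);
  apply: eq_Rintegral => u Du; rewrite hk.
Qed.

Lemma cintegralD D h k : measurable D -> cintegrable D h -> cintegrable D k ->
  cintegral D (fun u => h u + k u) = cintegral D h + cintegral D k.
Proof.
move=> mD [h1 h2] [k1 k2]; apply: complexP; rewrite /= -RintegralD//;
  by apply: eq_Rintegral => u _; rewrite ReImE.
Qed.

Lemma integrableZl_real D (k : R -> R) (a : R) : measurable D ->
  mu.-integrable D (EFin \o k) -> mu.-integrable D (EFin \o (fun u => a * k u)).
Proof.
move=> mD ik; by apply: eq_integrable (integrableZl mD a ik).
Qed.

Lemma cintegralZ D h z : measurable D -> cintegrable D h ->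
  cintegral D (fun u => z * h u) = z * cintegral D h.
Proof.
move=> mD [h1 h2]; apply: complexP; rewrite [in RHS]ReImE /= -!RintegralZl//.
  rewrite -RintegralB//; try exact: integrableZl_real.
  by apply: eq_Rintegral => u _; rewrite ReImE.
rewrite -RintegralD//; try exact: integrableZl_real.
by apply: eq_Rintegral => u _; rewrite ReImE.
Qed.

Lemma cintegral_sum D (I : Type) (s : seq I) (F : I -> R -> R[i]) : measurable D ->
  (forall i, cintegrable D (F i)) ->
  cintegrable D (fun u => \sum_(i <- s) F i u) /\
  cintegral D (fun u => \sum_(i <- s) F i u) = \sum_(i <- s) cintegral D (F i).
Proof.
move=> mD hF; elim: s => [|i s [ih1 ih2]].
  have i0 : cintegrable D (fun=> 0 : R[i]) by split; exact: integrable0.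
  under eq_fun do rewrite big_nil.
  rewrite big_nil; split=> //; rewrite -[RHS](mul0r (cintegral D (fun=> 0))).
  by rewrite -cintegralZ//; apply: eq_cintegral => u _; rewrite mul0r.
under eq_fun do rewrite big_cons.
rewrite big_cons -ih2 cintegralD//; split=> //.
exact: cintegrableD.
Qed.

Lemma lebesgue_measure_segment (a b : R) : a <= b ->
  mu `[a, b]%classic = (b - a)%:E.
Proof.
rewrite lebesgue_measure_itv /= lte_fin.
by case: ltgtP => // -> _; rewrite subrr.
Qed.

Lemma cabs_cintegral_le (a b M : R) h : a <= b ->
  cintegrable `[a, b] h -> (forall u, a <= u <= b -> cabs (h u) <= M) ->
  cabs (cintegral `[a, b] h) <= 2 * (M * (b - a)).
Proof.
move=> ab [h1 h2] hM.
have key (k : R -> R) : mu.-integrable `[a, b] (EFin \o k) ->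
    (forall u, a <= u <= b -> `|k u| <= M) ->
    `|Rintegral mu `[a, b] k| <= M * (b - a).
  move=> ik kM; apply: le_trans (le_normr_Rintegral _ ik) _ => //.
  apply: (@le_trans _ _ (\int[mu]_(u in `[a, b]) M)%R).
    apply: le_Rintegral => //; first exact: integrable_norm.
      apply: continuous_compact_integrable; first exact: segment_compact.
      by move=> x; exact: cvg_cst.
  by rewrite Rintegral_cst//= lebesgue_measure_segment.
have hr := key _ h1 (fun u hu => le_trans (normRe_cabs _) (hM u hu)).
have hi := key _ h2 (fun u hu => le_trans (normIm_cabs _) (hM u hu)).
by rewrite /cabs /= mulr2n mulrDl mul1r lerD.
Qed.

End ComplexIntegral.

Section ComplexContinuity.
Context {R : realType}.
Implicit Types (D : set R) (h k : R -> R[i]) (z : R[i]).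

Definition ccontinuous D h :=
  {within D, continuous (fun u => Re (h u))} /\
  {within D, continuous (fun u => Im (h u))}.

Lemma ccontinuous_cst D z : ccontinuous D (fun=> z).
Proof. by split=> u; exact: cvg_cst. Qed.

Lemma ccontinuousD D h k :
  ccontinuous D h -> ccontinuous D k -> ccontinuous D (fun u => h u + k u).
Proof.
move=> [h1 h2] [k1 k2]; split=> u; under eq_fun do rewrite ReImE.
  by apply: cvgD; [exact: h1|exact: k1].
by apply: cvgD; [exact: h2|exact: k2].
Qed.

Lemma ccontinuousM D h k :
  ccontinuous D h -> ccontinuous D k -> ccontinuous D (fun u => h u * k u).
Proof.
move=> [h1 h2] [k1 k2]; split=> u; under eq_fun do rewrite ReImE.
  by apply: cvgB; apply: cvgM; [exact: h1|exact: k1|exact: h2|exact: k2].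
by apply: cvgD; apply: cvgM; [exact: h1|exact: k2|exact: h2|exact: k1].
Qed.

Lemma ccontinuous_sum D (I : Type) (s : seq I) (F : I -> R -> R[i]) :
  (forall i, ccontinuous D (F i)) -> ccontinuous D (fun u => \sum_(i <- s) F i u).
Proof.
move=> hF; elim: s => [|i s ih]; under eq_fun do rewrite ?big_nil ?big_cons.
  exact: ccontinuous_cst.
exact: ccontinuousD.
Qed.

Lemma ccontinuous_cexp D h : ccontinuous D h -> ccontinuous D (fun u => cexp (h u)).
Proof.
move=> [h1 h2]; split=> u; under eq_fun do rewrite ?Re_cexp ?Im_cexp.
  apply: cvgM.
    by apply: (continuous_comp (h1 u)); exact: continuous_expR.
  by apply: (continuous_comp (h2 u)); exact: continuous_cos.
apply: cvgM.
  by apply: (continuous_comp (h1 u)); exact: continuous_expR.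
by apply: (continuous_comp (h2 u)); exact: continuous_sin.
Qed.

Lemma ccontinuousV D h : (forall u, D u -> h u != 0) ->
  ccontinuous D h -> ccontinuous D (fun u => (h u)^-1).
Proof.
move=> h0 [h1 h2].
have hN : {within D, continuous (fun u => (Re (h u) ^+ 2 + Im (h u) ^+ 2)^-1)}.
  apply/subspace_continuousP => u Du.
  have Nu : Re (h u) ^+ 2 + Im (h u) ^+ 2 != 0.
    by rewrite gt_eqF//; apply: normc2_gt0; exact: h0.
  apply: cvgV => //; apply: cvgD; rewrite -?expr2;
    under eq_fun do rewrite expr2; rewrite expr2; apply: cvgM;
    by move: u Du {Nu}; apply/subspace_continuousP.
split=> u; under eq_fun do rewrite ?ReV ?ImV.
  by apply: cvgM; [exact: h1|exact: hN].
by apply: cvgM; [apply: cvgN; exact: h2|exact: hN].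
Qed.

Lemma ccontinuous_cmeasurable D h :
  measurable D -> ccontinuous D h -> cmeasurable D h.
Proof.
by move=> mD [? ?]; split; exact: subspace_continuous_measurable_fun.
Qed.

Lemma ccontinuous_bounded (a b : R) h : ccontinuous `[a, b] h ->
  exists M : R, forall u, a <= u <= b -> cabs (h u) <= M.
Proof.
move=> [h1 h2].
have key (k : R -> R) : {within `[a, b], continuous k} ->
    exists M : R, forall u, a <= u <= b -> `|k u| <= M.
  move=> ck; have /compact_bounded[M [_ hM]] :=
    continuous_compact ck (@segment_compact R a b).
  exists (M + 1) => u hu; apply: (hM (M + 1)); first by rewrite ltrDl.
  by exists u => //=; rewrite in_itv.
have [M1 hM1] := key _ h1; have [M2 hM2] := key _ h2.
by exists (M1 + M2) => u hu; rewrite lerD ?hM1 ?hM2.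
Qed.

Lemma eq_ccontinuous D h k : {in D, h =1 k} -> ccontinuous D h -> ccontinuous D k.
Proof.
move=> hk [h1 h2]; split.
  by apply: subspace_eq_continuous h1 => u Du /=; rewrite /from_subspace /= hk.
by apply: subspace_eq_continuous h2 => u Du /=; rewrite /from_subspace /= hk.
Qed.

Lemma ccontinuousU D1 D2 h : closed D1 -> closed D2 ->
  ccontinuous D1 h -> ccontinuous D2 h -> ccontinuous (D1 `|` D2) h.
Proof. by move=> ? ? [? ?] [? ?]; split; exact: withinU_continuous. Qed.

Lemma is_cderive_continuous h D (dh : R -> R[i]) :
  (forall u, D u -> is_cderive h u (dh u)) -> ccontinuous D h.
Proof.
move=> hd; split; apply: continuous_in_subspaceT => u /set_mem/hd[[d1 _] [d2 _]].
  exact/differentiable_continuous/derivable1_diffP.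
exact/differentiable_continuous/derivable1_diffP.
Qed.

Lemma cC1_is_cderive h u : cC1 h -> is_cderive h u (cderive1 h u).
Proof.
move=> [[h1 _] [h2 _]]; split; apply: DeriveDef => //=; exact/esym/derive1E.
Qed.

Lemma cC1_ccontinuous h D : cC1 h -> ccontinuous D h /\ ccontinuous D (cderive1 h).
Proof.
move=> hC; split.
  by apply: (@is_cderive_continuous _ _ (cderive1 h)) => u _; exact: cC1_is_cderive.
by case: hC => -[_ ?] [_ ?]; split; exact: continuous_subspaceT.
Qed.

End ComplexContinuity.

(** * Path integrals along piecewise smooth paths, and primitives *)

Section PathIntegral.
Context {R : realType}.
Implicit Types (gam : R -> R[i]) (f F : R[i] -> R[i]) (a b u : R).
Local Notation mu := (@lebesgue_measure R).

Lemma partition_ge0 (n : nat) (tau : nat -> R) : tau 0 = 0 ->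
  (forall k, (k < n)%N -> tau k < tau k.+1) ->
  forall k, (k <= n)%N -> 0 <= tau k.
Proof.
move=> t0 tS; elim=> [|k ih] kn; first by rewrite t0.
by rewrite ltW// (le_lt_trans (ih (ltnW kn)) (tS _ kn)).
Qed.

Lemma partition_le (n : nat) (tau : nat -> R) :
  (forall k, (k < n)%N -> tau k < tau k.+1) ->
  forall k l, (k <= l <= n)%N -> tau k <= tau l.
Proof.
move=> tS k; elim=> [|l ih] /andP[kl ln].
  by move: kl; rewrite leqn0 => /eqP ->.
move: kl; rewrite leq_eqVlt => /predU1P[->//|kl].
by rewrite (le_trans (ih _) (ltW (tS _ ln)))// -ltnS kl ltnW.
Qed.

(** Induction along the subdivision: [Q b] speaks of the path on [0, b] and passes from node to
    node, so that later proofs never handle the partition. *)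
Lemma piecewise_C1_ind gam (Q : R -> Prop) : piecewise_C1 gam -> Q 0 ->
  (forall a b (phi : R -> R[i]), 0 <= a -> a < b -> b <= 1 -> cC1 phi ->
     (forall u, a <= u <= b -> gam u = phi u) -> Q a -> Q b) -> Q 1.
Proof.
move=> [n [tau [t0 t1 tS tphi]]] Q0 QS.
suff H k : (k <= n)%N -> Q (tau k) by rewrite -t1; exact: H.
elim: k => [|k ih] kn; first by rewrite t0.
have [phi phiC hphi] := tphi _ kn.
apply: (QS (tau k) _ phi) => //; last exact/ih/ltnW.
- by apply: (partition_ge0 t0 tS); exact: ltnW.
- exact: tS.
- by rewrite -t1; apply: (partition_le tS); rewrite kn leqnn.
Qed.

(** The interval is open because [derive1] is two-sided: at a node it involves both adjacent pieces
    and can differ from the derivative of either. *)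
Lemma cderive1_eq_oo gam (phi : R -> R[i]) a b u : a < u < b ->
  (forall v, a <= v <= b -> gam v = phi v) -> cderive1 gam u = cderive1 phi u.
Proof.
move=> aub hphi.
have nearu : \near u, gam u = phi u.
  have : u \in `]a, b[ by rewrite in_itv.
  move=> /near_in_itvoo; apply: filterS => v; rewrite in_itv/= => /andP[av vb].
  by apply: hphi; rewrite !ltW.
rewrite /cderive1 !derive1E; congr (_ +i* _); apply: near_eq_derive => //;
  by apply: filterS nearu => v ->.
Qed.

Lemma piecewise_C1_ccontinuous gam : piecewise_C1 gam -> ccontinuous `[0, 1] gam.
Proof.
move=> gamC.
apply: (piecewise_C1_ind (Q := fun b => ccontinuous `[0, b] gam) gamC).
  by rewrite set_itv1; split; exact: continuous_subspace1.
move=> a b phi a0 ab b1 phiC hphi cgam.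
rewrite (@itv_bndbnd_setU _ _ _ (BLeft a))//; last by rewrite bnd_simp ltW.
suff : ccontinuous (`[0, a] `|` `[a, b]) gam.
  move=> [h1 h2]; split.
    apply: continuous_subspaceW h1; apply: setSU; apply: subset_itvl; rewrite bnd_simp//.
  by apply: continuous_subspaceW h2; apply: setSU; apply: subset_itvl; rewrite bnd_simp//.
apply: ccontinuousU => //; try exact: interval_closed.
apply: eq_ccontinuous (proj1 (cC1_ccontinuous _ phiC)) => u /set_mem /=.
by rewrite in_itv/= => /hphi.
Qed.

Lemma piecewise_C1_cderive1 gam : piecewise_C1 gam ->
  cmeasurable `[(0 : R), 1] (cderive1 gam) /\
  exists M : R, forall u, 0 <= u <= 1 -> cabs (cderive1 gam u) <= M.
Proof.
move=> gamC.
apply: (piecewise_C1_ind (Q := fun b => cmeasurable `[(0 : R), b] (cderive1 gam) /\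
  exists M : R, forall u, 0 <= u <= b -> cabs (cderive1 gam u) <= M) gamC).
  split; first by rewrite set_itv1; split; exact: measurable_fun_set1.
  exists (cabs (cderive1 gam 0)) => u u0.
  by have -> : u = 0 by apply/eqP; rewrite eq_le andbC.
move=> a b phi a0 ab b1 phiC hphi [[m1 m2] [M hM]]; split.
  have mpiece (h k : R -> R) : measurable_fun `[0, a] h -> continuous k ->
      (forall u, a < u < b -> h u = k u) -> measurable_fun `[0, b] h.
    move=> mh ck hk; apply/measurable_fun_itv_bndo_bndcP.
    rewrite (@itv_bndbnd_setU _ _ _ (BRight a)) ?bnd_simp//.
    apply/measurable_funU => //; split => //.
    apply: (eq_measurable_fun k) => [u /set_mem /=|].
      by rewrite in_itv/= => /hk.
    by apply: measurable_funTS; exact: continuous_measurable_fun.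
  case: (phiC) => -[_ c1] [_ c2].
  split; [apply: mpiece m1 c1 _|apply: mpiece m2 c2 _] => u aub;
    by rewrite (cderive1_eq_oo aub hphi).
have [M' hM'] := ccontinuous_bounded (proj2 (cC1_ccontinuous `[a, b] phiC)).
(* The derivative at the node b is controlled by neither piece, so its value enters the maximum by
   itself. *)
exists (Num.max (Num.max M M') (cabs (cderive1 gam b))) => u /andP[u0 ub].
rewrite !le_max; have [ua|au] := leP u a; first by rewrite hM ?u0.
move: ub; rewrite le_eqVlt => /predU1P[->|ub]; first by rewrite lexx orbT.
by rewrite (@cderive1_eq_oo _ phi a b)// ?au// hM' ?orbT// !ltW.
Qed.

Lemma path_integrand_integrable gam f : piecewise_C1 gam ->
  ccontinuous `[0, 1] (fun u => f (gam u)) ->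
  cintegrable `[0, 1] (fun u => f (gam u) * cderive1 gam u).
Proof.
move=> gamC fc; have [mg [M hM]] := piecewise_C1_cderive1 gamC.
have [M' hM'] := ccontinuous_bounded fc.
apply: (@cintegrable_dominated _ _ _ (fun=> M' * M)) => //.
- apply: cmeasurableM => //; exact: ccontinuous_cmeasurable.
- apply: continuous_compact_integrable; first exact: segment_compact.
  by move=> x; exact: cvg_cst.
- move=> u; rewrite /= in_itv/= => hu.
  by rewrite (le_trans (cabsM _ _))// ler_pM ?cabs_ge0 ?hM ?hM'.
Qed.

Lemma FTC2_cderive (h dh : R -> R[i]) a b : a < b -> ccontinuous `[a, b] dh ->
  (forall u, a <= u <= b -> is_cderive h u (dh u)) ->
  cintegral `[a, b] dh = h b - h a.
Proof.
move=> ab [c1 c2] hd.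
have key (k dk : R -> R) : {within `[a, b], continuous dk} ->
    (forall u, a <= u <= b -> is_derive u 1 k (dk u)) ->
    Rintegral mu `[a, b] dk = k b - k a.
  move=> ck hk.
  have kc u : a <= u <= b -> {for u, continuous k}.
    by move=> /hk[dk' _]; exact/differentiable_continuous/derivable1_diffP.
  rewrite /Rintegral (continuous_FTC2 (F := k) ab ck)//.
    split=> [u||].
      rewrite in_itv/= => /andP[au ub].
      by have /hk[] : a <= u <= b by rewrite !ltW.
      apply: cvg_at_right_filter; apply: kc; rewrite lexx ltW//.
    apply: cvg_at_left_filter; apply: kc; rewrite lexx ltW//.
  move=> u; rewrite in_itv/= => /andP[au ub].
  by have /hk[_ <-] : a <= u <= b; rewrite ?derive1E// !ltW.
by apply: complexP; rewrite !ReImE /=;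
  [apply: (key (fun u => Re (h u)))|apply: (key (fun u => Im (h u)))] => // u /hd[].
Qed.

(** The fundamental theorem of calculus on each piece, telescoped over the nodes. The hypothesis on
    F expresses F' = f as a chain rule along curves, at points of the path only. *)
Lemma path_integral_primitive gam f F : piecewise_C1 gam ->
  ccontinuous `[0, 1] (fun u => f (gam u)) ->
  (forall (phi : R -> R[i]) u d, 0 <= u <= 1 -> phi u = gam u ->
     is_cderive phi u d -> is_cderive (F \o phi) u (f (phi u) * d)) ->
  path_integral gam f = F (gam 1) - F (gam 0).
Proof.
move=> gamC fc hF; have ig := path_integrand_integrable gamC fc.
apply: (piecewise_C1_ind (Q := fun b => cintegral `[0, b]
  (fun u => f (gam u) * cderive1 gam u) = F (gam b) - F (gam 0)) gamC).
  by rewrite set_itv1 subrr; apply: complexP; rewrite /= Rintegral_set1.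
move=> a b phi a0 ab b1 phiC hphi IH.
set g := fun u => f (gam u) * cderive1 gam u in IH ig *.
pose k u := f (phi u) * cderive1 phi u.
have sab : `[a, b] `<=` `[0, 1]%classic.
  by apply: subset_itvScc => //; rewrite bnd_simp.
have kc : ccontinuous `[a, b] k.
  apply: ccontinuousM; last exact: (proj2 (cC1_ccontinuous _ phiC)).
  apply: (@eq_ccontinuous _ _ (fun u => f (gam u))) => [u /set_mem /=|].
    by rewrite in_itv/= => /hphi ->.
  by case: fc => ? ?; split; apply: continuous_subspaceW sab _.
have Fk : cintegral `[a, b] k = F (gam b) - F (gam a).
  rewrite (@FTC2_cderive (F \o phi))//=.
    by rewrite !hphi ?lexx ?ltW.
  move=> u /andP[au ub]; apply: hF; last exact: cC1_is_cderive.
    by rewrite (le_trans a0 au) (le_trans ub b1).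
  by rewrite hphi ?au.
(* The new piece is taken open at both ends, where the derivatives of [gam] and [phi] agree; its
   endpoints form a null set. *)
have split_ab (h : R -> R) : mu.-integrable `[0, 1] (EFin \o h) ->
    Rintegral mu `[0, b] h = Rintegral mu `[0, a] h + Rintegral mu `]a, b[ h.
  move=> ih; have ihb : mu.-integrable `[0, b] (EFin \o h).
    by apply: integrableS ih => //; apply: subset_itvl; rewrite bnd_simp//.
  rewrite Rintegral_itv_bndo_bndc; last first.
    by apply: integrableS ihb => //; apply: subset_itv; rewrite bnd_simp ?lexx.
  rewrite -(@Rintegral_itvB _ h (BLeft 0) (BRight b) a) ?bnd_simp// ?ltW//.
  by rewrite addrC subrK.
have eq_ab : cintegral `]a, b[ g = cintegral `]a, b[ k.
  apply: eq_cintegral => u /set_mem /=; rewrite in_itv/= => aub.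
  rewrite /g /k (cderive1_eq_oo aub hphi) hphi//.
  by case/andP: aub => *; rewrite !ltW.
have oocc (h : R -> R) : mu.-integrable `[a, b] (EFin \o h) ->
    Rintegral mu `]a, b[ h = Rintegral mu `[a, b] h.
  move=> ih; rewrite Rintegral_itv_obnd_cbnd; last first.
    apply: integrableS ih; [exact: measurable_itv|exact: measurable_itv|].
    exact: subset_itv_oo_cc.
  rewrite Rintegral_itv_bndo_bndc; last first.
    apply: integrableS ih; [exact: measurable_itv|exact: measurable_itv|].
    exact: subset_itv_co_cc.
  by [].
have -> : F (gam b) - F (gam 0) = cintegral `[0, a] g + cintegral `]a, b[ g.
  rewrite IH eq_ab (_ : cintegral `]a, b[ k = cintegral `[a, b] k).
    by rewrite Fk; ring.
  have ik : cintegrable `[a, b] k.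
    case: kc => k1 k2; split; apply: continuous_compact_integrable;
      by [exact: segment_compact|exact: k1|exact: k2].
  by case: ik => k1 k2; rewrite /cintegral !oocc.
by case: ig => g1 g2; apply: complexP; rewrite /= split_ab.
Qed.

End PathIntegral.

(** * Residues: integrals of inverse products of linear factors *)

Section Residues.
Context {R : realType}.
Variables (gam : R -> R[i]).
Hypotheses (gamC : piecewise_C1 gam) (gam01 : gam 0 = gam 1).
Implicit Types (f h : R[i] -> R[i]) (z w : R[i]).

Local Notation twopii := (2 * (@pi R)%:C * imag_unit).

Lemma twopii_neq0 : twopii != 0.
Proof.
by rewrite !mulf_neq0 ?pnatr_eq0// eq_complex /= ?oner_eq0 ?andbF// negb_and gt_eqF ?pi_gt0.
Qed.

Definition pcontinuous f := ccontinuous `[0, 1] (fun u => f (gam u)).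

Lemma pcontinuous_id : pcontinuous id.
Proof. exact: piecewise_C1_ccontinuous. Qed.

Lemma path_integralZ f z : pcontinuous f ->
  path_integral gam (fun w => z * f w) = z * path_integral gam f.
Proof.
move=> fc; rewrite -cintegralZ//; last exact: path_integrand_integrable.
by apply: eq_cintegral => u _; rewrite mulrA.
Qed.

Lemma path_integralD f h : pcontinuous f -> pcontinuous h ->
  path_integral gam (fun w => f w + h w) = path_integral gam f + path_integral gam h.
Proof.
move=> fc hc; rewrite -cintegralD//; try exact: path_integrand_integrable.
by apply: eq_cintegral => u _; rewrite mulrDl.
Qed.

Lemma path_integral_sum (I : Type) (s : seq I) (F : I -> R[i] -> R[i]) :
  (forall i, pcontinuous (F i)) ->
  path_integral gam (fun w => \sum_(i <- s) F i w) =
  \sum_(i <- s) path_integral gam (F i).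
Proof.
move=> Fc.
have [_ <-] := @cintegral_sum R `[0, 1] I s _ (measurable_itv _)
  (fun i => path_integrand_integrable gamC (Fc i)).
by apply: eq_cintegral => u _; rewrite mulr_suml.
Qed.

Lemma eq_path_integral f h : (forall z, on_path gam z -> f z = h z) ->
  path_integral gam f = path_integral gam h.
Proof.
move=> fh; apply: eq_cintegral => u /set_mem /=; rewrite in_itv/= => hu.
by rewrite fh//; exists u.
Qed.

Lemma eq_pcontinuous f h : (forall z, on_path gam z -> f z = h z) ->
  pcontinuous f -> pcontinuous h.
Proof.
move=> fh; apply: eq_ccontinuous => u /set_mem /=; rewrite in_itv/= => hu.
by apply: fh; exists u.
Qed.

Lemma closed_path_integral_primitive f F : pcontinuous f ->
  (forall (phi : R -> R[i]) u d, on_path gam (phi u) ->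
     is_cderive phi u d -> is_cderive (F \o phi) u (f (phi u) * d)) ->
  path_integral gam f = 0.
Proof.
move=> fc hF; rewrite (path_integral_primitive gamC (F := F))//.
  by rewrite gam01 subrr.
by move=> phi u d hu e; apply: hF; exists u.
Qed.

Lemma path_integral1 : path_integral gam (fun=> 1) = 0.
Proof.
apply: (@closed_path_integral_primitive _ id); first exact: ccontinuous_cst.
by move=> phi u d _; rewrite mul1r.
Qed.

(** For t nonzero, -e^(-wt)/t is a primitive; at t = 0 the integrand is the constant 1. *)
Lemma path_integral_cexp (t : R) : path_integral gam (fun w => cexp (- w * t%:C)) = 0.
Proof.
have [->|t0] := eqVneq t 0.
  rewrite -path_integral1; apply: eq_path_integral => z _.
  by rewrite mulr0 cexp0.
apply: (@closed_path_integral_primitive _ (fun w => (- t^-1)%:C * cexp (w * (- t)%:C))).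
  apply: ccontinuous_cexp; apply: ccontinuousM; last exact: ccontinuous_cst.
  apply: (@eq_ccontinuous _ _ (fun u => - 1 * gam u)) => [u _|]; first by rewrite mulN1r.
  by apply: ccontinuousM pcontinuous_id; exact: ccontinuous_cst.
move=> phi u d _ hd.
have h1 := is_cderive_cexp (is_cderiveM hd (is_cderive_cst (- t)%:C u)).
apply: is_cderive_eq (is_cderiveM (is_cderive_cst _ u) h1) _.
have tt : (- t^-1)%:C * (- t)%:C = 1 by rewrite -rmorphM mulrNN mulVf.
rewrite mul0r add0r mulr0 addr0 !rmorphN mulrN -mulNr.
rewrite -[RHS]mul1r -tt !rmorphN; ring.
Qed.

Definition off_path z := ~ on_path gam z.

Lemma off_path_neq0 z w : off_path z -> on_path gam w -> w - z != 0.
Proof. by move=> zg wg; rewrite subr_eq0; apply/eqP => wz; apply: zg; rewrite -wz. Qed.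

Lemma pcontinuous_prodV (s : seq R[i]) : (forall z, z \in s -> off_path z) ->
  pcontinuous (fun w => (\prod_(z <- s) (w - z))^-1).
Proof.
move=> hs; apply: ccontinuousV.
  move=> u; rewrite /= in_itv/= => hu; rewrite prodf_seq_neq0; apply/allP => z zs.
  by apply/implyP => _; apply: off_path_neq0; [exact: hs|exists u].
elim: s {hs} => [|z s ih].
  apply: (@eq_ccontinuous _ _ (fun=> 1)) => [u _|]; first by rewrite big_nil.
  exact: ccontinuous_cst.
apply: (@eq_ccontinuous _ _ (fun u => (gam u - z) * \prod_(y <- s) (gam u - y))).
  by move=> u _; rewrite big_cons.
by apply: ccontinuousM ih; apply: ccontinuousD pcontinuous_id _; exact: ccontinuous_cst.
Qed.

(** An inverse power of order at least 2 has a single-valued primitive away from z; only simple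
    poles can contribute. *)
Lemma path_integral_powV z m : off_path z ->
  path_integral gam (fun w => (\prod_(y <- nseq m.+2 z) (w - y))^-1) = 0.
Proof.
move=> hz; apply: (@closed_path_integral_primitive _
    (fun w => - (m.+1%:R)^-1 * ((w - z)^-1) ^+ m.+1)).
  by apply: pcontinuous_prodV => y; rewrite mem_nseq/= => /eqP ->.
move=> phi u d hu hd; have hn := off_path_neq0 hz hu.
have h1 := is_cderiveV hn (is_cderiveD hd (is_cderive_cst (- z) u)).
apply: is_cderive_eq (is_cderiveM (is_cderive_cst _ u) (is_cderiveX m h1)) _.
have m0 : m.+1%:R != 0 :> R[i] by rewrite pnatr_eq0.
rewrite big_nseq iter_mulr mulr1 !exprS exprVn; field.
by rewrite expf_neq0 ?hn//= nat1r; exact: m0.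
Qed.

(** Partial fractions on two distinct points z and x of s trade the product for two products over
    shorter lists of equal size; by induction their integrals agree and cancel. There remain the
    empty list, a point repeated at least twice, and a single point, for which the winding number
    gives 2 pi i. *)
Lemma path_integral_prodV (s : seq R[i]) :
  (forall z, z \in s -> off_path z /\ winding gam z = 1) ->
  path_integral gam (fun w => (\prod_(z <- s) (w - z))^-1)
  = if size s == 1 then twopii else 0.
Proof.
have [n] := ubnP (size s); elim: n => // n IH in s *.
case: s => [_ _|z [_ hz|y t]] /=.
- rewrite -path_integral1; apply: eq_path_integral => w _.
  by rewrite big_nil invr1.
- have [zg wz] := hz z (mem_head _ _).
  rewrite (_ : path_integral _ _ = path_integral gam (fun w => (w - z)^-1)).
    move: wz; rewrite /winding => /(congr1 ( *%R twopii)).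
    by rewrite mulrA divff ?twopii_neq0// mul1r mulr1.
  by apply: eq_path_integral => w _; rewrite big_seq1.
rewrite ltnS => tn hs.
have [/all_pred1P e|] := boolP (all (pred1 z) (y :: t)).
  rewrite (_ : z :: y :: t = nseq (size t).+2 z); last by rewrite e.
  by apply: path_integral_powV; have [] := hs z (mem_head _ _).
rewrite -has_predC => /hasP[x xt /= xz].
have pt := perm_to_rem xt.
(* [r] is the list with one z and one x removed; further occurrences of either are kept. *)
set r := rem x (y :: t) in pt.
have sr : (size r).+1 = (size t).+1 by have := perm_size pt.
have hx w : w \in x :: r -> off_path w /\ winding gam w = 1.
  by move=> wr; apply: hs; rewrite inE (perm_mem pt) wr orbT.
have hzr w : w \in z :: r -> off_path w /\ winding gam w = 1.
  rewrite inE => /predU1P[->|wr]; first exact: hs (mem_head _ _).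
  by apply: hx; rewrite inE wr orbT.
transitivity ((z - x)^-1 * (path_integral gam (fun w => (\prod_(y <- z :: r) (w - y))^-1)
   + - 1 * path_integral gam (fun w => (\prod_(y <- x :: r) (w - y))^-1))).
  have zc : pcontinuous (fun w => (\prod_(y <- z :: r) (w - y))^-1).
    by apply: pcontinuous_prodV => w /hzr[].
  have xc : pcontinuous (fun w => (\prod_(y <- x :: r) (w - y))^-1).
    by apply: pcontinuous_prodV => w /hx[].
  have xc' : pcontinuous (fun w => - 1 * (\prod_(y <- x :: r) (w - y))^-1).
    by apply: ccontinuousM xc; exact: ccontinuous_cst.
  rewrite -(path_integralZ _ xc) -path_integralD// -path_integralZ; last first.
    exact: ccontinuousD.
  apply: eq_path_integral => w wg.
  rewrite big_cons (perm_big _ pt) /= !big_cons.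
  have z0 := off_path_neq0 (proj1 (hzr z (mem_head _ _))) wg.
  have x0 := off_path_neq0 (proj1 (hx x (mem_head _ _))) wg.
  have r0 : \prod_(j <- r) (w - j) != 0.
    rewrite prodf_seq_neq0; apply/allP => v vr; apply/implyP => _.
    by apply: off_path_neq0 wg; have [] := hx v; rewrite ?inE ?vr ?orbT.
  have zx : z - x != 0 by rewrite subr_eq0 eq_sym.
  by field; rewrite z0 x0 r0 zx.
(* [z :: r] and [x :: r] have the same size, so the induction hypothesis gives both integrals the
   same value, be it 0 or 2 pi i. *)
by rewrite !IH//= ?sr// mulN1r subrr mulr0.
Qed.

End Residues.

(** * The resolvent as a Newton interpolation polynomial *)

Section NewtonResolvent.
Variables (F : fieldType) (n : nat) (A : 'M[F]_n.+1).
Implicit Types (s : seq F) (w z : F).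

(* Newton interpolation at the points of s of the function x |-> (w - x)^-1. *)
Definition newton_resolvent s w : 'M[F]_n.+1 :=
  \sum_(k < size s) (\prod_(z <- take k.+1 s) (w - z))^-1 *:
    horner_mx A (\prod_(z <- take k s) ('X - z%:P)).

Lemma newton_resolvent_cons z s w : newton_resolvent (z :: s) w =
  (w - z)^-1 *: (1 + (A - z%:M) * newton_resolvent s w).
Proof.
rewrite /newton_resolvent big_ord_recl /= take0 big_seq1 big_nil rmorph1.
rewrite scalerDr mulr_sumr scaler_sumr; congr (_ + _).
apply: eq_bigr => k _; rewrite !big_cons invfM -scalerA; congr (_ *: _).
by rewrite rmorphM rmorphB /= horner_mx_X horner_mx_C -scalerAr.
Qed.

(** Newton interpolation has an explicit remainder: the product of the A - z divided by that of the
    w - z, for z in s. *)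
Lemma newton_resolventP s w : (forall z, z \in s -> w != z) ->
  (w%:M - A) * newton_resolvent s w =
  1 - (\prod_(z <- s) (w - z))^-1 *: horner_mx A (\prod_(z <- s) ('X - z%:P)).
Proof.
elim: s => [|z s ih] hs.
  by rewrite /newton_resolvent big_ord0 !big_nil invr1 rmorph1 scale1r mulr0 subrr.
have wz : w - z != 0 by rewrite subr_eq0 hs ?mem_head.
rewrite newton_resolvent_cons -scalerAr mulrDr mulr1 mulrA.
(* Both factors are polynomials in A, hence they commute. *)
have -> : (w%:M - A) * (A - z%:M) = (A - z%:M) * (w%:M - A).
  have cs v (B : 'M[F]_n.+1) : GRing.comm v%:M B by apply/esym/scalar_mxC.
  apply: commrB (commr_sym (cs z _)).
  by apply/commr_sym; apply: commrB (commr_refl A); apply/commr_sym/cs.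
rewrite -mulrA ih; last by move=> y ys; apply: hs; rewrite inE ys orbT.
rewrite !big_cons rmorphM rmorphB /= horner_mx_X horner_mx_C.
rewrite mulrBr mulr1 addrA (_ : w%:M - A + (A - z%:M) = (w - z)%:M); last first.
  by rewrite addrA subrK raddfB.
rewrite scalerBr -scalerAr scalerA -invfM; congr (_ - _).
by rewrite -scalemx1 scalerA mulVf// scale1r.
Qed.

(** When s lists the eigenvalues with multiplicity, the Cayley-Hamilton theorem kills the remainder
    and the interpolant is the resolvent itself. No Jordan form enters. *)
Lemma char_poly_roots_resolvent s w : char_poly A = \prod_(z <- s) ('X - z%:P) ->
  (forall z, z \in s -> w != z) ->
  w%:M - A \in unitmx /\ invmx (w%:M - A) = newton_resolvent s w.
Proof.
move=> sA hs; have := newton_resolventP hs.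
rewrite -sA Cayley_Hamilton scaler0 subr0 => h.
have [u _] := mulmx1_unit h; split=> //.
by rewrite -[RHS](mulKmx u) [X in _ *m X]h mulmx1.
Qed.

End NewtonResolvent.

(** * The contour integral of the resolvent *)

Section ContourResolvent.
Context {R : realType}.
Variables (gam : R -> R[i]).
Hypotheses (gamC : piecewise_C1 gam) (gam01 : gam 0 = gam 1).
Local Notation twopii := (2 * (@pi R)%:C * imag_unit).

Lemma eigenvalue_roots n (A : 'M[R[i]]_n.+1) :
  exists2 s : seq R[i], char_poly A = \prod_(z <- s) ('X - z%:P) &
    forall z, z \in s -> eigenvalue A z.
Proof.
have [s hs] := closed_field_poly_normal (char_poly A).
rewrite (monicP (char_poly_monic A)) scale1r in hs.
by exists s => // z zs; rewrite eigenvalue_root_char hs root_prod_XsubC.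
Qed.

Section ContourMatrix.
Variables (n : nat) (A : 'M[R[i]]_n).
Hypothesis gamA : forall z, eigenvalue A z -> off_path gam z /\ winding gam z = 1.

Lemma resolvent_unitmx w : on_path gam w -> w%:M - A \in unitmx.
Proof.
(* Dimension 0 is set apart because [newton_resolvent] lives in size n.+1. *)
case: n A gamA => [|m] A' gamA' wg; first by rewrite unitmxE det_mx00 unitr1.
have [s sA hs] := eigenvalue_roots A'.
have [] := char_poly_roots_resolvent (w := w) sA => // z /hs/gamA'[zg _].
by apply/eqP => wz; apply: zg; rewrite -wz.
Qed.

Lemma resolvent_pcontinuous i j : pcontinuous gam (fun w => invmx (w%:M - A) i j).
Proof.
case: n A gamA i j => [|m] A' gamA' i j; first by case: i.
have [s sA hs] := eigenvalue_roots A'.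
apply: (@eq_pcontinuous _ _ (fun w => newton_resolvent A' s w i j)) => [w wg|].
  have [|_ ->//] := char_poly_roots_resolvent (w := w) sA.
  by move=> z /hs/gamA'[zg _]; apply/eqP => wz; apply: zg; rewrite -wz.
apply: (@eq_pcontinuous _ _ (fun w => \sum_(k < size s)
    (\prod_(z <- take k.+1 s) (w - z))^-1 *
    horner_mx A' (\prod_(z <- take k s) ('X - z%:P)) i j)) => [w wg|].
  by rewrite summxE; apply: eq_bigr => k _; rewrite mxE.
apply: ccontinuous_sum => k; apply: ccontinuousM; last exact: ccontinuous_cst.
by apply: (pcontinuous_prodV gamC) => z /mem_take/hs/gamA'[].
Qed.

(** The Newton term of index k has k + 1 linear factors in its denominator, so only k = 0 has a
    nonzero integral, and its matrix coefficient is the identity. *)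
Lemma path_integral_resolvent i j :
  path_integral gam (fun w => invmx (w%:M - A) i j) = twopii * (i == j)%:R.
Proof.
case: n A gamA i j => [|m] A' gamA' i j; first by case: i.
have [s sA hs] := eigenvalue_roots A'.
rewrite (eq_path_integral (h := fun w => \sum_(k < size s)
    horner_mx A' (\prod_(z <- take k s) ('X - z%:P)) i j *
    (\prod_(z <- take k.+1 s) (w - z))^-1)); last first.
  move=> w wg; have [|_ ->//] := char_poly_roots_resolvent (w := w) sA.
    by move=> z /hs/gamA'[zg _]; apply/eqP => wz; apply: zg; rewrite -wz.
  by rewrite summxE; apply: eq_bigr => k _; rewrite mxE mulrC.
have pc (k : 'I_(size s)) :
    pcontinuous gam (fun w => (\prod_(z <- take k.+1 s) (w - z))^-1).
  by apply: (pcontinuous_prodV gamC) => z /mem_take/hs/gamA'[].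
rewrite path_integral_sum//; last first.
  by move=> k; apply: ccontinuousM (pc k); exact: ccontinuous_cst.
(* The size is positive, so the term k = 0 does occur. *)
have size_s : size s = m.+1.
  by apply: succn_inj; rewrite -(size_char_poly A') sA size_prod_XsubC.
transitivity (\sum_(k < size s)
    (if k == 0 :> nat then twopii * (i == j)%:R else 0)).
  apply: eq_bigr => k _; rewrite path_integralZ// path_integral_prodV//; last first.
    by move=> z /mem_take/hs/gamA'.
  rewrite size_takel ?ltn_ord// eqSS; case: eqP => [->|_]; last by rewrite mulr0.
  by rewrite take0 big_nil rmorph1 mxE mulrC.
rewrite size_s big_ord_recl big1 ?addr0// => k _.
Qed.

End ContourMatrix.
End ContourResolvent.

(** * Second-order Taylor bounds and the entrywise matrix norm *)

Section SecondOrderTaylor.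
Context {R : realType}.

(** The mean value theorem is applied to [k] and then to [dk]; this gives K where the sharp constant
    would be K / 2. *)
Lemma taylor2_le (k dk ddk : R -> R) (K x : R) : 0 <= x ->
  (forall u : R, is_derive u 1 k (dk u)) ->
  (forall u : R, is_derive u 1 dk (ddk u)) ->
  (forall u, 0 <= u <= x -> `|ddk u| <= K) ->
  `|k x - k 0 - x * dk 0| <= K * x ^+ 2.
Proof.
move=> x0 hk hdk hK.
have cont (f df : R -> R) (D : set R) : (forall u : R, is_derive u 1 f (df u)) ->
    {within D, continuous f}.
  move=> hf; apply: continuous_subspaceT => u; have [d1 _] := hf u.
  exact/differentiable_continuous/derivable1_diffP.
have [c + ->] := MVT_segment x0 (fun u _ => hk u) (cont _ _ _ hk).
rewrite subr0 in_itv/= => /andP[c0 cx].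
have [e + he] := MVT_segment c0 (fun u _ => hdk u) (cont _ _ _ hdk).
rewrite in_itv/= => /andP[e0 ec].
rewrite mulrC -mulrBr he subr0 !normrM (ger0_norm x0) (ger0_norm c0) mulrCA.
apply: ler_pM; rewrite ?mulr_ge0//; first by apply: hK; rewrite e0 (le_trans ec).
by rewrite expr2 ler_wpM2l.
Qed.

Lemma Re_scale (a : R) (z : R[i]) : Re (a%:C * z) = a * Re z.
Proof. by rewrite ReM /= mul0r subr0. Qed.

Lemma Im_scale (a : R) (z : R[i]) : Im (a%:C * z) = a * Im z.
Proof. by rewrite ImM /= mul0r addr0. Qed.

(** For Re z >= 0 the second derivative in x is at most 2 |z|^2 in [cabs], and each of the two
    components contributes this much, hence the constant 4. *)
Lemma cexp_taylor2 (z : R[i]) (x : R) : 0 <= x -> 0 <= Re z ->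
  cabs (cexp (- z * x%:C) - 1 + z * x%:C) <= 4 * cabs z ^+ 2 * x ^+ 2.
Proof.
move=> x0 z0.
pose k (u : R) := cexp (- z * u%:C).
have d1 u : is_cderive k u (- z * k u).
  have h1 : is_cderive (fun u : R => u%:C) u 1.
    by split; [exact: is_derive_id|exact: is_derive_cst].
  have := is_cderive_cexp (is_cderiveM (is_cderive_cst (- z) u) h1).
  by move/is_cderive_eq; apply; rewrite /k; ring.
have d2 u : is_cderive (fun u => - z * k u) u (- z * (- z * k u)).
  apply: is_cderive_eq (is_cderiveM (is_cderive_cst (- z) u) (d1 u)) _.
  by rewrite mul0r add0r.
have d2K u : 0 <= u <= x -> cabs (- z * (- z * k u)) <= 2 * cabs z ^+ 2.
  move=> /andP[u0 _]; rewrite mulrA mulrNN (le_trans (cabsM _ _))//.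
  rewrite mulrC ler_pM ?cabs_ge0//; last by rewrite expr2 cabsM.
  rewrite (le_trans (cabs_cexp _))// ler_piMr// -[leRHS]expR0 ler_expR.
  by rewrite !ReImE /= mulr0 subr0 mulNr oppr_le0 mulr_ge0.
have k0 : k 0 = 1 by rewrite /k mulr0 cexp0.
rewrite (_ : _ + _ = k x - k 0 - x%:C * (- z * k 0)); last by rewrite k0 /k; ring.
rewrite (_ : 4 * _ = 2 * cabs z ^+ 2 + 2 * cabs z ^+ 2); last by ring.
rewrite mulrDl [leLHS]/cabs; apply: lerD.
- have h (u : R) : 0 <= u <= x -> `|Re (- z * (- z * k u))| <= 2 * cabs z ^+ 2.
    by move=> /d2K; apply: le_trans (normRe_cabs _).
  have := taylor2_le x0 (fun u => proj1 (d1 u)) (fun u => proj1 (d2 u)) h.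
  by rewrite !ReD !ReN (Re_scale x (- z * k 0)).
- have h (u : R) : 0 <= u <= x -> `|Im (- z * (- z * k u))| <= 2 * cabs z ^+ 2.
    by move=> /d2K; apply: le_trans (normIm_cabs _).
  have := taylor2_le x0 (fun u => proj2 (d1 u)) (fun u => proj2 (d2 u)) h.
  by rewrite !ImD !ImN (Im_scale x (- z * k 0)).
Qed.

End SecondOrderTaylor.

Section EntrywiseNorm.
Context {R : realType}.

Definition mnorm m n (X : 'M[R[i]]_(m, n)) : R := \sum_i \sum_j cabs (X i j).

Lemma mnorm_ge0 m n (X : 'M[R[i]]_(m, n)) : 0 <= mnorm X.
Proof. by apply: sumr_ge0 => i _; apply: sumr_ge0 => j _; exact: cabs_ge0. Qed.

Lemma cabs_le_mnorm m n (X : 'M[R[i]]_(m, n)) i j : cabs (X i j) <= mnorm X.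
Proof.
rewrite /mnorm (bigD1 i)//= (bigD1 j)//= -addrA lerDl addr_ge0//.
  by apply: sumr_ge0 => *; exact: cabs_ge0.
by apply: sumr_ge0 => k _; apply: sumr_ge0 => *; exact: cabs_ge0.
Qed.

Lemma mnorm_eq0 m n (X : 'M[R[i]]_(m, n)) : mnorm X <= 0 -> X = 0.
Proof.
move=> h; apply/matrixP => i j; rewrite mxE; apply: cabs_eq0.
exact: le_trans (cabs_le_mnorm _ _ _) h.
Qed.

Lemma mnormD m n (X Y : 'M[R[i]]_(m, n)) : mnorm (X + Y) <= mnorm X + mnorm Y.
Proof.
rewrite /mnorm -big_split; apply: ler_sum => i _; rewrite -big_split.
by apply: ler_sum => j _; rewrite mxE cabsD.
Qed.

Lemma mnormN m n (X : 'M[R[i]]_(m, n)) : mnorm (- X) = mnorm X.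
Proof. by apply: eq_bigr => i _; apply: eq_bigr => j _; rewrite mxE cabsN. Qed.

Lemma mnormM m n q (X : 'M[R[i]]_(m, n)) (Y : 'M[R[i]]_(n, q)) :
  mnorm (X *m Y) <= mnorm X * mnorm Y.
Proof.
rewrite /mnorm mulr_suml; apply: ler_sum => i _.
rewrite mulr_suml.
apply: (@le_trans _ _ (\sum_j \sum_k cabs (X i k) * cabs (Y k j))).
  apply: ler_sum => j _; rewrite mxE (le_trans (cabs_sum _ _ _))//.
  by apply: ler_sum => k _; exact: cabsM.
rewrite exchange_big; apply: ler_sum => k _.
rewrite -mulr_sumr ler_wpM2l ?cabs_ge0// [leRHS](bigD1 k)//= lerDl.
by apply: sumr_ge0 => *; apply: sumr_ge0 => *; exact: cabs_ge0.
Qed.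

Lemma mnorm_le m n (X : 'M[R[i]]_(m, n)) (K : R) :
  (forall i j, cabs (X i j) <= K) -> mnorm X <= (m * n)%:R * K.
Proof.
move=> hK; rewrite /mnorm.
apply: (@le_trans _ _ (\sum_(i < m) \sum_(j < n) K)).
  by apply: ler_sum => i _; apply: ler_sum => j _.
by rewrite !sumr_const !card_ord -!mulrnA mulnC mulr_natl.
Qed.

Lemma mnorm_telescope m n (D : nat -> 'M[R[i]]_(m, n)) (N : nat) (e : R) :
  (forall k, (k < N)%N -> mnorm (D k.+1 - D k) <= e) ->
  mnorm (D N - D 0) <= N%:R * e.
Proof.
elim: N => [|N ih] h.
  by rewrite subrr mul0r (le_trans (mnorm_le (K := 0) _))// ?mulr0// => i j;
    rewrite mxE cabs0.
rewrite (_ : _ - _ = (D N.+1 - D N) + (D N - D 0)); last by rewrite addrA subrK.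
rewrite -nat1r mulrDl mul1r (le_trans (mnormD _ _))// lerD ?h//.
by apply: ih => k kN; apply: h; rewrite ltnS ltnW.
Qed.

End EntrywiseNorm.

(** * The contour integral of e^(-tw) against the resolvent, and its differential equation *)

Section ContourSemigroup.
Context {R : realType}.
Variables (gam : R -> R[i]).
Hypotheses (gamC : piecewise_C1 gam) (gam01 : gam 0 = gam 1).
Hypothesis gam_rhp : forall z, on_path gam z -> 0 < Re z.
Local Notation twopii := (2 * (@pi R)%:C * imag_unit).

(** The constant is twice a bound on the speed of the path: the parameter interval has length 1, and
    real and imaginary parts are estimated separately. *)
Lemma path_integral_bound : exists2 L : R, 0 <= L &
  forall (f : R[i] -> R[i]) (K : R), pcontinuous gam f ->
    (forall z, on_path gam z -> cabs (f z) <= K) ->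
    cabs (path_integral gam f) <= L * K.
Proof.
have [_ [L hL]] := piecewise_C1_cderive1 gamC.
have L0 : 0 <= L by rewrite (le_trans (cabs_ge0 _) (hL 0 _))// lexx ler01.
exists (2 * L); rewrite ?mulr_ge0// => f K fc hK.
rewrite -mulrA (_ : L * K = (K * L) * (1 - 0)); last by rewrite subr0 mulr1 mulrC.
apply: cabs_cintegral_le => //; first exact: path_integrand_integrable.
move=> u hu; rewrite (le_trans (cabsM _ _))// ler_pM ?cabs_ge0//; last exact: hL.
by apply: hK; exists u.
Qed.

Lemma pcontinuous_bounded (f : R[i] -> R[i]) : pcontinuous gam f ->
  exists2 K : R, 0 <= K & forall z, on_path gam z -> cabs (f z) <= K.
Proof.
move=> /ccontinuous_bounded[K hK].
exists K; first by rewrite (le_trans (cabs_ge0 _) (hK 0 _))// lexx ler01.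
by move=> _ [u hu <-]; exact: hK.
Qed.

Lemma path_Re_lower_bound : exists2 e : R, 0 < e & forall z, on_path gam z -> e <= Re z.
Proof.
have [h1 _] := piecewise_C1_ccontinuous gamC.
have [c c01 hc] := EVT_min ler01 h1.
exists (Re (gam c)).
  by apply: gam_rhp; exists c => //; move: c01; rewrite in_itv.
by move=> _ [u hu <-]; apply: hc; rewrite in_itv.
Qed.

Lemma pcontinuous_cexp (t : R) : pcontinuous gam (fun w => cexp (- w * t%:C)).
Proof.
apply: ccontinuous_cexp.
apply: (@eq_ccontinuous _ _ (fun u => (- t)%:C * gam u)) => [u _|].
  by rewrite rmorphN /= mulNr mulrC mulNr.
apply: ccontinuousM (pcontinuous_id gamC); exact: ccontinuous_cst.
Qed.

Lemma cabs_cexp_decay (w : R[i]) (t e : R) : 0 <= t -> e <= Re w ->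
  cabs (cexp (- w * t%:C)) <= 2 * expR (- (e * t)).
Proof.
move=> t0 ew; rewrite (le_trans (cabs_cexp _))// ler_pM2l// ler_expR.
by rewrite ReM /= mulr0 subr0 ReN mulNr lerN2 ler_wpM2r.
Qed.

Variables (n : nat) (A : 'M[R[i]]_n).
Hypothesis gamA : forall z, eigenvalue A z -> off_path gam z /\ winding gam z = 1.

(** The holomorphic functional calculus of e^(-tw) at A, without the normalization by 2 pi i. *)
Definition contour_semigroup (t : R) : 'M[R[i]]_n :=
  \matrix_(i, j) path_integral gam (fun w => cexp (- w * t%:C) * invmx (w%:M - A) i j).

Let resc i j : pcontinuous gam (fun w => invmx (w%:M - A) i j).
Proof. exact: resolvent_pcontinuous. Qed.

Lemma contour_semigroup0 : contour_semigroup 0 = twopii%:M.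
Proof.
apply/matrixP => i j; rewrite !mxE.
rewrite -[RHS]mulr_natr -(path_integral_resolvent gamC gam01 gamA).
by apply: eq_path_integral => w _; rewrite mulr0 cexp0 mul1r.
Qed.

Lemma resolvent_mulr w i j : on_path gam w ->
  w * invmx (w%:M - A) i j = (i == j)%:R + \sum_k A i k * invmx (w%:M - A) k j.
Proof.
move=> wg; have u := resolvent_unitmx gamA wg.
have /matrixP/(_ i j) := mulmxV u.
rewrite mulmxBl mul_scalar_mx !mxE => /eqP; rewrite subr_eq => /eqP ->.
by [].
Qed.

(** By w (w - A)^-1 = 1 + A (w - A)^-1, the factor w becomes A, up to the integral of e^(-tw), which
    vanishes on a closed path. As differentiation in t brings down -w, this is the equation M' = -A
    M. *)
Lemma contour_semigroup_mul t i j :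
  path_integral gam (fun w => w * cexp (- w * t%:C) * invmx (w%:M - A) i j)
  = (A *m contour_semigroup t) i j.
Proof.
have c1 k : pcontinuous gam (fun w => cexp (- w * t%:C) * invmx (w%:M - A) k j).
  by apply: ccontinuousM (pcontinuous_cexp t) (resc _ _).
rewrite (eq_path_integral (h := fun w => (i == j)%:R * cexp (- w * t%:C) +
   \sum_k A i k * (cexp (- w * t%:C) * invmx (w%:M - A) k j))); last first.
  move=> w wg; rewrite mulrAC resolvent_mulr// mulrDl; congr (_ + _).
  by rewrite mulr_suml; apply: eq_bigr => k _; rewrite mulrAC -mulrA.
rewrite path_integralD//; first last.
- by apply: ccontinuous_sum => k; apply: ccontinuousM (c1 k); exact: ccontinuous_cst.
- by apply: ccontinuousM (pcontinuous_cexp t); exact: ccontinuous_cst.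
rewrite path_integralZ ?path_integral_cexp// ?mulr0 ?add0r; last first.
  exact: pcontinuous_cexp.
rewrite path_integral_sum//; last first.
  by move=> k; apply: ccontinuousM (c1 k); exact: ccontinuous_cst.
by rewrite mxE; apply: eq_bigr => k _; rewrite path_integralZ// mxE.
Qed.

Lemma resolvent_bounded : exists2 K : R, 0 <= K &
  forall i j z, on_path gam z -> cabs (invmx (z%:M - A) i j) <= K.
Proof.
pose Kij (ij : 'I_n * 'I_n) := s2val (cid2 (pcontinuous_bounded (resc ij.1 ij.2))).
have Kij0 ij : 0 <= Kij ij by rewrite /Kij; case: cid2.
have hKij ij z : on_path gam z -> cabs (invmx (z%:M - A) ij.1 ij.2) <= Kij ij.
  by rewrite /Kij; case: cid2 => K /= _; apply.
exists (\sum_ij Kij ij); first exact: sumr_ge0.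
move=> i j z zg; rewrite (le_trans (hKij (i, j) z zg))//.
by rewrite (bigD1 (i, j))//= lerDl sumr_ge0.
Qed.

Lemma contour_semigroup_decay : exists K e : R, [/\ 0 <= K, 0 < e &
  forall t, 0 <= t -> mnorm (contour_semigroup t) <= K * expR (- (e * t))].
Proof.
have [L L0 hL] := path_integral_bound; have [e e0 he] := path_Re_lower_bound.
have [K0 K00 hK0] := resolvent_bounded.
  exists ((n * n)%:R * (L * (2 * K0))), e; split; rewrite ?mulr_ge0// => t t0.
  rewrite -mulrA; apply: mnorm_le => i j; rewrite mxE -mulrA; apply: hL.
    exact: ccontinuousM (pcontinuous_cexp t) (resc _ _).
  move=> z zg; rewrite (le_trans (cabsM _ _))// mulrAC ler_pM ?cabs_ge0 ?hK0//.
  exact: cabs_cexp_decay (he _ zg).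
Qed.

(** The matrix on the left is the integral of e^(-sw) (e^(-hw) - 1 + hw) (w - A)^-1. Since Re w > 0
    on the path, the first factor is bounded for all s >= 0, so K does not depend on s. *)
Lemma contour_semigroup_taylor : exists2 K : R, 0 <= K &
  forall s h, 0 <= s -> 0 <= h ->
    mnorm (contour_semigroup (s + h) - contour_semigroup s
      + h%:C *: (A *m contour_semigroup s)) <= K * h ^+ 2.
Proof.
have [L L0 hL] := path_integral_bound.
have [K1 K10 hK1] := pcontinuous_bounded (pcontinuous_id gamC).
have [K2 K20 hK2] := resolvent_bounded.
pose K0 := K2 * K1 ^+ 2; have K00 : 0 <= K0 by rewrite mulr_ge0 ?sqr_ge0.
have hK0 i j z : on_path gam z -> cabs (invmx (z%:M - A) i j) * cabs z ^+ 2 <= K0.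
  move=> zg; rewrite ler_pM ?cabs_ge0 ?sqr_ge0 ?hK2//.
  by rewrite ler_sqr ?nnegrE ?cabs_ge0// hK1.
  exists ((n * n)%:R * (L * (2 * 4 * K0))); rewrite ?mulr_ge0// => s h s0 h0.
  rewrite -mulrA; apply: mnorm_le => i j.
  pose f w := cexp (- w * s%:C) * (cexp (- w * h%:C) - 1 + w * h%:C) *
      invmx (w%:M - A) i j.
  have sc : pcontinuous gam (fun w => cexp (- w * s%:C) * invmx (w%:M - A) i j).
    exact: ccontinuousM (pcontinuous_cexp s) (resc _ _).
  have shc : pcontinuous gam (fun w => cexp (- w * (s + h)%:C) * invmx (w%:M - A) i j).
    exact: ccontinuousM (pcontinuous_cexp _) (resc _ _).
  have wc : pcontinuous gam (fun w => w * cexp (- w * s%:C) * invmx (w%:M - A) i j).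
    apply: ccontinuousM (resc _ _).
    exact: ccontinuousM (pcontinuous_id gamC) (pcontinuous_cexp s).
  rewrite (_ : _ i j = path_integral gam f); last first.
    rewrite mxE [X in X + _ = _]mxE [X in _ + X + _ = _]mxE.
    rewrite [X in _ + X = _]mxE -contour_semigroup_mul.
    rewrite [X in X - _ + _ = _]mxE [X in _ - X + _ = _]mxE -[- path_integral _ _]mulN1r.
    rewrite -!path_integralZ//. rewrite -!path_integralD//.
    + apply: eq_path_integral => w _; rewrite /f rmorphD mulrDr cexpD; ring.
    + by apply: ccontinuousD => //; apply: ccontinuousM sc; exact: ccontinuous_cst.
    + by apply: ccontinuousM wc; exact: ccontinuous_cst.
    + by apply: ccontinuousM sc; exact: ccontinuous_cst.
  rewrite -mulrA; apply: hL.
    apply: ccontinuousM (resc _ _); apply: ccontinuousM (pcontinuous_cexp s) _.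
    apply: ccontinuousD.
      by apply: ccontinuousD (pcontinuous_cexp h) _; exact: ccontinuous_cst.
    by apply: ccontinuousM (pcontinuous_id gamC) _; exact: ccontinuous_cst.
  move=> z zg; have z0 := ltW (gam_rhp zg).
  (* Decay rate 0 leaves the plain bound 2. *)
  have hs := @cabs_cexp_decay z s 0 s0 z0.
  rewrite mul0r oppr0 expR0 mulr1 in hs.
  have ht := cexp_taylor2 h0 z0.
  rewrite (le_trans (cabsM _ _))//.
  apply: (@le_trans _ _ (2 * (4 * cabs z ^+ 2 * h ^+ 2) * cabs (invmx (z%:M - A) i j))).
    by rewrite ler_wpM2r ?cabs_ge0// (le_trans (cabsM _ _))// ler_pM ?cabs_ge0.
  rewrite (_ : _ * _ = 2 * 4 * h ^+ 2 * (cabs (invmx (z%:M - A) i j) * cabs z ^+ 2)).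
    by rewrite [leRHS]mulrAC ler_wpM2l ?hK0// !mulr_ge0 ?sqr_ge0.
  by ring.
Qed.

End ContourSemigroup.

(** * Identification of the contour integral with the semigroup Q *)

Section SemigroupUniqueness.
Context {R : realType}.
Local Notation toC := (map_mx (real_complex R)).
Local Notation twopii := (2 * (@pi R)%:C * imag_unit).

Lemma at_right0_ex (Q : R -> Prop) : (\forall h \near 0^'+, Q h) ->
  exists2 d : R, 0 < d & forall h, 0 < h < d -> Q h.
Proof.
move=> [d /= d0 hd]; exists d => // h /andP[h0 hd']; apply: hd => //=.
by rewrite sub0r normrN gtr0_norm.
Qed.

Lemma exists_nat_gt (x : R) : exists N : nat, x <= N.+1%:R.
Proof.
exists (Num.truncn `|x|); rewrite (le_trans (ler_norm _))// ltW//.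
exact: truncnS_gt.
Qed.

Variables (gam : R -> R[i]).
Hypotheses (gamC : piecewise_C1 gam) (gam01 : gam 0 = gam 1).
Hypothesis gam_rhp : forall z, on_path gam z -> 0 < Re z.
Variables (n : nat) (T : 'M[R]_n) (Q : R -> 'M[R]_n).
Hypothesis gamA : forall z, eigenvalue (toC (- T)) z ->
  off_path gam z /\ winding gam z = 1.
Hypotheses (Q0 : Q 0 = 1%:M)
  (QD : forall s t, 0 <= s -> 0 <= t -> Q (s + t) = Q s *m Q t)
  (Qle1 : forall t i j, 0 <= t -> `|Q t i j| <= 1)
  (Qder : forall i j, (fun h => h^-1 * (Q h i j - (i == j)%:R)) @ 0^'+ --> T i j).

(** There are finitely many entries, hence one threshold d for all of them. *)
Lemma semigroup_first_order (e : R) : 0 < e ->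
  exists2 d : R, 0 < d & forall h, 0 < h < d ->
    forall i j, `|Q h i j - (i == j)%:R - h * T i j| <= e * h.
Proof.
move=> e0; apply: at_right0_ex.
have : \forall h \near 0^'+, forall ij : 'I_n * 'I_n,
    `|h^-1 * (Q h ij.1 ij.2 - (ij.1 == ij.2)%:R) - T ij.1 ij.2| <= e.
  apply: filter_forall => -[i j] /=.
  have /cvgrPdist_le/(_ _ e0) := @Qder i j.
  by apply: filterS => h; rewrite distrC.
have h0 := @nbhs_right_gt R 0.
apply: filterS2 h0 => h h0 H i j.
have := H (i, j); rewrite /= -(ler_pM2r h0); apply: le_trans.
rewrite -[X in _ <= _ * X](gtr0_norm h0) -normrM.
suff -> : Q h i j - (i == j)%:R - h * T i j =
   (h^-1 * (Q h i j - (i == j)%:R) - T i j) * h by [].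
by field; rewrite gt_eqF.
Qed.

(** D(s) = Q(t - s) M(s) joins 2 pi i Q(t), at s = 0, to M(t), at s = t. A step of length h moves D
    by o(h) uniformly in s, so N steps of length t / N move it by o(1): the two ends agree. The only
    derivative of Q that occurs is the one at 0+. *)
Lemma contour_semigroupE t : 0 <= t ->
  contour_semigroup gam (toC (- T)) t = twopii *: toC (Q t).
Proof.
move=> t0; set A := toC (- T); set M := contour_semigroup gam A.
have [KM [e1 [KM0 e10 hM]]] := contour_semigroup_decay gamC gam_rhp gamA.
have [KT KT0 hT] := contour_semigroup_taylor gamC gam01 gam_rhp gamA.
have KMb s : 0 <= s -> mnorm (M s) <= KM.
  move=> s0; rewrite (le_trans (hM s s0))// ler_piMr//.
  by rewrite -[leRHS]expR0 ler_expR oppr_le0 mulr_ge0// ltW.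
have Qb s : 0 <= s -> mnorm (toC (Q s)) <= (n * n)%:R.
  move=> s0; rewrite -[leRHS]mulr1; apply: mnorm_le => i j.
  by rewrite mxE cabs_real Qle1.
pose D s := toC (Q (t - s)) *m M s.
suff : D t = D 0.
  rewrite /D subrr subr0 Q0 map_mx1 mul1mx => ->.
  by rewrite /M contour_semigroup0// mul_mx_scalar.
apply/eqP; rewrite -subr_eq0; apply/eqP/mnorm_eq0.
have step e : 0 < e -> exists2 d : R, 0 < d & forall s h, 0 < h < d -> 0 <= s ->
    s + h <= t -> mnorm (D (s + h) - D s) <=
    (n * n)%:R * (KT * h ^+ 2 + (n * n)%:R * (e * h) * KM).
  move=> e0; have [d d0 hd] := semigroup_first_order e0.
  exists d => // s h hdh s0 sht; have h0 : 0 < h by case/andP: hdh.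
  have ts : t - s = t - (s + h) + h by ring.
  (* Q(t - s) factors as Q(t - s - h) Q(h); since A = -T, M(s + h) and Q(h) M(s) share the
     first-order expansion M(s) + h T M(s), and only their remainders are left. *)
  have -> : D (s + h) - D s = toC (Q (t - (s + h))) *m
      ((M (s + h) - M s + h%:C *: (A *m M s))
       - (toC (Q h) - 1%:M - h%:C *: toC T) *m M s).
    have QE : Q (t - s) = Q (t - (s + h)) *m Q h.
      by rewrite -QD -?ts ?subr_ge0 ?(ltW h0).
    rewrite /D QE map_mxM -mulmxA -mulmxBr; congr (_ *m _).
    rewrite !mulmxBl mul1mx -scalemxAl /A raddfN /= mulNmx scalerN.
    move: (M (s + h)) (toC (Q h) *m M s) (M s) (h%:C *: (toC T *m M s)).
    move=> a b c e'; rewrite !opprB !addrA; apply/eqP.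
    by rewrite -subr_eq0; apply/eqP/matrixP => i j; rewrite !mxE; ring.
  rewrite (le_trans (mnormM _ _))// ler_pM ?mnorm_ge0 ?Qb ?subr_ge0//.
  rewrite (le_trans (mnormD _ _))// mnormN lerD ?hT// ?(ltW h0)//.
  rewrite (le_trans (mnormM _ _))// ler_pM ?mnorm_ge0 ?KMb//.
  apply: mnorm_le => i j.
  rewrite (_ : _ i j = (Q h i j - (i == j)%:R - h * T i j)%:C).
    by rewrite cabs_real; exact: hd.
  by rewrite !rmorphB rmorphM rmorph_nat !mxE.
have [t_0|tn0] := eqVneq t 0.
  rewrite t_0 subrr (le_trans (mnorm_le (K := 0) _)) ?mulr0// => i j.
  by rewrite mxE cabs0.
have tp : 0 < t by rewrite lt_neqAle eq_sym tn0.
apply/ler_addgt0Pr => e e0; rewrite add0r.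
pose N2 : R := (n * n)%:R.
have N20 : 0 <= N2 by [].
(* With [e'] the first-order errors of all steps add up to at most e / 2; the added 1 keeps the
   denominator positive. *)
pose e' := e / (2 * (N2 * N2 * t * KM + 1)).
have den0 : 0 < N2 * N2 * t * KM + 1 by rewrite ltr_wpDl// !mulr_ge0.
have e'0 : 0 < e' by rewrite divr_gt0// mulr_gt0.
have [d d0 hd] := step _ e'0.
(* The first bound makes the step smaller than d, strictly because of t + t; the second makes the
   quadratic errors add up to at most e / 2. *)
have [N hN] := exists_nat_gt (Num.max ((t + t) / d) (2 * N2 * KT * t ^+ 2 / e)).
move: hN; rewrite ge_max => /andP[hN1 hN2].
have Np : 0 < N.+1%:R :> R by [].
pose h := t / N.+1%:R.
have h0 : 0 < h by rewrite divr_gt0.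
have hd' : h < d.
  move: hN1; rewrite ler_pdivrMr// => hN1; rewrite ltr_pdivrMr// mulrC.
  by apply: lt_le_trans hN1; rewrite ltrDl.
have := @mnorm_telescope R _ _ (fun k => D (k%:R * h)) N.+1
  (N2 * (KT * h ^+ 2 + N2 * (e' * h) * KM)).
rewrite mul0r (_ : N.+1%:R * h = t); last by rewrite mulrC divfK// gt_eqF.
move=> H; apply: le_trans (H _) _ => [k kN|].
  have kS : k.+1%:R * h = k%:R * h + h by rewrite -natr1 mulrDl mul1r.
  rewrite kS; apply: hd; rewrite ?h0//; first by rewrite mulr_ge0// ltW.
  rewrite -kS /h mulrCA ler_piMr ?(ltW tp)//.
  by rewrite ler_pdivrMr// mul1r ler_nat.
have -> : N.+1%:R * (N2 * (KT * h ^+ 2 + N2 * (e' * h) * KM)) =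
    N2 * KT * t ^+ 2 / N.+1%:R + N2 * N2 * t * KM * e'.
  by rewrite /h; field; rewrite nat1r gt_eqF.
rewrite [leRHS]splitr; apply: lerD.
  move: hN2; rewrite !ler_pdivrMr// => hN2; nra.
rewrite /e' mulrA ler_pdivrMr ?mulr_gt0//; lra.
Qed.

End SemigroupUniqueness.

(** * Measures with a density, and the change of variable s = g(u) *)

Section DensityMeasure.
Context d (T : measurableType d) {R : realType} (mu : {measure set T -> \bar R}).
Variable f : T -> R.
Hypotheses (mf : measurable_fun setT f) (f0 : forall x, 0 <= f x).
Local Open Scope ereal_scope.

(** The [let]s make [mf] and [f0] arguments of the definition, since its measure structure is built
    from them. *)
Definition density_measure (A : set T) : \bar R :=
  let _ := mf in let _ := f0 in \int[mu]_(x in A) (f x)%:E.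

Let density_measure0 : density_measure set0 = 0.
Proof. exact: integral_set0. Qed.

Let density_measure_ge0 A : 0 <= density_measure A.
Proof. by apply: integral_ge0 => x _; rewrite lee_fin. Qed.

Let density_measure_sigma_additive : semi_sigma_additive density_measure.
Proof.
apply: semi_sigma_additive_nng_induced; first exact/measurable_EFinP.
by move=> x; rewrite lee_fin.
Qed.

HB.instance Definition _ := isMeasure.Build _ _ _ density_measure
  density_measure0 density_measure_ge0 density_measure_sigma_additive.

Import HBNNSimple.

(** True for indicators by definition, for simple functions by linearity, and in the limit by
    monotone convergence. *)
Lemma ge0_integral_density_measure (h : T -> \bar R) :
  measurable_fun setT h -> (forall x, 0 <= h x) ->
  \int[density_measure]_x h x = \int[mu]_x (h x * (f x)%:E).
Proof.
move=> mh h0; pose h_ := nnsfun_approx measurableT mh.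
have mhn n : measurable_fun setT (fun x => (h_ n x)%:E).
  exact/measurable_EFinP/measurable_funP.
have mfE : measurable_fun setT (fun x => (f x)%:E) by exact/measurable_EFinP.
have hx x : (h_ n x)%:E @[n --> \oo] --> h x.
  by apply: (@cvg_nnsfun_approx _ _ _ _ measurableT h mh) => //.
transitivity (limn (fun n => \int[density_measure]_x (h_ n x)%:E)).
  rewrite -monotone_convergence//.
  - by apply: eq_integral => y _; apply/esym/cvg_lim.
  - by move=> n y _; rewrite lee_fin.
  - by move=> y _ m n mn; rewrite lee_fin; exact/lefP/nd_nnsfun_approx.
transitivity (limn (fun n => \int[mu]_x ((h_ n x)%:E * (f x)%:E))); last first.
  rewrite -monotone_convergence//.
  - apply: eq_integral => x _; apply/cvg_lim => //.
    by apply: cvgeZr.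
  - by move=> n; exact: emeasurable_funM.
  - by move=> n y _; rewrite mule_ge0 ?lee_fin.
  - move=> y _ m n mn; rewrite lee_wpmul2r ?lee_fin//.
    exact/lefP/nd_nnsfun_approx.
congr (limn _); apply/funext => n.
under [LHS]eq_integral do rewrite fimfunE -fsumEFin//.
have mind (r : R) : measurable_fun setT (fun x => (r * \1_(h_ n @^-1` [set r]) x)%:E).
  by apply/measurable_EFinP; exact: measurable_funM.
rewrite ge0_integral_fsum//; last by move=> r x _; exact: nnfun_muleindic_ge0.
transitivity (\int[mu]_x (\sum_(r \in range (h_ n))
   ((r * \1_(h_ n @^-1` [set r]) x)%:E * (f x)%:E))); last first.
  apply: eq_integral => x _; rewrite -ge0_mule_fsuml => [|r]; last first.
    exact: nnfun_muleindic_ge0.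
  by rewrite fsumEFin// -(fimfunE _ x).
rewrite ge0_integral_fsum//; last 2 first.
- by move=> r; exact: emeasurable_funM.
- by move=> r x _; rewrite mule_ge0 ?nnfun_muleindic_ge0 ?lee_fin.
apply: eq_fsbigr => r _.
rewrite integralZl_indic_nnsfun// integral_indic// setIT.
under [RHS]eq_integral do rewrite EFinM -muleA.
(* A nonnegative simple function has an empty fibre over a negative value; otherwise the factor r
   comes out of the integral. *)
have [r0|r0] := leP 0%R r; last first.
  rewrite preimage_nnfun0//.
  rewrite measure0 mule0 integral0_eq// => x _.
  by rewrite indic0 mul0e mule0.
rewrite ge0_integralZl//; last 2 first.
- by apply: emeasurable_funM => //; exact/measurable_EFinP.
- by move=> x _; rewrite mule_ge0 ?lee_fin.
congr (_ * _); rewrite /density_measure /= [LHS]integral_mkcond.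
by apply: eq_integral => x _; rewrite epatch_indic muleC.
Qed.

End DensityMeasure.

Section TimeChangeTheory.
Context {R : realType}.
Local Notation mu := (@lebesgue_measure R).

(** The two clocks play symmetric roles, so each lemma below serves g and its inverse; what has to
    be derived is the monotonicity of the inverse and its value at 0. *)
Lemma time_change_sym (g ginv : R -> R) : time_change g ginv -> time_change ginv g.
Proof.
move=> tc; case: (tc) => g0 gi0 ginc gz giK gK dg dgi ig igi.
split=> // [u v u0 uv|].
  have v0 : 0 <= v by rewrite (le_trans u0) ?ltW.
  rewrite ltNge; apply/negP; rewrite le_eqVlt => /predU1P[e|lt].
    by have := gK _ v0; rewrite e gK// => h; move: uv; rewrite h ltxx.
  have := ginc _ _ (gi0 v v0) lt.
  by rewrite !gK// => vu; have := lt_trans uv vu; rewrite ltxx.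
by rewrite -{1}gz giK.
Qed.

Variables g ginv : R -> R.
Hypothesis tc : time_change g ginv.

Let g0 u : 0 <= u -> 0 <= g u. Proof. exact: (tc_ge0 tc). Qed.
Let gi0 u : 0 <= u -> 0 <= ginv u. Proof. exact: (tc_inv_ge0 tc). Qed.

Lemma time_change_le u v : 0 <= u -> u <= v -> g u <= g v.
Proof.
move=> u0; rewrite le_eqVlt => /predU1P[->//|uv].
exact/ltW/(tc_increasing tc).
Qed.

Lemma time_change_ltE u v : 0 <= u -> 0 <= v -> (g u < g v) = (u < v).
Proof.
move=> u0 v0; apply/idP/idP => [|uv]; last exact: (tc_increasing tc).
by apply: contraTT; rewrite -!leNgt; exact: time_change_le.
Qed.

(** g is constrained on the half-line only. Freezing it at [g 0] on negative arguments gives a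
    monotone, hence measurable, function on the line. *)
Definition time_change_ext (u : R) := g (Num.max u 0).

Lemma time_change_extE u : 0 <= u -> time_change_ext u = g u.
Proof. by move=> u0; rewrite /time_change_ext max_l. Qed.

Lemma measurable_time_change_ext : measurable_fun setT time_change_ext.
Proof.
apply: nondecreasing_measurable => // u v uv.
apply: time_change_le; first by rewrite le_max lexx orbT.
by rewrite ge_max !le_max uv lexx orbT.
Qed.

Lemma measurable_time_change : measurable_fun `[(0 : R), +oo[ g.
Proof.
apply: (eq_measurable_fun time_change_ext) => [u /set_mem /=|].
  by rewrite in_itv/= andbT => /time_change_extE.
exact: measurable_funTS measurable_time_change_ext.
Qed.

(** Difference quotients with steps 1 / (n + 1): their limit exhibits g' as measurable and
    nonnegative on the open half-line. *)
Let quot (n : nat) (u : R) : R :=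
  n.+1%:R * (time_change_ext (u + n.+1%:R^-1) - time_change_ext u).

Let quot_cvg u : 0 < u -> quot ^~ u @ \oo --> derive1 g u.
Proof.
move=> u0; have := tc_derivable tc u0; rewrite derive1E.
move=> /cvg_dnbhs_at_right/cvg_at_rightP/(_ (@harmonic R)).
move=> /(_ (conj (fun n => harmonic_gt0 n) (@cvg_harmonic R))).
apply: cvg_trans; apply: near_eq_cvg; near=> n.
rewrite /quot /harmonic /= !time_change_extE ?ltW//; last first.
  by rewrite addr_gt0// invr_gt0.
by rewrite invrK /GRing.scale /= mulr1 [u + _]addrC.
Unshelve. all: end_near. Qed.

Lemma measurable_derive1_time_change : measurable_fun `](0 : R), +oo[ (derive1 g).
Proof.
apply: (measurable_fun_cvg (h := quot)) => [n|u]; last first.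
  by rewrite /= in_itv/= andbT; exact: quot_cvg.
apply: measurable_funTS; apply: measurable_funM => //.
apply: measurable_funB; last exact: measurable_time_change_ext.
apply: measurableT_comp; first exact: measurable_time_change_ext.
exact: measurable_funD.
Qed.

Lemma derive1_time_change_ge0 u : 0 < u -> 0 <= derive1 g u.
Proof.
move=> u0; rewrite -(cvg_lim (@Rhausdorff R) (quot_cvg u0)).
apply: limr_ge; first by apply/cvg_ex; exists (derive1 g u); exact: quot_cvg.
apply: nearW => n; rewrite /quot mulr_ge0// subr_ge0 !time_change_extE ?ltW//.
  by apply: (tc_increasing tc); rewrite ?ltW// ltrDl invr_gt0.
by rewrite addr_gt0// invr_gt0.
Qed.

Let dens (u : R) : R := if 0 < u then derive1 g u else 0.

Let mdens : measurable_fun setT dens.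
Proof.
apply: measurable_fun_if => //.
- by apply: measurable_fun_ltr.
- rewrite setTI (_ : _ @^-1` _ = `](0 : R), +oo[%classic).
    exact: measurable_derive1_time_change.
  by apply/seteqP; split=> u /=; rewrite in_itv/= andbT.
Qed.

Let dens0 u : 0 <= dens u.
Proof. by rewrite /dens; case: ifPn => // /derive1_time_change_ge0. Qed.

Let nu := density_measure mu mdens dens0.

Let ext : measurableTypeR R -> measurableTypeR R := time_change_ext.

Let mext : measurable_fun setT ext.
Proof. exact: measurable_time_change_ext. Qed.

Let half : set (measurableTypeR R) := `[0, +oo[%classic.

Let mhalf : measurable_fun [set: measurableTypeR R] (\1_half : measurableTypeR R -> R).
Proof. by apply/measurable_indicP; exact: measurable_itv. Qed.

Let half0 u : 0 <= (\1_half u : R).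
Proof. by rewrite indicE. Qed.

Let integral_dens (t : R) : 0 <= t ->
  (\int[mu]_(u in `]-oo, t[) (dens u)%:E = (g t)%:E)%E.
Proof.
move=> t0; rewrite (tc_integral tc t0) (@integral_itv_bndoo _ 0 t _ true false).
  rewrite [RHS](_ : _ = \int[mu]_(u in `]-oo, t[ `&` `]0%R, +oo[) (derive1 g u)%:E)%E.
    rewrite integral_mkcondr; apply: eq_integral => u _.
    rewrite /dens patchE mem_setE in_itv/= andbT.
    by case: ifP.
  congr (integral _ _ _); apply/seteqP; split=> u /=; rewrite !in_itv/= ?andbT.
    by move=> /andP[-> ->].
  by move=> [-> ->].
apply/measurable_EFinP; apply: measurable_funS measurable_derive1_time_change => //.
by apply: subset_itvl; rewrite bnd_simp.
Qed.

(** The image of g'(u) du under g is Lebesgue measure on the half-line: for t > 0 the preimage of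
    the ray ]-oo, t[ has mass g(ginv t) = t, and rays are a generating class stable under
    intersection. *)
Let pushforward_halfE A : measurable A ->
  pushforward nu ext A = density_measure mu mhalf half0 A.
Proof.
move=> mA.
pose m1' : {measure set (measurableTypeR R) -> \bar R} := pushforward nu ext.
pose m1 := m1' mext.
pose m2 : {measure set (measurableTypeR R) -> \bar R} :=
  density_measure mu mhalf half0.
have m2E D : m2 D = (\int[mu]_(u in D) (\1_half u)%:E)%E by [].
have hI : setI_closed (@RGenInftyO.G R).
  move=> _ _ [x ->] [y ->]; exists (Num.min x y).
  apply/seteqP; split=> u /=; rewrite !in_itv /= lt_min; first by move=> [-> ->].
  by move=> /andP[].
have hG n : @RGenInftyO.G R `]-oo, n%:R[%classic by exists n%:R.
have hcov : \bigcup_(k in [set: nat]) `]-oo, (k%:R : R)[%classic = setT.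
  rewrite -subTset => u _; have [n hn] := exists_nat_gt (u + 1).
  by exists n.+1 => //=; rewrite in_itv/=; lra.
have m12 (t : R) : m1 `]-oo, t[%classic = m2 `]-oo, t[%classic /\
    (m1 `]-oo, t[%classic < +oo)%E.
  (* For t <= 0 neither measure charges the ray. *)
  have [t0|t0] := leP t 0.
    have -> : m1 `]-oo, t[%classic = 0%E.
      rewrite /m1 /= /pushforward (_ : _ @^-1` _ = set0) ?measure0//.
      apply/seteqP; split=> u //=; rewrite in_itv/= ltNge; apply/negP; rewrite negbK.
      by rewrite (le_trans t0)// g0// le_max lexx orbT.
    split; last exact: ltry.
    rewrite m2E integral0_eq// => u /=; rewrite in_itv/= => ut.
    rewrite indicE memNset// /half /= in_itv/= andbT; apply/negP; rewrite -ltNge.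
    exact: lt_le_trans t0.
  have -> : m1 `]-oo, t[%classic = t%:E.
    rewrite /m1 /= /pushforward (_ : _ @^-1` _ = `]-oo, ginv t[%classic).
      rewrite -[LHS]/(\int[mu]_(u in `]-oo, ginv t[) (dens u)%:E)%E.
      by rewrite integral_dens ?(tc_K tc) ?gi0 ?ltW.
    have git : 0 < ginv t.
      by have := tc_increasing (time_change_sym tc) (lexx 0) t0;
        rewrite (tc_0 (time_change_sym tc)).
    have e u : (ext u < t) = (u < ginv t).
      rewrite /ext /time_change_ext -[X in _ < X](tc_K tc (ltW t0)) time_change_ltE.
      + by rewrite gt_max git andbT.
      + by rewrite le_max lexx orbT.
      + exact: ltW.
    by apply/seteqP; split=> u /=; rewrite !in_itv/= e.
  split; last exact: ltry.
  rewrite m2E integral_indic//; last exact: measurable_itv.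
  rewrite (_ : _ `&` _ = `[0, t[%classic).
    by have := lebesgue_measure_itv `[0%R, t[; rewrite /= lte_fin t0 sube0 => <-.
  by rewrite /half; apply/seteqP; split=> u /=; rewrite !in_itv/= ?andbT => /andP.
exact: (@measure_unique _ R (measurableTypeR R) (@RGenInftyO.G R)
  (fun n => `]-oo, n%:R[%classic) (RGenInftyO.measurableE R) hI hG hcov m1 m2
  (fun B hB => let: ex_intro t e := hB in eq_ind_r (fun C => m1 C = m2 C) (proj1 (m12 t)) e)
  (fun n => proj2 (m12 n%:R)) A mA).
Qed.

(** Stated in the extended reals for nonnegative F, so that it carries over finiteness as well as
    values. *)
Lemma time_change_substitution (F : R -> R) : measurable_fun `[(0 : R), +oo[ F ->
  (forall s, 0 <= s -> 0 <= F s) ->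
  (\int[mu]_(u in `[0%R, +oo[) (F (g u) * derive1 g u)%:E =
   \int[mu]_(s in `[0%R, +oo[) (F s)%:E)%E.
Proof.
move=> mF F0.
pose FF s := (F \_ `[(0 : R), +oo[) s.
have mFF : measurable_fun setT FF by apply/(measurable_restrictT _ (measurable_itv _)).
have FF0 s : 0 <= FF s.
  by rewrite /FF patchE; case: ifPn => // /set_mem; rewrite /= in_itv/= andbT => /F0.
have mFE : measurable_fun setT (EFin \o FF) by exact/measurable_EFinP.
transitivity (\int[mu]_u ((FF (ext u))%:E * (dens u)%:E))%E.
  (* The point 0 is a null set, and g' is controlled on the open half-line only. *)
  rewrite -integral_itv_obnd_cbnd; last first.
    apply/measurable_EFinP; apply: measurable_funM measurable_derive1_time_change.
    apply: (eq_measurable_fun (FF \o ext)) => [u /set_mem /=|].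
      rewrite in_itv/= andbT => u0.
      by rewrite /FF patchE mem_setE in_itv/= andbT /ext time_change_extE ?g0 ?ltW.
    by apply: measurable_funTS; apply: measurableT_comp mFF _;
      exact: measurable_time_change_ext.
  rewrite integral_mkcond; apply: eq_integral => u _.
  rewrite patchE mem_setE in_itv/= andbT /dens.
  have [u0|u0] := ltP 0 u; last by rewrite mule0.
  by rewrite /FF patchE mem_setE in_itv/= andbT /ext time_change_extE ?g0 ?ltW.
transitivity (\int[pushforward nu ext]_s (FF s)%:E)%E.
  rewrite (ge0_integral_pushforward mext)//; last by move=> s _; rewrite lee_fin.
  rewrite preimage_setT ge0_integral_density_measure//.
  - exact: measurableT_comp mFE mext.
  - by move=> u; rewrite lee_fin.
transitivity (\int[density_measure mu mhalf half0]_s (FF s)%:E)%E.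
  by apply: eq_measure_integral => A mA _; exact: pushforward_halfE.
rewrite ge0_integral_density_measure// [RHS]integral_mkcond.
apply: eq_integral => s _; rewrite indicE /FF !patchE /half.
by case: (s \in _); rewrite ?mule1 ?mule0.
Qed.

End TimeChangeTheory.

(** * Fubini's theorem along the contour, and matrix Laplace transforms *)

Section DominatedFubini.
Context {R : realType} {d1 d2} {T1 : measurableType d1} {T2 : measurableType d2}.
Variables (m1 : {sigma_finite_measure set T1 -> \bar R})
  (m2 : {sigma_finite_measure set T2 -> \bar R}).

Lemma measurable_fst_on {d3} {T3 : measurableType d3} (D1 : set T1) (D2 : set T2)
    (f : T1 -> T3) : measurable D1 -> measurable D2 ->
  measurable_fun D1 f -> measurable_fun (D1 `*` D2) (fun z => f z.1).
Proof.
move=> mD1 mD2 mf; apply: (measurable_comp mD1 _ mf).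
  by move=> _ [[x y] [/= xD yD] <-].
exact: measurable_funTS measurable_fst.
Qed.

Lemma measurable_snd_on {d3} {T3 : measurableType d3} (D1 : set T1) (D2 : set T2)
    (f : T2 -> T3) : measurable D1 -> measurable D2 ->
  measurable_fun D2 f -> measurable_fun (D1 `*` D2) (fun z => f z.2).
Proof.
move=> mD1 mD2 mf; apply: (measurable_comp mD2 _ mf).
  by move=> _ [[x y] [/= xD yD] <-].
exact: measurable_funTS measurable_snd.
Qed.

(** The first factor has finite mass and the bound C b(u) does not involve x, so the extension of k
    by 0 is integrable for the product measure. *)
Lemma dominated_Fubini (D1 : set T1) (D2 : set T2) (k : T1 -> T2 -> R) (C : R) (b : T2 -> R) :
  measurable D1 -> measurable D2 -> (m1 D1 < +oo)%E ->
  measurable_fun (D1 `*` D2) (fun z => k z.1 z.2) ->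
  m2.-integrable D2 (EFin \o b) ->
  (forall x u, D1 x -> D2 u -> `|k x u| <= C * b u) ->
  Rintegral m1 D1 (fun x => Rintegral m2 D2 (k x)) =
  Rintegral m2 D2 (fun u => Rintegral m1 D1 (k ^~ u)).
Proof.
move=> mD1 mD2 D1oo mk ib kb.
have mD : measurable (D1 `*` D2) by exact: measurableX.
pose f : T1 * T2 -> \bar R := (fun z : T1 * T2 => (k z.1 z.2)%:E) \_ (D1 `*` D2).
have mf : measurable_fun setT f.
  by apply/(measurable_restrictT _ mD)/measurable_EFinP.
have fE x u : f (x, u) = (if (x \in D1) && (u \in D2) then (k x u)%:E else 0%E).
  rewrite /f patchE; congr (if _ then _ else _).
  apply/idP/andP => [/set_mem[/= ? ?]|[/set_mem ? /set_mem ?]]; last exact/mem_set.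
  by split; exact/mem_set.
have f2 x : (\int[m2]_u f (x, u) =
    if x \in D1 then \int[m2]_(u in D2) (k x u)%:E else 0)%E.
  case: ifPn => xD; last by rewrite integral0_eq// => u _; rewrite fE (negbTE xD).
  rewrite [RHS]integral_mkcond; apply: eq_integral => u _.
  by rewrite fE xD patchE.
have f1 u : (\int[m1]_x f (x, u) =
    if u \in D2 then \int[m1]_(x in D1) (k x u)%:E else 0)%E.
  case: ifPn => uD; last by rewrite integral0_eq// => x _; rewrite fE (negbTE uD) andbF.
  rewrite [RHS]integral_mkcond; apply: eq_integral => x _.
  by rewrite fE uD andbT patchE.
have mk1 u : D2 u -> measurable_fun D1 (k ^~ u).
  move=> uD; apply: (measurable_comp mD _ mk (g := fun x => (x, u))).
    by move=> _ [x xD <-].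
  exact: measurable_funTS (pair2_measurable u).
have mk2 x : D1 x -> measurable_fun D2 (k x).
  move=> xD; apply: (measurable_comp mD _ mk (g := fun u => (x, u))).
    by move=> _ [u uD <-].
  exact: measurable_funTS (pair1_measurable x).
have iCb : m2.-integrable D2 (EFin \o (fun u => C * b u)).
  exact: eq_integrable (integrableZl mD2 C ib).
have ik2 x : D1 x -> m2.-integrable D2 (EFin \o k x).
  move=> xD; apply: le_integrable iCb => //=.
    by apply/measurable_EFinP; exact: mk2.
  by move=> u uD; rewrite lee_fin (le_trans (kb _ _ xD uD))// ler_norm.
have ik1 u : D2 u -> m1.-integrable D1 (EFin \o k ^~ u).
  move=> uD; apply: measurable_bounded_integrable => //; first exact: mk1.
  exists (C * b u); split; rewrite ?num_real// => M hM x xD /=.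
  by rewrite (le_trans (kb _ _ xD uD))// ltW.
have intf : (m1 \x m2)%E.-integrable setT f.
  apply/integrable12ltyP => //.
  apply: (@le_lt_trans _ _ (\int[m1]_(x in D1) (Rintegral m2 D2 (fun u => C * b u))%:E)%E).
    rewrite [leRHS]integral_mkcond; apply: ge0_le_integral => //=.
    - by move=> x _; exact: integral_ge0.
    - apply: (@measurable_fun_fubini_tonelli_F _ _ _ _ _ m2 (fun z => `|f z|%E)) => //.
      exact: measurableT_comp.
    - by apply/(measurable_restrictT _ mD1); exact: measurable_cst.
    move=> x _; rewrite patchE; case: ifPn => xD; last first.
      by rewrite integral0_eq// => u _; rewrite fE (negbTE xD) abse0.
    rewrite /Rintegral fineK; last exact: integrable_fin_num.
    rewrite [leRHS]integral_mkcond; apply: ge0_le_integral => //=.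
    - apply: measurableT_comp => //.
      exact: measurable_fun_pair2.
    - apply/(measurable_restrictT _ mD2)/measurable_EFinP.
      by case/integrableP: iCb => /measurable_EFinP.
    move=> u _; rewrite fE xD patchE /=; case: ifPn => uD; last by rewrite abse0.
    by rewrite lee_fin kb//; exact: set_mem.
  by rewrite integral_cst// ltey_eq fin_numM// ge0_fin_numE.
have H := Fubini intf.
have E1 : (\int[m1]_x \int[m2]_y f (x, y) =
    \int[m1]_(x in D1) (Rintegral m2 D2 (k x))%:E)%E.
  rewrite [RHS]integral_mkcond; apply: eq_integral => x _.
  rewrite f2 patchE; case: ifPn => // xD.
  by rewrite /Rintegral fineK//; apply/integrable_fin_num/ik2/set_mem.
have E2 : (\int[m2]_y \int[m1]_x f (x, y) =
    \int[m2]_(y in D2) (Rintegral m1 D1 (k ^~ y))%:E)%E.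
  rewrite [RHS]integral_mkcond; apply: eq_integral => y _.
  rewrite f1 patchE; case: ifPn => // yD.
  by rewrite /Rintegral fineK//; apply/integrable_fin_num/ik1/set_mem.
by rewrite /Rintegral -[in LHS]E1 -[in RHS]E2 H.
Qed.

End DominatedFubini.

Section ContourLaplace.
Context {R : realType}.
Local Notation mu := (@lebesgue_measure R).
Local Notation half := (`[(0 : R), +oo[%classic).
Local Notation twopii := (2 * (@pi R)%:C * imag_unit).
Local Notation toC := (map_mx (real_complex R)).

Lemma cintegral_exchange (D1 D2 : set (measurableTypeR R)) (k : R -> R -> R[i])
    (C : R) (b : R -> R) :
  measurable D1 -> measurable D2 -> (mu D1 < +oo)%E ->
  cmeasurable (D1 `*` D2) (fun z => k z.1 z.2) ->
  mu.-integrable D2 (EFin \o b) ->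
  (forall x u, D1 x -> D2 u -> cabs (k x u) <= C * b u) ->
  cintegral D1 (fun x => cintegral D2 (k x)) =
  cintegral D2 (fun u => cintegral D1 (k ^~ u)).
Proof.
move=> mD1 mD2 D1oo [m1 m2] ib kb; rewrite /cintegral /=; congr (_ +i* _).
  apply: (@dominated_Fubini R _ _ (measurableTypeR R) (measurableTypeR R) mu mu
    D1 D2 (fun x u => Re (k x u)) C b mD1 mD2 D1oo m1 ib).
  by move=> x u xD uD; rewrite (le_trans (normRe_cabs _))// kb.
apply: (@dominated_Fubini R _ _ (measurableTypeR R) (measurableTypeR R) mu mu
  D1 D2 (fun x u => Im (k x u)) C b mD1 mD2 D1oo m2 ib).
by move=> x u xD uD; rewrite (le_trans (normIm_cabs _))// kb.
Qed.

Variable (gam : R -> R[i]).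
Hypotheses (gamC : piecewise_C1 gam).
Hypothesis gam_rhp : forall z, on_path gam z -> 0 < Re z.

Section Exchange.
Variables (G h : R -> R) (c : R[i] -> R[i]).
Hypotheses (mG : measurable_fun half G) (mh : measurable_fun half h)
  (G0 : forall u, 0 <= u -> 0 <= G u) (cc : pcontinuous gam c)
  (ih : forall e, 0 < e -> mu.-integrable half (EFin \o (fun u => expR (- (e * G u)) * `|h u|))).

(** The pair (G, h) covers both transforms of the formula: G is the identity for [h1] and [ginv] for
    [h2]. *)
Lemma laplace_integrable (w : R[i]) : 0 < Re w ->
  cintegrable half (fun u => cexp (- w * (G u)%:C) * (h u)%:C).
Proof.
move=> w0; apply: (@cintegrable_dominated _ _ _ (fun u => 2 * (expR (- (Re w * G u)) * `|h u|))).
- exact: measurable_itv.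
- apply: cmeasurableM; last exact: cmeasurable_real.
  apply: cmeasurable_cexp; apply: cmeasurableM; first exact: cmeasurable_cst.
  exact: cmeasurable_real.
- by apply: integrableZl_real; [exact: measurable_itv|exact: ih].
- move=> u; rewrite /= in_itv/= andbT => u0; rewrite (le_trans (cabsM _ _))//.
  rewrite mulrA cabs_real ler_wpM2r// cabs_cexp_decay//; exact: G0.
Qed.

(** On the contour Re w >= e, so the double integrand is at most a constant times e^(-e G(u))
    |h(u)|, and the two integrals can be exchanged. *)
Lemma path_integral_laplace :
  path_integral gam (fun w => c w * cintegral half (fun u => cexp (- w * (G u)%:C) * (h u)%:C))
  = cintegral half
      (fun u => (h u)%:C * path_integral gam (fun w => cexp (- w * (G u)%:C) * c w)).
Proof.
have [e e0 he] := path_Re_lower_bound gamC gam_rhp.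
have [K K0 hK] := pcontinuous_bounded cc.
have [mg [L hL]] := piecewise_C1_cderive1 gamC.
have L0 : 0 <= L by rewrite (le_trans (cabs_ge0 _) (hL 0 _))// lexx ler01.
pose k x u := c (gam x) * cderive1 gam x * (cexp (- gam x * (G u)%:C) * (h u)%:C).
rewrite /path_integral.
transitivity (cintegral `[0, 1] (fun x => cintegral half (k x))).
  apply: eq_cintegral => x /set_mem /=; rewrite in_itv/= => x01.
  have xg : on_path gam (gam x) by exists x.
  rewrite (cintegralZ (c (gam x) * cderive1 gam x) (measurable_itv _)
    (laplace_integrable (gam_rhp xg))).
  exact: mulrAC.
rewrite (@cintegral_exchange _ _ _ (K * L * 2) (fun u => expR (- (e * G u)) * `|h u|)).
- apply: eq_cintegral => u _; rewrite -cintegralZ; last 2 first.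
  + exact: measurable_itv.
  + apply: (@path_integrand_integrable _ _ (fun w => cexp (- w * (G u)%:C) * c w)) => //.
    exact: ccontinuousM (pcontinuous_cexp gamC (G u)) cc.
  by apply: eq_cintegral => x _; rewrite /k; ring.
- exact: measurable_itv.
- exact: measurable_itv.
- by rewrite lebesgue_measure_segment// ltry.
- have gm := ccontinuous_cmeasurable (measurable_itv _) (piecewise_C1_ccontinuous gamC).
  have cm := ccontinuous_cmeasurable (measurable_itv _) cc.
  have lift1 (f : R -> R[i]) : cmeasurable `[(0 : R), 1] f ->
      cmeasurable (`[(0 : R), 1]%classic `*` half) (fun z => f z.1).
    move=> [f1 f2]; split.
      apply: (@measurable_fst_on _ _ _ _ _ _ _ _ (fun x => Re (f x))) f1; exact: measurable_itv.
    apply: (@measurable_fst_on _ _ _ _ _ _ _ _ (fun x => Im (f x))) f2; exact: measurable_itv.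
  have lift2 (f : R -> R) : measurable_fun half f ->
      cmeasurable (`[(0 : R), 1]%classic `*` half) (fun z => (f z.2)%:C).
    move=> mf; apply: cmeasurable_real.
    by apply: measurable_snd_on mf; exact: measurable_itv.
  have k1 : cmeasurable (`[(0 : R), 1]%classic `*` half)
     (fun z => c (gam z.1) * cderive1 gam z.1).
    exact: cmeasurableM (lift1 _ cm) (lift1 _ mg).
  have k2 : cmeasurable (`[(0 : R), 1]%classic `*` half)
     (fun z => - 1 * gam z.1 * (G z.2)%:C).
    apply: cmeasurableM (lift2 _ mG).
    exact: cmeasurableM (cmeasurable_cst _ _) (lift1 _ gm).
  have := cmeasurableM k1 (cmeasurableM (cmeasurable_cexp k2) (lift2 _ mh)).
  congr cmeasurable.
  by apply/funext => z; rewrite /k mulN1r.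
- exact: ih.
- move=> x u; rewrite /= !in_itv/= andbT => x01 u0.
  have xg : on_path gam (gam x) by exists x.
  rewrite -2!mulrA [2 * _]mulrA mulrA (le_trans (cabsM _ _))// ler_pM ?cabs_ge0//.
    by rewrite (le_trans (cabsM _ _))// ler_pM ?cabs_ge0 ?hK ?hL.
  rewrite (le_trans (cabsM _ _))// cabs_real ler_wpM2r// cabs_cexp_decay ?he//.
  exact: G0.
Qed.

End Exchange.

Hypothesis gam01 : gam 0 = gam 1.
Variables (n : nat) (T : 'M[R]_n) (Q : R -> 'M[R]_n).
Hypothesis gamA : forall z, eigenvalue (toC (- T)) z ->
  off_path gam z /\ winding gam z = 1.
Hypotheses (Q0 : Q 0 = 1%:M)
  (QD : forall s t, 0 <= s -> 0 <= t -> Q (s + t) = Q s *m Q t)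
  (Qle1 : forall t i j, 0 <= t -> `|Q t i j| <= 1)
  (Qder : forall i j, (fun h => h^-1 * (Q h i j - (i == j)%:R)) @ 0^'+ --> T i j).

Let resc i j : pcontinuous gam (fun w => invmx (w%:M - toC (- T)) i j).
Proof. exact: resolvent_pcontinuous. Qed.

Let QE := contour_semigroupE gamC gam01 gam_rhp gamA Q0 QD Qle1 Qder.

(** Q is the contour integral divided by 2 pi i, hence decays at the rate given by the distance from
    the contour to the imaginary axis. *)
Lemma semigroup_decay : exists K e : R, [/\ 0 <= K, 0 < e &
  forall t i j, 0 <= t -> `|Q t i j| <= K * expR (- (e * t))].
Proof.
have [K [e [K0 e0 hK]]] := contour_semigroup_decay gamC gam_rhp gamA.
pose c : R[i] := twopii^-1.
exists (cabs c * K), e; split; rewrite ?mulr_ge0 ?cabs_ge0// => t i j t0.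
rewrite -mulrA; apply: (le_trans _ (ler_wpM2l (cabs_ge0 c) (hK t t0))).
apply: (le_trans _ (ler_wpM2l (cabs_ge0 c) (cabs_le_mnorm _ i j))).
apply: (le_trans _ (cabsM _ _)).
by rewrite QE// 2!mxE mulrA mulVf ?twopii_neq0// mul1r cabs_real.
Qed.

(** The increment of M is h T M(s) + O(h^2) with M bounded, and h <= 1 absorbs the square. *)
Lemma semigroup_lipschitz : exists2 L : R, 0 <= L &
  forall s h i j, 0 <= s -> 0 <= h <= 1 -> `|Q (s + h) i j - Q s i j| <= L * h.
Proof.
have [K K0 hK] := contour_semigroup_taylor gamC gam01 gam_rhp gamA.
have [KM [e [KM0 e0 hM]]] := contour_semigroup_decay gamC gam_rhp gamA.
pose M := contour_semigroup gam (toC (- T)).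
pose c : R[i] := twopii^-1; pose N := mnorm (toC (- T)) * KM.
have N0 : 0 <= N by rewrite mulr_ge0 ?mnorm_ge0.
exists (cabs c * (K + N)); first by rewrite mulr_ge0 ?cabs_ge0 ?addr_ge0.
move=> s h i j s0 /andP[h0 h1].
have -> : `|Q (s + h) i j - Q s i j| = cabs (c * (M (s + h) - M s) i j).
  rewrite /M !QE ?addr_ge0// -scalerBr !mxE mulrA mulVf ?twopii_neq0// mul1r.
  by rewrite -rmorphB cabs_real.
rewrite (le_trans (cabsM _ _))// -mulrA ler_wpM2l ?cabs_ge0//.
rewrite (le_trans (cabs_le_mnorm _ _ _))//.
rewrite (_ : M (s + h) - M s = (M (s + h) - M s + h%:C *: (toC (- T) *m M s))
  - h%:C%:M *m (toC (- T) *m M s)); last by rewrite mul_scalar_mx addrK.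
rewrite (le_trans (mnormD _ _))// mnormN mulrDl lerD//.
  by rewrite (le_trans (hK _ _ s0 h0))// expr2 mulrA ler_piMr// mulr_ge0.
rewrite mul_scalar_mx.
rewrite (_ : mnorm (h%:C *: _) = h * mnorm (toC (- T) *m M s)); last first.
  rewrite /mnorm mulr_sumr; apply: eq_bigr => k _; rewrite mulr_sumr.
  apply: eq_bigr => l _; rewrite mxE /cabs Re_scale Im_scale !normrM ger0_norm//.
  by rewrite mulrDr.
rewrite mulrC ler_wpM2r// (le_trans (mnormM _ _))// ler_wpM2l ?mnorm_ge0//.
rewrite (le_trans (hM _ s0))// ler_piMr// -[leRHS]expR0 ler_expR oppr_le0.
by rewrite mulr_ge0// ltW.
Qed.

Lemma semigroup_measurable i j : measurable_fun half (fun t => Q t i j).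
Proof.
have [L L0 hL] := semigroup_lipschitz.
(* Frozen at Q(0) for negative times, the entry is continuous on the whole line, because the maximum
   with 0 does not increase distances. *)
pose q t := Q (Num.max t 0) i j.
have dist s t : 0 <= s -> s <= t -> t - s <= 1 -> `|Q t i j - Q s i j| <= L * (t - s).
  move=> s0 st st1; have := hL s (t - s) i j s0; rewrite subr_ge0 st st1 subrKC.
  exact.
have qc : continuous q.
  move=> x; apply/cvgrPdist_le => e e0.
  have d0 : 0 < Num.min 1 (e / (L + 1)) by rewrite lt_min ltr01 divr_gt0// ltr_wpDl.
  near=> y.
  have xy : `|Num.max x 0 - Num.max y 0| <= `|x - y|.
    have h1 := ler_norm (x - y); have := ler_norm (y - x); rewrite distrC => h2.
    by case: (leP x 0) => ?; case: (leP y 0) => ?; rewrite ler_norml; lra.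
  have xyd : `|x - y| < Num.min 1 (e / (L + 1)).
    by near: y; apply: cvgr_dist_lt => //; exact: cvg_id.
  move: xyd; rewrite lt_min => /andP[xy1 xye].
  have key s t : 0 <= s -> s <= t -> t - s <= `|x - y| -> `|Q t i j - Q s i j| <= e.
    move=> s0 st h; rewrite (le_trans (dist s t s0 st (le_trans h (ltW xy1))))//.
    move: xye; rewrite ltr_pdivlMr ?ltr_wpDl// => xye.
    nra.
  rewrite /q; have [h|/ltW h] := leP (Num.max y 0) (Num.max x 0).
    apply: key => //; first by rewrite le_max lexx orbT.
    by rewrite (le_trans _ xy)// ler_norm.
  rewrite distrC; apply: key => //; first by rewrite le_max lexx orbT.
  by rewrite (le_trans _ xy)// distrC ler_norm.
apply: (eq_measurable_fun q) => [u /set_mem /=|].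
  by rewrite in_itv/= andbT /q => u0; rewrite max_l.
exact: measurable_funTS (continuous_measurable_fun qc).
Unshelve. all: end_near. Qed.

Section MatrixLaplace.
Variables (G h : R -> R).
Hypotheses (mG : measurable_fun half G) (mh : measurable_fun half h)
  (G0 : forall u, 0 <= u -> 0 <= G u)
  (ih : forall e, 0 < e ->
    mu.-integrable half (EFin \o (fun u => expR (- (e * G u)) * `|h u|))).

Lemma semigroup_comp_measurable i j : measurable_fun half (fun u => Q (G u) i j).
Proof.
apply: (measurable_comp (F := half) _ _ (semigroup_measurable i j) mG).
  exact: measurable_itv.
by move=> _ [u /= + <-]; rewrite !in_itv/= !andbT => /G0.
Qed.

Lemma semigroup_laplace_integrable i j :
  mu.-integrable half (EFin \o (fun u => h u * Q (G u) i j)).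
Proof.
have [K [e [K0 e0 hK]]] := semigroup_decay.
have iK : mu.-integrable half (EFin \o (fun u => K * (expR (- (e * G u)) * `|h u|))).
  by apply: integrableZl_real; [exact: measurable_itv|exact: ih].
apply: le_integrable iK; first exact: measurable_itv.
  by apply/measurable_EFinP; exact: measurable_funM (semigroup_comp_measurable i j).
move=> u; rewrite /= in_itv/= andbT => u0; rewrite lee_fin normrM mulrA.
by rewrite mulrC (le_trans _ (ler_norm _))// ler_wpM2r// hK// G0.
Qed.

Lemma path_integral_resolvent_laplace i j :
  path_integral gam (fun w => invmx (w%:M - toC (- T)) i j *
      cintegral half (fun u => cexp (- w * (G u)%:C) * (h u)%:C))
  = twopii * (Rintegral mu half (fun u => h u * Q (G u) i j))%:C.
Proof.
rewrite (path_integral_laplace mG mh G0 (resc i j) ih).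
transitivity (cintegral half (fun u => twopii * (h u * Q (G u) i j)%:C)).
  apply: eq_cintegral => u /set_mem /=; rewrite in_itv/= andbT => u0.
  have /matrixP/(_ i j) := QE (G0 u0); rewrite !mxE => ->.
  by rewrite rmorphM mulrCA.
rewrite (cintegralZ twopii (measurable_itv _)); last first.
  by split; [exact: semigroup_laplace_integrable|exact: integrable0].
by congr (_ * _); rewrite /cintegral /= /Rintegral integral0.
Qed.

(** The factor w, which stems from [h2], acts under the contour integral as multiplication by -T. *)
Lemma path_integral_mul_resolvent_laplace i j :
  path_integral gam (fun w => w * invmx (w%:M - toC (- T)) i j *
      cintegral half (fun u => cexp (- w * (G u)%:C) * (h u)%:C))
  = twopii * (\sum_k (- T) i k * Rintegral mu half (fun u => h u * Q (G u) k j))%:C.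
Proof.
have cw : pcontinuous gam (fun w => w * invmx (w%:M - toC (- T)) i j).
  exact: ccontinuousM (pcontinuous_id gamC) (resc i j).
rewrite (path_integral_laplace mG mh G0 cw ih).
have ik k : cintegrable half (fun u => (h u * Q (G u) k j)%:C).
  by split; [exact: semigroup_laplace_integrable|exact: integrable0].
have ick k : cintegrable half
    (fun u => (twopii * ((- T) i k)%:C) * (h u * Q (G u) k j)%:C).
  exact: cintegrableZ (measurable_itv _) (ik k).
have [_ E] := cintegral_sum (index_enum 'I_n) (measurable_itv _) ick.
transitivity (cintegral half (fun u =>
    \sum_k (twopii * ((- T) i k)%:C) * (h u * Q (G u) k j)%:C)).
  apply: eq_cintegral => u /set_mem /=; rewrite in_itv/= andbT => u0.
  transitivity ((h u)%:C * (toC (- T) *m contour_semigroup gam (toC (- T)) (G u)) i j).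
    congr (_ * _); rewrite -(contour_semigroup_mul gamC gam01 gamA).
    by apply: eq_path_integral => w _; rewrite mulrCA mulrA.
  rewrite mxE mulr_sumr; apply: eq_bigr => k _.
  by rewrite QE ?G0// !mxE !rmorphM; ring.
rewrite E rmorph_sum mulr_sumr; apply: eq_bigr => k _.
rewrite (cintegralZ _ (measurable_itv _) (ik k)) -mulrA rmorphM.
by congr (_ * (_ * _)); rewrite /cintegral /= /Rintegral integral0.
Qed.

End MatrixLaplace.
End ContourLaplace.

Lemma unitmx_eigenvalue0 (F : fieldType) n (A : 'M[F]_n) :
  ~~ eigenvalue A 0 -> A \in unitmx.
Proof.
rewrite /eigenvalue /eigenspace raddf0 subr0 negbK => /eqP k0.
by rewrite -row_free_unit -kermx_eq0 k0.
Qed.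

(** * The two matrix functions of the formula as real integrals of Q *)

Section ExponentialTimeChange.
Context {R : realType}.
Local Notation mu := (@lebesgue_measure R).
Local Notation half := (`[(0 : R), +oo[%classic).

(** Up to the factor 1 / a, this is the density of an exponential law. *)
Lemma expR_integrable (a : R) : 0 < a ->
  mu.-integrable half (EFin \o (fun s => expR (- (a * s)))).
Proof.
move=> a0.
have h : mu.-integrable half (EFin \o exponential_pdf a).
  apply: integrableS (integrable_exponential_pdf a0) => //; exact: measurable_itv.
have := integrableZl_real a^-1 (measurable_itv _) h.
apply: eq_integrable => [|s]; first exact: measurable_itv.
move=> /set_mem /=; rewrite in_itv/= andbT => s0.
by rewrite exponential_pdfE//= mulrA mulVf ?gt_eqF// mul1r mulNr.
Qed.

Lemma measurable_expRN (D : set R) (f : R -> R) (a : R) : measurable_fun D f ->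
  measurable_fun D (fun u => expR (- (a * f u))).
Proof.
move=> mf; apply: measurableT_comp => //; apply: measurableT_comp => //.
exact: measurable_funM.
Qed.

Variables g ginv : R -> R.
Hypothesis tc : time_change g ginv.

Lemma measurable_derive1_half : measurable_fun half (derive1 g).
Proof.
by apply/measurable_fun_itv_obnd_cbndP; exact: measurable_derive1_time_change tc.
Qed.

(** The absolute value accounts for u = 0, where the sign of [derive1 g] is unknown. *)
Lemma time_change_integrable (F : R -> R) : measurable_fun half F ->
  (forall s, 0 <= s -> 0 <= F s) -> mu.-integrable half (EFin \o F) ->
  mu.-integrable half (EFin \o (fun u => F (g u) * `|derive1 g u|)).
Proof.
move=> mF F0 iF.
have mFg : measurable_fun half (fun u => F (g u)).
  apply: (measurable_comp (F := half) _ _ mF (measurable_time_change tc)).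
    exact: measurable_itv.
  by move=> _ [u /= + <-]; rewrite !in_itv/= !andbT => /(tc_ge0 tc).
have mint : measurable_fun half (fun u => F (g u) * `|derive1 g u|).
  apply: measurable_funM mFg _.
  by apply: measurableT_comp => //; exact: measurable_derive1_half.
apply/integrableP; split; first exact/measurable_EFinP.
have /integrableP[_] := iF.
rewrite (_ : \int[mu]_(x in half) `|(EFin \o F) x| = \int[mu]_(x in half) (F x)%:E)%E; last first.
  apply: eq_integral => s /set_mem /=; rewrite in_itv/= andbT => s0.
  by rewrite ger0_norm// F0.
rewrite -(time_change_substitution tc mF F0); apply: le_lt_trans.
rewrite -integral_itv_obnd_cbnd; last first.
  apply: measurableT_comp => //; apply/measurable_EFinP.
  by apply/measurable_fun_itv_obnd_cbndP.
rewrite -[leRHS]integral_itv_obnd_cbnd; last first.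
  apply/measurable_EFinP/measurable_fun_itv_obnd_cbndP.
  exact: measurable_funM mFg measurable_derive1_half.
rewrite le_eqVlt; apply/orP; left; apply/eqP; apply: eq_integral => u /set_mem /=.
rewrite in_itv/= andbT => u0; have d0 := derive1_time_change_ge0 tc u0.
by rewrite (ger0_norm d0) ger0_norm// mulr_ge0// F0// (tc_ge0 tc)// ltW.
Qed.

End ExponentialTimeChange.

Section RightHandSide.
Context {R : realType}.
Local Notation mu := (@lebesgue_measure R).
Local Notation half := (`[(0 : R), +oo[%classic).
Local Notation twopii := (2 * (@pi R)%:C * imag_unit).
Local Notation toC := (map_mx (real_complex R)).
Variables (gam : R -> R[i]) (n : nat) (T : 'M[R]_n) (Q : R -> 'M[R]_n).
Variables (g ginv : R -> R) (r : R).
Hypotheses (gam_adm : admissible_path right_half_plane (toC (- T)) gam)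
  (Q0 : Q 0 = 1%:M)
  (QD : forall s t, 0 <= s -> 0 <= t -> Q (s + t) = Q s *m Q t)
  (Qge0 : forall t i j, 0 <= t -> 0 <= Q t i j)
  (Qle1 : forall t i j, 0 <= t -> `|Q t i j| <= 1)
  (Qder : forall i j, (fun h => h^-1 * (Q h i j - (i == j)%:R)) @ 0^'+ --> T i j)
  (tc : time_change g ginv) (r0 : 0 < r).

Let gamC : piecewise_C1 gam. Proof. by case: gam_adm => -[]. Qed.
Let gam01 : gam 0 = gam 1. Proof. by case: gam_adm => -[]. Qed.
Let gam_rhp z : on_path gam z -> 0 < Re z.
Proof. by case: gam_adm => _ h _ _ /h. Qed.
Let gamA z : eigenvalue (toC (- T)) z -> off_path gam z /\ winding gam z = 1.
Proof. by case: gam_adm => _ _ _; apply. Qed.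

(** An eigenvalue 0 would be enclosed by the path, hence would lie in the open right half-plane. *)
Lemma admissible_unitmx : toC (- T) \in unitmx.
Proof.
apply: unitmx_eigenvalue0; apply/negP => e0; have [off w1] := gamA e0.
case: gam_adm => _ _ h _; have := h 0 off; rewrite w1 oner_neq0 => /(_ isT).
by rewrite /right_half_plane /= ltxx.
Qed.

(** For Q the transient block: the expected discounted time that X spends in j when started in i. *)
Definition discounted_occupation i j : R :=
  Rintegral mu half (fun s => expR (- r * s) * Q (ginv s) i j).

(** The stay in j on the clock of the Markov process. Multiplied by the intensity of a transition
    out of j, it is the expected discounted number of such transitions. *)
Definition discounted_exit i j : R :=
  Rintegral mu half (fun u => expR (- r * g u) * Q u i j).

Let mg := measurable_time_change tc.
Let mgi := measurable_time_change (time_change_sym tc).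
Let mid : measurable_fun half (id : R -> R). Proof. exact: measurable_id. Qed.

Let mQ i j : measurable_fun half (fun t => Q t i j).
Proof. by apply: (semigroup_measurable gamC gam_rhp gam01 gamA Q0 QD Qle1 Qder). Qed.

Let mQginv i j : measurable_fun half (fun s => Q (ginv s) i j).
Proof.
apply: (measurable_comp (F := half) _ _ (mQ i j) mgi); first exact: measurable_itv.
by move=> _ [u /= + <-]; rewrite !in_itv/= !andbT => /(tc_inv_ge0 tc).
Qed.

Let expRE (a x : R) : expR (- a * x) = expR (- (a * x)). Proof. by rewrite mulNr. Qed.

Let mexp (f : R -> R) : measurable_fun half f ->
  measurable_fun half (fun u => expR (- r * f u)).
Proof.
move=> /(measurable_expRN r); apply: eq_measurable_fun => u _.
by rewrite expRE.
Qed.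

Lemma occupation_integrable i j :
  mu.-integrable half (EFin \o (fun s => expR (- r * s) * Q (ginv s) i j)).
Proof.
apply: le_integrable (expR_integrable r0); first exact: measurable_itv.
  by apply/measurable_EFinP; apply: measurable_funM (mQginv i j); exact: mexp.
move=> s; rewrite /= in_itv/= andbT => s0; rewrite lee_fin normrM expRE.
by rewrite ler_piMr// Qle1// (tc_inv_ge0 tc).
Qed.

(** The contour integral leaves r e^(-r g(u)) g'(u) Q(u) to be integrated, and s = g(u) removes the
    derivative. *)
Lemma mxfun_laplace_h1 i j :
  mxfun gam (fun s => laplace (h1 r g) s) (toC (- T)) i j
  = (r * discounted_occupation i j)%:C.
Proof.
pose h u := r * expR (- r * g u) * derive1 g u.
have mh : measurable_fun half h.
  apply: measurable_funM (measurable_derive1_half tc); apply: measurable_funM => //.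
  exact: mexp.
have ih e : 0 < e -> mu.-integrable half (EFin \o (fun u => expR (- (e * u)) * `|h u|)).
  (* As e^(-eu) <= 1, it is enough to integrate e^(-r g(u)) |g'(u)|, the image of e^(-rs) under the
     substitution. *)
  move=> e0; have := time_change_integrable tc
    (measurable_expRN r mid) (fun s _ => expR_ge0 _) (expR_integrable r0).
  move/(integrableZl_real r (measurable_itv _)); apply: le_integrable.
  - exact: measurable_itv.
  - apply/measurable_EFinP; apply: measurable_funM; first exact: measurable_expRN.
    exact: measurableT_comp.
  - move=> u; rewrite /= in_itv/= andbT => u0; rewrite lee_fin.
    rewrite ger0_norm ?mulr_ge0 ?expR_ge0// (le_trans _ (ler_norm _))//.
    rewrite /h !normrM (ger0_norm (expR_ge0 _)) (ger0_norm (ltW r0)) expRE -mulrA.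
    by rewrite ler_piMl ?mulr_ge0 ?expR_ge0 ?(ltW r0)// -[leRHS]expR0 ler_expR
      oppr_le0 mulr_ge0// ltW.
rewrite mxE (eq_path_integral (h := fun w => invmx (w%:M - toC (- T)) i j *
    cintegral half (fun u => cexp (- w * u%:C) * (h u)%:C))); last first.
  by move=> w _; rewrite mulrC.
rewrite (path_integral_resolvent_laplace gamC gam_rhp gam01 gamA Q0 QD Qle1 Qder
  mid mh (fun u u0 => u0) ih) mulKf ?twopii_neq0//; congr (_ %:C).
pose F s := r * (expR (- r * s) * Q (ginv s) i j).
have mF : measurable_fun half F.
  apply: measurable_funM => //; apply: measurable_funM (mQginv i j).
  exact: mexp.
have F0 s : 0 <= s -> 0 <= F s.
  by move=> s0; rewrite !mulr_ge0 ?expR_ge0 ?(ltW r0) ?Qge0 ?(tc_inv_ge0 tc).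
transitivity (Rintegral mu half (fun u => F (g u) * derive1 g u)).
  apply: eq_Rintegral => u /set_mem /=; rewrite in_itv/= andbT => u0.
  by rewrite /F /h (tc_invK tc u0); ring.
transitivity (Rintegral mu half F).
  by rewrite /Rintegral (time_change_substitution tc mF F0).
by rewrite RintegralZl; [|exact: measurable_itv|exact: occupation_integrable].
Qed.

(** Here the substitution is v = ginv(u). The factor -T produced by w is left standing, for the
    inverse in the formula to cancel. *)
Lemma mxfun_laplace_h2 i j :
  mxfun gam (fun w => laplace (h2 w ginv) r%:C) (toC (- T)) i j
  = (toC (- T) *m \matrix_(i, j) (discounted_exit i j)%:C) i j.
Proof.
have tci := time_change_sym tc.
pose h u := expR (- r * u) * derive1 ginv u.
have mh : measurable_fun half h.
  by apply: measurable_funM (measurable_derive1_half tci); exact: mexp.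
have ih e : 0 < e ->
    mu.-integrable half (EFin \o (fun u => expR (- (e * ginv u)) * `|h u|)).
  move=> e0; have := time_change_integrable tci
    (measurable_expRN e mid) (fun s _ => expR_ge0 _) (expR_integrable e0).
  apply: le_integrable.
  - exact: measurable_itv.
  - apply/measurable_EFinP; apply: measurable_funM; first exact: measurable_expRN.
    exact: measurableT_comp.
  - move=> u; rewrite /= in_itv/= andbT => u0; rewrite lee_fin.
    rewrite ger0_norm ?mulr_ge0 ?expR_ge0// (le_trans _ (ler_norm _))//.
    rewrite ler_wpM2l ?expR_ge0// /h normrM (ger0_norm (expR_ge0 _)) expRE.
    by rewrite ler_piMl// -[leRHS]expR0 ler_expR oppr_le0 mulr_ge0// ltW.
rewrite mxE (eq_path_integral (h := fun w => w * invmx (w%:M - toC (- T)) i j *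
    cintegral half (fun u => cexp (- w * (ginv u)%:C) * (h u)%:C))); last first.
  (* The factor w inside [h2] does not depend on u, so it leaves the Laplace integral and joins the
     resolvent. *)
  move=> w wg; rewrite [RHS]mulrAC; congr (_ * _).
  have L := laplace_integrable mgi mh (tc_inv_ge0 tc) ih (gam_rhp wg).
  rewrite -(cintegralZ w (measurable_itv _) L).
  apply: eq_cintegral => u _; rewrite /h2 /h rmorphM.
  suff -> : cexp (- r%:C * u%:C) = (expR (- r * u))%:C :> R[i] by ring.
  rewrite -rmorphN -rmorphM; apply: complexP.
    by rewrite Re_cexp /= cos0 mulr1.
  by rewrite Im_cexp /= sin0 mulr0.
rewrite (path_integral_mul_resolvent_laplace gamC gam_rhp gam01 gamA Q0 QD Qle1 Qder
  mgi mh (tc_inv_ge0 tc) ih) mulKf ?twopii_neq0//.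
rewrite rmorph_sum [RHS]mxE; apply: eq_bigr => k _.
rewrite rmorphM !mxE; congr (_ * _%:C).
pose F v := expR (- r * g v) * Q v k j.
have mF : measurable_fun half F.
  by apply: measurable_funM (mQ k j); exact: mexp.
have F0 s : 0 <= s -> 0 <= F s.
  by move=> s0; rewrite !mulr_ge0 ?expR_ge0 ?Qge0.
transitivity (Rintegral mu half (fun u => F (ginv u) * derive1 ginv u)).
  apply: eq_Rintegral => u /set_mem /=; rewrite in_itv/= andbT => u0.
  by rewrite /F /h (tc_K tc u0); ring.
by rewrite /Rintegral (time_change_substitution tci mF F0).
Qed.

End RightHandSide.

(** * Jumps of right-continuous paths with left limits *)

Section CadlagPath.
Context {R : realType} {S : eqType}.
Variable z : R -> S.
Hypothesis z_right : forall t, 0 <= t -> \forall s \near t^'+, z s = z t.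
Hypothesis z_left : forall t, 0 < t -> exists i, \forall s \near t^'-, z s = i.

(** A positive time of no change satisfies this with i = j, so genuine jumps are singled out by i <>
    j. *)
Definition path_jump (i j : S) : set R :=
  [set v | [/\ 0 < v, \forall u \near v^'-, z u = i & z v = j]].

Lemma at_left_ex (Q : R -> Prop) (t : R) : (\forall h \near t^'-, Q h) ->
  exists2 d : R, 0 < d & forall h, t - d < h < t -> Q h.
Proof.
move=> [d /= d0 hd]; exists d => // h /andP[h0 hd']; apply: hd => //=.
by rewrite gtr0_norm ?subr_gt0//; lra.
Qed.

Lemma at_right_ex (Q : R -> Prop) (t : R) : (\forall h \near t^'+, Q h) ->
  exists2 d : R, 0 < d & forall h, t < h < t + d -> Q h.
Proof.
move=> [d /= d0 hd]; exists d => // h /andP[h0 hd']; apply: hd => //=.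
by rewrite distrC gtr0_norm ?subr_gt0//; lra.
Qed.

Lemma path_jump_left i j k v d : path_jump i j v -> 0 < d ->
  (forall u, v - d < u < v -> z u = k) -> i = k.
Proof.
move=> [v0 /at_left_ex[e e0 he] _] d0 hd.
pose m := Num.min d e; have m0 : 0 < m by rewrite lt_min d0.
have [md me] : m <= d /\ m <= e by rewrite !ge_min !lexx orbT.
by rewrite -(he (v - m / 2)) ?(hd (v - m / 2))//; lra.
Qed.

Lemma path_jump_fun i j i' j' v : path_jump i j v -> path_jump i' j' v ->
  i = i' /\ j = j'.
Proof.
move=> J [_ /at_left_ex[e e0 he] <-]; have [_ _ ->] := J; split=> //.
exact: path_jump_left J e0 he.
Qed.

(* On ]x, x + d] the path makes at most one jump, which is visible at the
   endpoints. *)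
Definition single_jump (d x : R) :=
  (z x = z (x + d) /\ forall v i j, x < v <= x + d -> path_jump i j v -> i = j) \/
  (exists2 v, x < v <= x + d & [/\ path_jump (z x) (z (x + d)) v,
     z x <> z (x + d) &
     forall v' i j, x < v' <= x + d -> path_jump i j v' -> i <> j -> v' = v]).

(** Near t the path is constant before t, and constant from t on, so t is the only candidate for a
    jump. What remains is the position of t with respect to ]x, x + d]. *)
Lemma local_single_jump (t : R) : 0 <= t ->
  \forall x \near t & d \near (0 : R)^'+, 0 <= x -> single_jump d x.
Proof.
move=> t0; have [d1 d10 hr] := at_right_ex (z_right t0).
have hr' s : t <= s < t + d1 -> z s = z t.
  by move=> /andP[]; rewrite le_eqVlt => /predU1P[->//|ts sd]; rewrite hr// ts.
have [d2 [d20 hl]] : exists d2, 0 < d2 /\ (0 < t -> exists i, forall s, t - d2 < s < t -> z s = i).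
  (* The value 1 is a default for t = 0, where there is no left side: then x >= 0 means t <= x. *)
  have [tp|tn] := ltP 0 t; last by exists 1; split.
  by have [i /at_left_ex[d2 d20 hi]] := z_left tp; exists d2; split=> // _; exists i.
pose rho := Num.min d1 d2; have rho0 : 0 < rho by rewrite lt_min d10.
have [rho1 rho2] : rho <= d1 /\ rho <= d2 by rewrite !ge_min !lexx orbT.
(* Half of [rho] keeps both x and x + d within [rho] of t. *)
have rho40 : 0 < rho / 2 by lra.
have nt : \forall x \near t, `|t - x| < rho / 2 by exists (rho / 2).
have nd : \forall d \near (0 : R)^'+, 0 < d < rho / 2.
  near=> d; apply/andP; split; first by near: d; exact: nbhs_right_gt.
  by near: d; exact: nbhs_right_lt.
exists ([set x | `|t - x| < rho / 2], [set d | 0 < d < rho / 2]) => //= -[x d] /=.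
rewrite ltr_norml => -[/andP[tx1 tx2] /andP[d0 d4]] x0.
have [tx|xt] := leP t x.
  left; split=> [|v i j /andP[xv vx] J].
    by rewrite !hr' //; lra.
  have [_ _ <-] := J; rewrite (hr' v); last lra.
  by apply: (path_jump_left (d := v - t) J) => [|u hu]; rewrite ?hr'//; lra.
have [|i0 hi0] := hl; first by lra.
have [xdt|txd] := ltP (x + d) t.
  left; split=> [|v i j /andP[xv vx] J].
    by rewrite !hi0 //; lra.
  have [_ _ <-] := J; rewrite (hi0 v); last lra.
  by apply: (path_jump_left (d := v - x) J) => [|u hu]; rewrite ?hi0//; lra.
have zx : z x = i0 by rewrite hi0//; lra.
have zxd : z (x + d) = z t by rewrite hr'//; lra.
have other v i j : x < v <= x + d -> path_jump i j v -> v != t -> i = j.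
  move=> /andP[xv vx] J; rewrite neq_lt => /orP[vt|tv].
    have [_ _ <-] := J; rewrite (hi0 v); last lra.
    by apply: (path_jump_left (d := v - x) J) => [|u hu]; rewrite ?hi0//; lra.
  have [_ _ <-] := J; rewrite (hr' v); last lra.
  by apply: (path_jump_left (d := v - t) J) => [|u hu]; rewrite ?hr'//; lra.
have tleft i j : path_jump i j t -> i = i0.
  by move=> J; apply: (path_jump_left (d := t - x) J) => [|u hu]; rewrite ?hi0//; lra.
(* If the left limit at t is [z t], there is no genuine jump at t either. *)
have [i0t|i0t] := eqVneq i0 (z t).
  left; split; first by rewrite zx zxd.
  move=> v i j hv J; have [vt|vt] := eqVneq v t; last exact: other hv J vt.
  by move: J; rewrite vt => J; rewrite (tleft _ _ J) i0t; case: J.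
right; exists t; first lra.
rewrite zx zxd; split; last 2 first.
- exact/eqP.
- move=> v i j hv J ij; apply/eqP; apply/negPn/negP => vt.
  exact/ij/(other _ _ _ hv J).
split=> //; first lra.
near=> u; apply: hi0; apply/andP; split; last by near: u; exact: nbhs_left_lt.
by near: u; apply: nbhs_left_gt; lra.
Unshelve. all: end_near. Qed.

(** Compactness of [0, K], in its near-covering form, makes the threshold on d uniform in x. *)
Lemma uniform_single_jump (K : R) :
  exists2 d0 : R, 0 < d0 & forall d x, 0 < d < d0 -> 0 <= x <= K -> single_jump d x.
Proof.
have := @segment_compact R 0 K; rewrite compact_near_coveringP => cov.
have [d0 d00 hd] : exists2 d0 : R, 0 < d0 & forall d, 0 < d < d0 ->
    forall x, `[0, K]%classic x -> 0 <= x -> single_jump d x.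
  apply: at_right0_ex; apply: (cov R 0^'+ (fun d x => 0 <= x -> single_jump d x)).
  by move=> t; rewrite /= in_itv/= => /andP[t0 _]; exact: local_single_jump.
exists d0 => // d x hd0 /andP[x0 xK]; apply: hd => //=; by rewrite in_itv/= x0.
Qed.

Lemma single_jump_change d x : single_jump d x -> z x <> z (x + d) ->
  exists2 v, x < v <= x + d & path_jump (z x) (z (x + d)) v.
Proof. by move=> [[->]//|[v hv [J _ _]] _]; exists v. Qed.

Lemma single_jump_endpoints d x v i j : single_jump d x -> x < v <= x + d ->
  path_jump i j v -> i <> j -> z x = i /\ z (x + d) = j.
Proof.
move=> [[_ h] hv J ij|[v0 hv0 [J0 _ h]] hv J ij]; first by case: ij; exact: h J.
by have vv := h v i j hv J ij; move: J; rewrite vv => J; exact: path_jump_fun J0 J.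
Qed.

Lemma single_jump_uniq d x v i j v' i' j' : single_jump d x ->
  x < v <= x + d -> path_jump i j v -> i <> j ->
  x < v' <= x + d -> path_jump i' j' v' -> i' <> j' -> v = v'.
Proof.
move=> [[_ h] hv J ij|[v0 hv0 [J0 _ h]] hv J ij hv' J' ij'].
  by case: ij; exact: h J.
by rewrite (h v i j)// (h v' i' j').
Qed.

(** By contraposition: without a genuine jump in ]a, b], the path agrees at consecutive points of a
    fine subdivision, hence at a and b. *)
Lemma change_path_jump (a b : R) : 0 <= a -> a < b -> z a <> z b ->
  exists v i j, [/\ a < v <= b, path_jump i j v & i <> j].
Proof.
move=> a0 ab; apply: contra_notP => nj.
have [d0 d00 hd] := uniform_single_jump b.
(* The added 1 makes the step strictly smaller than [d0]. *)
have [N hN] := exists_nat_gt ((b - a) / d0 + 1).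
pose d := (b - a) / N.+1%:R.
have Np : 0 < N.+1%:R :> R by [].
have d_gt0 : 0 < d by rewrite divr_gt0// subr_gt0.
have dd0 : d < d0.
  rewrite ltr_pdivrMr// mulrC -ltr_pdivrMr//; lra.
have dN : N.+1%:R * d = b - a by rewrite mulrC divfK// gt_eqF.
suff H k : (k <= N.+1)%N -> z a = z (a + k%:R * d).
  by rewrite (H N.+1)// dN subrKC.
elim: k => [|k ih] kN; first by rewrite mul0r addr0.
have kb : a + k%:R * d + d <= b.
  have : k.+1%:R * d <= N.+1%:R * d by rewrite ler_wpM2r ?ler_nat// ltW.
  by rewrite dN -natr1 mulrDl mul1r; lra.
have ak : a <= a + k%:R * d by rewrite lerDl mulr_ge0// ltW.
have kS : a + k.+1%:R * d = a + k%:R * d + d by rewrite -natr1 mulrDl mul1r addrA.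
rewrite ih ?(ltnW kN)// kS; apply: contrapT => ne.
have G : single_jump d (a + k%:R * d) by apply: hd; lra.
have [v hv J] := single_jump_change G ne.
by apply: nj; exists v, (z (a + k%:R * d)), (z (a + k%:R * d + d)); split=> //; lra.
Qed.

End CadlagPath.

(** * Sums over the jumps of a path as limits of grid sums *)

Section GridSum.
Context {R : realType} {S : finType}.
Variable z : R -> S.
Hypothesis z_right : forall t, 0 <= t -> \forall s \near t^'+, z s = z t.
Hypothesis z_left : forall t, 0 < t -> exists i, \forall s \near t^'-, z s = i.
Variables (phi : R -> R) (K : nat).
Hypothesis phi_ge0 : forall u, 0 <= phi u.
Hypothesis phi_le1 : forall u, 0 <= u -> phi u <= 1.
Hypothesis phi_nincr : forall u v, 0 <= u -> u <= v -> phi v <= phi u.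
Hypothesis phi_right : forall u e, 0 <= u -> 0 < e ->
  exists2 d : R, 0 < d & forall v, u <= v < u + d -> phi u - e <= phi v.

Definition mesh (n : nat) : R := n.+1%:R^-1.

Lemma mesh_gt0 n : 0 < mesh n. Proof. by rewrite invr_gt0. Qed.

Lemma mesh_le1 n : mesh n <= 1. Proof. by rewrite invf_le1// ler1n. Qed.

Lemma meshK n : (K * n.+1)%:R * mesh n = K%:R :> R.
Proof. by rewrite natrM mulfK. Qed.

Lemma mesh_small (d : R) : 0 < d -> \forall n \near \oo, 0 < mesh n < d.
Proof.
move=> d0.
have : \forall n \near \oo, @harmonic R n < d by apply: cvgr_lt d0; exact: cvg_harmonic.
by apply: filterS => n; rewrite mesh_gt0.
Qed.

Lemma mesh_index n (v : R) : 0 < v <= K%:R ->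
  exists m : 'I_(K * n.+1), m%:R * mesh n < v <= m.+1%:R * mesh n.
Proof.
move=> /andP[v0 vK]; pose x := v / mesh n.
have x0 : 0 < x by rewrite divr_gt0// mesh_gt0.
have [m /andP[m1 m2]] : exists m : nat, m%:R < x <= m.+1%:R.
  have /andP[t1 t2] := truncn_itv (ltW x0).
  move: t1; rewrite le_eqVlt => /predU1P[tx|tx]; last by exists (Num.truncn x); rewrite tx ltW.
  (* Cells are open on the left, so a grid point belongs to the cell on its left and takes the
     previous index. *)
  case: (Num.truncn x) tx {t2} => [x0'|m <-]; first by move: x0; rewrite -x0' ltxx.
  by exists m; rewrite lexx andbT ltr_nat.
have mN : (m < K * n.+1)%N.
  rewrite -(ltr_nat R) (lt_le_trans m1)// ler_pdivrMr ?mesh_gt0//.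
  by rewrite meshK.
by exists (Ordinal mN); rewrite /= -ltr_pdivlMr ?mesh_gt0// -ler_pdivrMr ?mesh_gt0// m1.
Qed.

Definition grid_sum n (i j : S) : R := \sum_(m < K * n.+1)
  phi (m.+1%:R * mesh n) *
    ((z (m%:R * mesh n) == i) && (z (m.+1%:R * mesh n) == j))%:R.

Definition jump_sum (i j : S) : \bar R :=
  \esum_(v in path_jump z i j `&` [set v | v <= K%:R]) (phi v)%:E.

Lemma mesh_succ m n : m.+1%:R * mesh n = m%:R * mesh n + mesh n.
Proof. by rewrite -natr1 mulrDl mul1r. Qed.

Lemma mesh_pt_ge0 m n : 0 <= m%:R * mesh n.
Proof. by rewrite mulr_ge0// ltW// mesh_gt0. Qed.

Lemma mesh_pt_le m n : (m <= K * n.+1)%N -> m%:R * mesh n <= K%:R.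
Proof. by move=> mN; rewrite -(meshK n) ler_wpM2r ?ler_nat// ltW// mesh_gt0. Qed.

Lemma mesh_interval_uniq (m m' : nat) n (v : R) :
  m%:R * mesh n < v <= m.+1%:R * mesh n ->
  m'%:R * mesh n < v <= m'.+1%:R * mesh n -> m = m'.
Proof.
have le k l : k%:R * mesh n < l.+1%:R * mesh n -> (k <= l)%N.
  by rewrite ltr_pM2r ?mesh_gt0// ltr_nat ltnS.
move=> /andP[a b] /andP[c d]; apply/eqP.
by rewrite eqn_leq !le// ?(lt_le_trans a d) ?(lt_le_trans c b).
Qed.

Lemma sum_le_inj (I : finType) (X : seq R) (F : R -> I) (A : pred I) (f : R -> R) (c : I -> R) :
  uniq X -> {in X &, injective F} -> (forall m, A m -> 0 <= c m) ->
  (forall v, v \in X -> A (F v) /\ f v <= c (F v)) ->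
  \sum_(v <- X) f v <= \sum_(m | A m) c m.
Proof.
move=> uX Finj c0 hX.
apply: (@le_trans _ _ (\sum_(v <- X) c (F v))).
  by rewrite big_seq [leRHS]big_seq; apply: ler_sum => v /hX[].
rewrite -(big_map F xpredT c) big_uniq ?map_inj_in_uniq//=.
rewrite [leRHS](bigID (fun m => m \in [seq F v | v <- X]))/=.
rewrite -[leLHS]addr0; apply: lerD; last by apply: sumr_ge0 => m /andP[/c0].
rewrite le_eqVlt; apply/orP; left; apply/eqP; apply: eq_bigl => m.
apply/idP/andP => [mX|[]//]; split=> //.
by case/mapP: mX => v /hX[Av _] ->.
Qed.

Lemma sum_le_esum (I : finType) (A : pred I) (F : I -> R) (J : set R) (c : I -> R) :
  {in A &, injective F} ->
  (forall m, A m -> J (F m) /\ c m <= phi (F m)) ->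
  ((\sum_(m | A m) c m)%:E <= \esum_(v in J) (phi v)%:E)%E.
Proof.
move=> Finj hA; pose X := [seq F m | m <- enum A].
have uX : uniq X.
  by rewrite map_inj_in_uniq ?enum_uniq// => a b; rewrite !mem_enum; exact: Finj.
apply: esum_ge; exists [set` X].
  split; first exact: finite_seq.
  by move=> v /= /mapP[m]; rewrite mem_enum => /hA[Jm _] ->.
rewrite -fsbig_seq//= big_map big_enum/= sumEFin lee_fin.
by apply: ler_sum => m /hA[].
Qed.

Lemma esum_le_bound (J : set R) (c : R) :
  (forall X : seq R, uniq X -> {in X, forall v, J v} -> \sum_(v <- X) phi v <= c) ->
  (\esum_(v in J) (phi v)%:E <= c%:E)%E.
Proof.
move=> hX; apply: ge_ereal_sup => _ [X [finX XJ] <-].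
rewrite fsbig_finite//= sumEFin lee_fin; apply: hX; first exact: finmap.fset_uniq.
by move=> v; rewrite in_fset_set// => /set_mem/XJ.
Qed.

(** Valid for every n: a counted cell has distinct end values, so it contains a genuine jump,
    perhaps between other states. The cells are sorted by the pair of states of the jump chosen in
    each, and disjoint cells give distinct jump times. *)
Lemma grid_sum_le_total n i j : i != j ->
  ((grid_sum n i j)%:E <= \sum_(kl : S * S | kl.1 != kl.2) jump_sum kl.1 kl.2)%E.
Proof.
move=> ij.
pose A (m : 'I_(K * n.+1)) := (z (m%:R * mesh n) == i) && (z (m.+1%:R * mesh n) == j).
have hv m : exists vkl : R * (S * S), A m ->
   [/\ m%:R * mesh n < vkl.1 <= m.+1%:R * mesh n, path_jump z vkl.2.1 vkl.2.2 vkl.1 &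
     vkl.2.1 != vkl.2.2].
  have [Am|_] := boolP (A m); last by exists (0, (i, j)).
  have ab : m%:R * mesh n < m.+1%:R * mesh n by rewrite mesh_succ ltrDl mesh_gt0.
  have zab : z (m%:R * mesh n) <> z (m.+1%:R * mesh n).
    by case/andP: Am => /eqP -> /eqP ->; apply/eqP.
  have [v [k [l [hv J kl]]]] := change_path_jump z_right z_left (mesh_pt_ge0 m n) ab zab.
  by exists (v, (k, l)) => _; split=> //; apply/eqP.
have {hv} [F hF] := choice hv.
have -> : grid_sum n i j = \sum_(m | A m) phi (m.+1%:R * mesh n).
  rewrite big_mkcond; apply: eq_bigr => m _; rewrite -/(A m).
  by case: (A m); rewrite ?mulr1 ?mulr0.
rewrite (partition_big (fun m => (F m).2) (fun kl => kl.1 != kl.2)) /=; last first.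
  by move=> m /hF[].
rewrite -sumEFin; apply: lee_sum => -[k l] /= kl.
apply: (@sum_le_esum _ _ (fun m => (F m).1)) => [m m'|m /andP[Am /eqP Fm]].
  rewrite !unfold_in => /andP[Am _] /andP[Am' _] e; apply: val_inj => /=.
  have [h _ _] := hF _ Am; have [h' _ _] := hF _ Am'; rewrite e in h.
  exact: mesh_interval_uniq h h'.
have [/andP[h1 h2] J _] := hF _ Am; rewrite Fm in J.
split.
  by split=> //=; apply: le_trans h2 _; exact: mesh_pt_le.
by apply: phi_nincr => //; rewrite (le_trans _ (ltW h1))// mesh_pt_ge0.
Qed.

Lemma fine_mesh : \forall n \near \oo,
  forall x, 0 <= x <= K%:R -> single_jump z (mesh n) x.
Proof.
have [d0 d00 hd] := uniform_single_jump z_right z_left K%:R.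
by have := mesh_small d00; apply: filterS => n hn x hx; exact: hd.
Qed.

(** Once the mesh resolves the path, a cell holds at most one genuine jump, so a cell counted for i
    and j contains a jump from i to j. *)
Lemma grid_sum_le_jump_sum : \forall n \near \oo, forall i j, i != j ->
  ((grid_sum n i j)%:E <= jump_sum i j)%E.
Proof.
have := fine_mesh; apply: filterS => n hn i j ij.
pose A (m : 'I_(K * n.+1)) := (z (m%:R * mesh n) == i) && (z (m.+1%:R * mesh n) == j).
have hv m : exists v, A m ->
    m%:R * mesh n < v <= m.+1%:R * mesh n /\ path_jump z i j v.
  have [Am|_] := boolP (A m); last by exists 0.
  have G : single_jump z (mesh n) (m%:R * mesh n).
    by apply: hn; rewrite mesh_pt_ge0 mesh_pt_le// ltnW.
  case/andP: Am => /eqP zi /eqP zj.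
  have [|v hv J] := single_jump_change G.
    by rewrite -mesh_succ zi zj; exact/eqP.
  by exists v; rewrite mesh_succ; rewrite -mesh_succ zi zj in J.
have {hv} [F hF] := choice hv.
have -> : grid_sum n i j = \sum_(m | A m) phi (m.+1%:R * mesh n).
  rewrite big_mkcond; apply: eq_bigr => m _; rewrite -/(A m).
  by case: (A m); rewrite ?mulr1 ?mulr0.
apply: (@sum_le_esum _ _ F) => [m m' Am Am' e|m Am].
  apply: val_inj => /=; have [h _] := hF _ Am; have [h' _] := hF _ Am'.
  by rewrite e in h; exact: mesh_interval_uniq h h'.
have [/andP[h1 h2] J] := hF _ Am; split.
  by split=> //=; apply: le_trans h2 _; exact: mesh_pt_le.
by apply: phi_nincr => //; rewrite (le_trans _ (ltW h1))// mesh_pt_ge0.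
Qed.

(** The converse bound. Distinct jumps lie in distinct cells, and the right end of a cell is less
    than one mesh after its jump, hence the shift in [phi]. The second bound counts cells and yields
    finiteness. *)
Lemma sum_le_grid_sum : \forall n \near \oo, forall i j, i != j ->
  forall X : seq R, uniq X ->
    {in X, forall v, path_jump z i j v /\ v <= K%:R} ->
    \sum_(v <- X) phi (v + mesh n) <= grid_sum n i j /\
    \sum_(v <- X) phi v <= (K * n.+1)%:R.
Proof.
have := fine_mesh; apply: filterS => n hn i j ij X uX hX.
pose A (m : 'I_(K * n.+1)) := (z (m%:R * mesh n) == i) && (z (m.+1%:R * mesh n) == j).
(* The empty list is set apart, since for K = 0 there is no cell to serve as a default. *)
have [->|[x0 Xx0]] : X = [::] \/ exists x, x \in X.
  by case: X {uX hX} => [|x X]; [left|right; exists x; rewrite mem_head].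
  rewrite !big_nil; split=> //; apply: sumr_ge0 => m _.
  by rewrite mulr_ge0.
have posX v : v \in X -> 0 < v <= K%:R by move=> /hX[[-> _ _] ->].
have [m0 _] := mesh_index n (posX _ Xx0).
have hm v : exists m : 'I_(K * n.+1), v \in X ->
    m%:R * mesh n < v <= m.+1%:R * mesh n.
  have [vX|_] := boolP (v \in X); last by exists m0.
  by have [m hm] := mesh_index n (posX _ vX); exists m.
have {hm} [F hF] := choice hm.
have G (m : 'I_(K * n.+1)) : single_jump z (mesh n) (m%:R * mesh n).
  by apply: hn; rewrite mesh_pt_ge0 mesh_pt_le// ltnW.
have inj : {in X &, injective F}.
  move=> v v' vX v'X e; have h := hF _ vX; have h' := hF _ v'X.
  have [J _] := hX _ vX; have [J' _] := hX _ v'X.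
  rewrite mesh_succ in h; rewrite -e mesh_succ in h'.
  by apply: (single_jump_uniq (G (F v)) h J _ h' J'); exact/eqP.
have FA v : v \in X -> A (F v).
  move=> vX; have h := hF _ vX; rewrite mesh_succ in h.
  have [J _] := hX _ vX.
  have [] := single_jump_endpoints (G (F v)) h J; first exact/eqP.
  by rewrite -mesh_succ /A => -> ->; rewrite !eqxx.
split.
  have -> : grid_sum n i j = \sum_(m | A m) phi (m.+1%:R * mesh n).
    rewrite big_mkcond; apply: eq_bigr => m _; rewrite -/(A m).
    by case: (A m); rewrite ?mulr1 ?mulr0.
  apply: (sum_le_inj uX inj) => // v vX; split; first exact: FA.
  have := hF _ vX; rewrite mesh_succ => /andP[h1 h2].
  by apply: phi_nincr; [rewrite -mesh_succ mesh_pt_ge0|rewrite lerD2r ltW].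
have -> : (K * n.+1)%:R = \sum_(m < K * n.+1) 1 :> R by rewrite sumr_const card_ord.
apply: (sum_le_inj uX inj) => // v vX; split=> //.
by apply: phi_le1; have /andP[/ltW] := posX _ vX.
Qed.

Lemma jump_sum_lty i j : i != j -> (jump_sum i j < +oo)%E.
Proof.
move=> ij; have [n _ /(_ n (leqnn _)) hn] := sum_le_grid_sum.
apply: (@le_lt_trans _ _ ((K * n.+1)%:R%:E)); last exact: ltry.
apply: esum_le_bound => X uX hX.
by have [|] := hn i j ij X uX.
Qed.

Lemma jump_sum_ge0 i j : (0 <= jump_sum i j)%E.
Proof. by apply: esum_ge0 => v _; rewrite lee_fin. Qed.

(** A squeeze: finitely many jumps carry the sum up to e / 2, and right-continuity of [phi] at these
    points makes the shift by one mesh cost at most another e / 2. *)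
Lemma grid_sum_cvg i j : i != j ->
  (grid_sum n i j)%:E @[n --> \oo] --> jump_sum i j.
Proof.
move=> ij; have Sfin : jump_sum i j \is a fin_num.
  by rewrite ge0_fin_numE ?jump_sum_ge0// jump_sum_lty.
rewrite -(fineK Sfin); apply: cvg_EFin; first exact: nearW.
apply/cvgrPdist_le => e e0.
have e20 : 0 < e / 2 by lra.
have [X [uX hX hsum]] : exists X : seq R, [/\ uniq X,
    {in X, forall v, path_jump z i j v /\ v <= K%:R} &
    fine (jump_sum i j) - e / 2 <= \sum_(v <- X) phi v].
  have : ((fine (jump_sum i j) - e / 2)%:E < jump_sum i j)%E.
    by rewrite -{2}(fineK Sfin) lte_fin; lra.
  move=> /ereal_sup_gt[_ [X [finX XJ] <-] hX]; exists (finmap.enum_fset (fset_set X)); split.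
  - exact: finmap.fset_uniq.
  - by move=> v; rewrite in_fset_set// => /set_mem/XJ[].
  - by move: hX; rewrite fsbig_finite//= sumEFin lte_fin => /ltW.
have [d d0 hd] : exists2 d : R, 0 < d & forall h, 0 < h < d ->
    \sum_(v <- X) phi v - e / 2 <= \sum_(v <- X) phi (v + h).
  (* The tolerance is shared among the points of X; the successor avoids a division by 0. *)
  pose e' := e / 2 / (size X).+1%:R.
  have e'0 : 0 < e' by rewrite divr_gt0.
  have [d d0 hd] : exists2 d : R, 0 < d & {in X, forall v h, 0 < h < d -> phi v - e' <= phi (v + h)}.
    elim: (X) hX => [|x Y ih] hY; first by exists 1.
    have [|d d0 hd] := ih; first by move=> v vY; apply: hY; rewrite inE vY orbT.
    have x0 : 0 <= x by have [[/ltW]] := hY x (mem_head _ _).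
    have [d' d'0 hd'] := phi_right x0 e'0.
    exists (Num.min d d'); first by rewrite lt_min d0.
    move=> v; rewrite inE => /predU1P[->|vY] h; rewrite lt_min => /and3P[h0 h1 h2].
      by apply: hd'; lra.
    by apply: hd => //; rewrite h0.
  exists d => // h hh; rewrite lerBlDr.
  apply: (@le_trans _ _ (\sum_(v <- X) (phi (v + h) + e'))).
    rewrite big_seq [leRHS]big_seq; apply: ler_sum => v vX.
    by rewrite -lerBlDr; exact: hd.
  rewrite big_split/= lerD2l big_const_seq count_predT iter_addr_0 /e' -[leLHS]mulr_natr.
  by rewrite mulrAC ler_pdivrMr// ler_wpM2l ?(ltW e20)// ler_nat.
have h1 := mesh_small d0; have h2 := grid_sum_le_jump_sum; have h3 := sum_le_grid_sum.
near=> n.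
have n1 : 0 < mesh n < d by near: n.
have n2 : ((grid_sum n i j)%:E <= jump_sum i j)%E.
  by move: i j ij {Sfin hX hsum}; near: n.
have n3 : \sum_(v <- X) phi (v + mesh n) <= grid_sum n i j.
  have : forall i j, i != j ->  forall X : seq R, uniq X ->
    {in X, forall v, path_jump z i j v /\ v <= K%:R} ->
    \sum_(v <- X) phi (v + mesh n) <= grid_sum n i j /\
    \sum_(v <- X) phi v <= (K * n.+1)%:R by near: n.
  by move=> /(_ _ _ ij _ uX hX)[].
rewrite -(fineK Sfin) lee_fin in n2.
have n4 := hd _ n1; rewrite ler_norml; apply/andP; split=> /=; lra.
Unshelve. all: end_near. Qed.

End GridSum.

(** * Riemann sums with two different evaluation points *)

Section RiemannSum.
Context {R : realType}.
Local Notation mu := (@lebesgue_measure R).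
Local Notation half := (`[(0 : R), +oo[%classic).
Variables (phi q : R -> R) (K : nat) (L : R).
Hypotheses (phi0 : forall u, 0 <= u -> 0 <= phi u <= 1)
  (phi_nincr : forall u v, 0 <= u -> u <= v -> phi v <= phi u)
  (mphi : measurable_fun half phi) (mq : measurable_fun half q)
  (q0 : forall u, 0 <= u -> 0 <= q u <= 1) (L0 : 0 <= L)
  (qL : forall s h, 0 <= s -> 0 <= h <= 1 -> `|q (s + h) - q s| <= L * h).

Let f u := phi u * q u.

Let mf : measurable_fun half f. Proof. exact: measurable_funM. Qed.

Let f_integrable b : mu.-integrable `[0, b] (EFin \o f).
Proof.
have mb : measurable_fun `[0, b] f.
  by apply: measurable_funS mf => //; apply: subset_itvl; rewrite bnd_simp.
apply: measurable_bounded_integrable; [exact: measurable_itv| |exact: mb|].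
- exact: compact_finite_measure (@segment_compact R 0 b).
- exists 1; split; rewrite ?num_real// => M M1 u /=; rewrite in_itv/= => /andP[u0 _].
  have := phi0 u0; have := q0 u0; rewrite /f normrM => /andP[a1 a2] /andP[b1 b2].
  by rewrite !ger0_norm// (le_trans _ (ltW M1))// mulr_ile1.
Qed.

(** On the step, [phi] varies at most by its decrease, being monotone, and q by its Lipschitz
    constant times h. *)
Lemma riemann_step (a h : R) : 0 <= a -> 0 < h <= 1 ->
  `|Rintegral mu `]a, a + h] f - h * (phi (a + h) * q a)| <=
  h * (phi a - phi (a + h)) + L * h ^+ 2.
Proof.
move=> a0 /andP[h0 h1]; pose c := phi (a + h) * q a.
have mh : mu `]a, a + h]%classic = h%:E.
  by rewrite lebesgue_measure_itv/= lte_fin ltrDl h0 -EFinB addrC addKr.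
have iff : mu.-integrable `]a, a + h] (EFin \o f).
  apply: integrableS (f_integrable (a + h)); [exact: measurable_itv|exact: measurable_itv|].
  by move=> u /=; rewrite !in_itv/= => /andP[au ->]; rewrite (le_trans a0 (ltW au)).
have icst (x : R) : mu.-integrable `]a, a + h] (EFin \o (fun=> x)).
  apply: measurable_bounded_integrable; first exact: measurable_itv.
  - by apply: le_lt_trans (ltry h); rewrite -mh.
  - exact: measurable_cst.
  - exact: bounded_cst.
have cE (x : R) : Rintegral mu `]a, a + h] (fun=> x) = x * h.
  by rewrite Rintegral_cst; [rewrite /= mh|exact: measurable_itv].
rewrite mulrC -cE -RintegralB; [|exact: measurable_itv|exact: iff|exact: icst].
have mI : measurable (`]a, a + h]%classic : set (measurableTypeR R)).
  exact: measurable_itv.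
have ifc : mu.-integrable `]a, a + h] (EFin \o (fun u => f u - c)).
  exact: eq_integrable (integrableB mI iff (icst c)).
apply: le_trans (le_normr_Rintegral mI ifc) _.
rewrite (_ : h * _ + _ = ((phi a - phi (a + h)) + L * h) * h); last by ring.
rewrite -cE; apply: le_Rintegral.
- exact: measurable_itv.
- exact: integrable_norm.
- exact: icst.
move=> u /=; rewrite in_itv/= => /andP[au uah].
have u0 : 0 <= u by rewrite (le_trans a0) ?ltW.
have ah0 : 0 <= a + h by rewrite addr_ge0// ltW.
rewrite /f /c (_ : _ - _ = (phi u - phi (a + h)) * q u + phi (a + h) * (q u - q a)); last by ring.
rewrite (le_trans (ler_normD _ _))// !normrM lerD//.
  have /andP[q1 q2] := q0 u0; have h2 := phi_nincr a0 (ltW au).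
  have h3 := phi_nincr u0 uah.
  rewrite (ger0_norm q1) ger0_norm ?subr_ge0//; nra.
have /andP[p1 p2] := phi0 ah0; rewrite (ger0_norm p1).
have := @qL a (u - a) a0; rewrite subrKC => H.
have {}H : `|q u - q a| <= L * (u - a) by apply: H; lra.
have : L * (u - a) <= L * h by rewrite ler_wpM2l//; lra.
have := normr_ge0 (q u - q a); nra.
Qed.

(** The decreases of [phi] telescope, to at most 1 in total, which replaces a modulus of continuity;
    each Lipschitz error is of order mesh^2. *)
Lemma riemann_sum_error n M : `|Rintegral mu `[0, M%:R * mesh n] f -
    \sum_(m < M) mesh n * (phi (m.+1%:R * mesh n) * q (m%:R * mesh n))| <=
  mesh n * (1 - phi (M%:R * mesh n)) + L * mesh n ^+ 2 * M%:R.
Proof.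
have h0 := @mesh_gt0 R n; have h1 := @mesh_le1 R n.
elim: M => [|M ih].
  rewrite big_ord0 mul0r subr0 mulr0 addr0 set_itv1 Rintegral_set1 normr0.
  by have /andP[_ p1] := phi0 (lexx 0); apply: mulr_ge0; [exact: ltW h0|rewrite subr_ge0].
have a0 := @mesh_pt_ge0 R M n.
have B := @Rintegral_itvB _ f (BLeft 0) (BRight (M.+1%:R * mesh n)) (M%:R * mesh n)
  (f_integrable _).
have {}B : Rintegral mu `[0, M.+1%:R * mesh n] f =
    Rintegral mu `[0, M%:R * mesh n] f +
    Rintegral mu `]M%:R * mesh n, M.+1%:R * mesh n] f.
  have Mle : M%:R * mesh n <= M.+1%:R * mesh n :> R by rewrite mesh_succ lerDl ltW.
  by rewrite -B ?bnd_simp// addrC subrK.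
have S := @riemann_step (M%:R * mesh n) (mesh n) a0.
rewrite h0 h1 -mesh_succ in S; have {}S := S isT.
rewrite B big_ord_recr /= opprD addrACA (le_trans (ler_normD _ _))//.
apply: le_trans (lerD ih S) _.
by rewrite le_eqVlt; apply/orP; left; apply/eqP; rewrite -natr1; ring.
Qed.

Lemma riemann_sum_cvg :
  \sum_(m < K * n.+1) mesh n * (phi (m.+1%:R * mesh n) * q (m%:R * mesh n))
    @[n --> \oo] --> Rintegral mu `[0, K%:R] f.
Proof.
apply/cvgrPdist_le => e e0.
(* With K (n + 1) cells the error is at most (1 + L K) times the mesh. *)
have d0 : 0 < e / (1 + L * K%:R) by rewrite divr_gt0// ltr_pwDl// mulr_ge0.
have := @mesh_small R _ d0; apply: filterS => n /andP[h0 hd].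
have := riemann_sum_error n (K * n.+1); rewrite meshK => /le_trans; apply.
rewrite -mulrA [mesh n ^+ 2 * _]mulrC expr2 [_%:R * (_ * _)]mulrA meshK.
move: hd; rewrite ltr_pdivlMr ?ltr_pwDl ?mulr_ge0// => hd.
have /andP[p1 p2] := @phi0 K%:R (ler0n _ _).
have : mesh n * (1 - phi K%:R) <= mesh n by rewrite ler_piMr ?(ltW h0)//; lra.
rewrite mulrA; lra.
Qed.

End RiemannSum.

(** * Expected discounted jumps of the Markov process on a bounded horizon *)

Section MarkovJumps.
Context {R : realType} {d} {Omega : measurableType d} (P : probability Omega R).
Variables (N : nat) (Lam : 'M[R]_N) (Pt : R -> 'M[R]_N) (Z : R -> Omega -> 'I_N).
Hypotheses (Pt_trans : transition_function Lam Pt)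
  (Z_mjp : markov_jump_process P Pt Z).

Definition start_at k : set Omega := [set om | Z 0 om = k].

Lemma measurable_start_at k : measurable (start_at k).
Proof. exact: (mjp_measurable Z_mjp). Qed.

Lemma transition_le1 t i j : 0 <= t -> Pt t i j <= 1.
Proof.
move=> t0; rewrite -(transition_sum1 Pt_trans i t0) (bigD1 j)//= lerDl.
by apply: sumr_ge0 => k _; exact: (transition_ge0 Pt_trans).
Qed.

Let past_nil (s : R) (q : R * 'I_N) : q \in [::] -> 0 <= q.1 <= s.
Proof. by []. Qed.

(** The Markov property at time 0 with an empty past. *)
Lemma prob_start_at t k i : 0 <= t ->
  P (start_at k `&` [set om | Z t om = i]) = (P (start_at k) * (Pt t k i)%:E)%E.
Proof.
move=> t0; have := mjp_markov Z_mjp (past := [::]) k i (lexx 0) t0 (past_nil 0).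
rewrite (_ : [set om | _] = start_at k `&` [set om | Z t om = i]); last first.
  by apply/seteqP; split=> om /=; rewrite add0r; by [case|case=> ? ?; split].
rewrite (_ : [set om | _ /\ _] = start_at k)//.
by apply/seteqP; split=> om /=; [case|].
Qed.

Lemma prob_start_at_jump s t k i j : 0 <= s -> 0 <= t ->
  P (start_at k `&` [set om | Z s om = i /\ Z (s + t) om = j]) =
  (P (start_at k) * (Pt s k i * Pt t i j)%:E)%E.
Proof.
move=> s0 t0; have past q : q \in [:: (0, k)] -> 0 <= q.1 <= s.
  by rewrite inE => /eqP -> /=; rewrite lexx.
have := mjp_markov Z_mjp i j s0 t0 past.
rewrite (_ : [set om | _] = start_at k `&` [set om | Z s om = i /\ Z (s + t) om = j]); last first.
  apply/seteqP; split=> om /= => [[h zs zt]|[h [zs zt]]].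
    by split=> //; exact: (h (0, k) (mem_head _ _)).
  by split=> // q; rewrite inE => /eqP ->.
rewrite (_ : [set om | (forall q, _) /\ _] = start_at k `&` [set om | Z s om = i]).
  by rewrite prob_start_at// => ->; rewrite EFinM muleA.
apply/seteqP; split=> om /= => [[h zs]|[h zs]].
  by split=> //; exact: (h (0, k) (mem_head _ _)).
by split=> // q; rewrite inE => /eqP ->.
Qed.

(** A bound uniform in s and free of the initial state: it serves the integrability of jump sums
    over the whole probability space. *)
Lemma prob_jump_le s t i j : 0 <= s -> 0 <= t ->
  (P [set om | Z s om = i /\ Z (s + t) om = j] <= (Pt t i j)%:E)%E.
Proof.
move=> s0 t0; have := mjp_markov Z_mjp (past := [::]) i j s0 t0 (past_nil s).
rewrite (_ : [set om | _] = [set om | Z s om = i /\ Z (s + t) om = j]); last first.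
  by apply/seteqP; split=> om /=; by [case|case=> ? ?; split].
move=> ->; rewrite -[leRHS]mul1e lee_wpmul2r//.
  by rewrite lee_fin (transition_ge0 Pt_trans).
apply: probability_le1.
rewrite (_ : [set om | _] = [set om | Z s om = i]); first exact: (mjp_measurable Z_mjp).
by apply/seteqP; split=> om /=; [case|].
Qed.

Lemma transition_small_time i j : i != j ->
  exists2 C : R, 0 <= C & \forall n \near \oo, Pt (mesh n) i j <= C * mesh n.
Proof.
move=> ij; have := @transition_intensity _ _ _ _ Pt_trans i j.
rewrite (negbTE ij) => /cvgrPdist_le/(_ 1 ltr01)/at_right0_ex[e e0 he].
exists (`|Lam i j| + 1); first by rewrite addr_ge0.
have := mesh_small e0; apply: filterS => n hn.
have h0 : 0 < mesh n :> R by case/andP: hn.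
have := he _ hn; rewrite subr0 ler_distl => /andP[h1 h2].
rewrite mulrC -ler_pdivrMl//.
have := ler_norm (Lam i j); lra.
Qed.

Lemma transition_mesh_cvg i j : i != j ->
  (mesh n)^-1 * Pt (mesh n) i j @[n --> \oo] --> Lam i j.
Proof.
move=> ij; have := @transition_intensity _ _ _ _ Pt_trans i j.
have hm : (forall n, 0 < @mesh R n) /\ @mesh R n @[n --> \oo] --> 0.
  by split; [exact: mesh_gt0|exact: cvg_harmonic].
rewrite (negbTE ij) => /cvg_at_rightP/(_ _ hm).
by under eq_cvg do rewrite subr0.
Qed.

Section Weighted.
Variables (phi : R -> R) (K : nat).
Hypothesis phi_ge0 : forall u, 0 <= phi u.
Hypothesis phi_le1 : forall u, 0 <= u -> phi u <= 1.
Hypothesis phi_nincr : forall u v, 0 <= u -> u <= v -> phi v <= phi u.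
Hypothesis phi_right : forall u e, 0 <= u -> 0 < e ->
  exists2 d : R, 0 < d & forall v, u <= v < u + d -> phi u - e <= phi v.

Let gs n i j om := grid_sum (Z ^~ om) phi K n i j.
Let js i j om := jump_sum (Z ^~ om) phi K i j.

Let step n i j (m : nat) : set Omega :=
  [set om | Z (m%:R * mesh n) om = i /\ Z (m%:R * mesh n + mesh n) om = j].

Let measurable_step n i j m : measurable (step n i j m).
Proof.
apply: measurableI; apply: (mjp_measurable Z_mjp); first exact: mesh_pt_ge0.
by rewrite addr_ge0 ?mesh_pt_ge0// ltW// mesh_gt0.
Qed.

Let gsE n i j om : (gs n i j om)%:E =
  (\sum_(m < K * n.+1) (phi (m.+1%:R * mesh n) * \1_(step n i j m) om)%:E)%E.
Proof.
rewrite /gs /grid_sum -sumEFin; apply: eq_bigr => m _; congr (_ * _)%:E.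
rewrite indicE mesh_succ; congr (_%:R); congr (nat_of_bool _).
apply/andP/idP => [[/eqP h1 /eqP h2]|/set_mem[-> ->]]; last by rewrite !eqxx.
by apply/mem_set; split.
Qed.

Let integral_gs n i j (D : set Omega) : measurable D ->
  (\int[P]_(om in D) (gs n i j om)%:E =
   \sum_(m < K * n.+1) (phi (m.+1%:R * mesh n))%:E * P (step n i j m `&` D))%E.
Proof.
move=> mD; under eq_integral do rewrite gsE.
rewrite ge0_integral_sum//.
- apply: eq_bigr => m _; under eq_integral do rewrite EFinM.
  rewrite ge0_integralZl//; first by rewrite integral_indic.
  + by apply/measurable_EFinP; exact: measurable_indic.
  + by rewrite lee_fin.
- move=> m; apply/measurable_EFinP; exact: measurable_funM.
- by move=> m om _; rewrite lee_fin mulr_ge0.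
Qed.

Let gs_ge0 n i j om : 0 <= gs n i j om.
Proof. by apply: sumr_ge0 => m _; rewrite mulr_ge0. Qed.

Let measurable_gs n i j : measurable_fun setT (fun om => (gs n i j om)%:E).
Proof.
under eq_fun do rewrite gsE; apply: emeasurable_sum => m.
by apply/measurable_EFinP; exact: measurable_funM.
Qed.

(** The mesh and its inverse are inserted so that one factor tends to the intensity and the other is
    a Riemann sum. *)
Lemma integral_grid_sum n k i j :
  (\int[P]_(om in start_at k) (grid_sum (Z ^~ om) phi K n i j)%:E =
   (fine (P (start_at k)) * ((mesh n)^-1 * Pt (mesh n) i j *
     \sum_(m < K * n.+1) mesh n * (phi (m.+1%:R * mesh n) * Pt (m%:R * mesh n) k i)))%:E)%E.
Proof.
have pE : P (start_at k) = (fine (P (start_at k)))%:E.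
  by rewrite fineK// fin_num_measure//; exact: measurable_start_at.
rewrite (integral_gs _ _ _ (measurable_start_at k)) !mulr_sumr -sumEFin.
apply: eq_bigr => m _; rewrite setIC prob_start_at_jump ?mesh_pt_ge0//; last first.
  exact/ltW/mesh_gt0.
rewrite pE -!EFinM; congr (_ %:E).
have h0 : mesh n != 0 :> R by rewrite gt_eqF// mesh_gt0.
by field.
Qed.

(** There are K (n + 1) cells, and each shows a change from i to j with probability O(mesh). *)
Lemma integral_grid_sum_bound i j : i != j ->
  exists C : R, \forall n \near \oo,
    (\int[P]_om (grid_sum (Z ^~ om) phi K n i j)%:E <= C%:E)%E.
Proof.
move=> ij; have [C C0 hC] := transition_small_time ij.
exists (C * K%:R); apply: filterS hC => n hn.
rewrite (integral_gs _ _ _ measurableT).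
apply: (@le_trans _ _ (\sum_(m < K * n.+1) (C * mesh n)%:E)%E).
  apply: lee_sum => m _; rewrite setIT -[leRHS]mul1e; apply: lee_pmul => //.
  - by rewrite lee_fin.
  - by rewrite lee_fin phi_le1// mesh_pt_ge0.
  apply: (@le_trans _ _ (Pt (mesh n) i j)%:E); last by rewrite lee_fin.
  by apply: prob_jump_le; [exact: mesh_pt_ge0|exact/ltW/mesh_gt0].
rewrite sumEFin sumr_const card_ord lee_fin -[leLHS]mulr_natr -mulrA [mesh n * _]mulrC.
by rewrite meshK.
Qed.

Let js_cvg om i j : i != j -> (gs n i j om)%:E @[n --> \oo] --> js i j om.
Proof.
apply: grid_sum_cvg => // t; first exact: (mjp_right_continuous Z_mjp).
exact: (mjp_left_limit Z_mjp).
Qed.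

Lemma measurable_jump_sum i j : i != j ->
  measurable_fun setT (fun om => jump_sum (Z ^~ om) phi K i j).
Proof.
move=> ij; apply: (emeasurable_fun_cvg (fun n om => (gs n i j om)%:E)) => //.
by move=> om _; exact: js_cvg.
Qed.

Lemma integrable_jump_sum i j : i != j ->
  P.-integrable setT (fun om => jump_sum (Z ^~ om) phi K i j).
Proof.
move=> ij; apply/integrableP; split; first exact: measurable_jump_sum.
have [C hC] := integral_grid_sum_bound ij.
apply: (@le_lt_trans _ _ C%:E); last exact: ltry.
under eq_integral do rewrite gee0_abs ?jump_sum_ge0//.
have gs0 n om : [set: Omega] om -> (0 <= (gs n i j om)%:E)%E.
  by move=> _; rewrite lee_fin; exact: gs_ge0.
have F := fatou P measurableT (fun n => measurable_gs n i j) gs0.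
rewrite (_ : \int[P]_om _ = \int[P]_om limn_einf (fun n => (gs n i j om)%:E))%E; last first.
  by apply: eq_integral => om _; rewrite (cvg_limn_einf_sup (@js_cvg om _ _ ij)).1.
apply: le_trans F _; rewrite limn_einf_lim.
apply: lime_le; first exact: is_cvg_einfs.
(* The bound holds from [n0] on, and the infimum over the indices from n on is below the term of
   index n + n0. *)
have [n0 _ hn0] := hC; apply: nearW => n.
apply: (@le_trans _ _ (\int[P]_om (gs (n + n0) i j om)%:E)%E).
  by apply: ereal_inf_lbound; exists (n + n0)%N => //=; rewrite leq_addr.
by apply: hn0 => /=; rewrite leq_addl.
Qed.

Lemma integral_jump_sum k i j (L : R) : i != j -> 0 <= L ->
  measurable_fun `[(0 : R), +oo[ phi ->
  measurable_fun `[(0 : R), +oo[ (fun u => Pt u k i) ->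
  (forall s h, 0 <= s -> 0 <= h <= 1 -> `|Pt (s + h) k i - Pt s k i| <= L * h) ->
  (\int[P]_(om in start_at k) jump_sum (Z ^~ om) phi K i j =
   (fine (P (start_at k)) *
     (Lam i j * Rintegral (@lebesgue_measure R) `[0%R, K%:R] (fun u => phi u * Pt u k i)))%:E)%E.
Proof.
move=> ij L0 mphi mq qL.
pose G om := (\sum_(kl : 'I_N * 'I_N | kl.1 != kl.2) js kl.1 kl.2 om)%E.
have iG : P.-integrable (start_at k) G.
  apply: integrableS measurableT (measurable_start_at k) (@subsetT _ _) _.
  by apply: integrable_sum => // -[a b] /= ab; exact: integrable_jump_sum.
have lim1 : (\int[P]_(om in start_at k) (gs n i j om)%:E)%E @[n --> \oo] -->
    (\int[P]_(om in start_at k) js i j om)%E.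
  have m_gs n : measurable_fun (start_at k) (fun om => (gs n i j om)%:E).
    exact: measurable_funTS (measurable_gs n i j).
  have m_js : measurable_fun (start_at k) (js i j).
    exact: measurable_funTS (measurable_jump_sum ij).
  have gs_js : {ae P, forall om, start_at k om ->
      (gs n i j om)%:E @[n --> \oo] --> js i j om}.
    by apply: aeW => om _; exact: js_cvg.
  have gs_G : {ae P, forall om n, start_at k om -> (`|(gs n i j om)%:E| <= G om)%E}.
    apply: aeW => om n _; have g0 : (0 <= (gs n i j om)%:E)%E by rewrite lee_fin; exact: gs_ge0.
    rewrite (gee0_abs g0).
    apply: grid_sum_le_total => // t; first exact: (mjp_right_continuous Z_mjp).
    exact: (mjp_left_limit Z_mjp).
  by have [] := dominated_convergence (measurable_start_at k) m_gs m_js gs_js iG gs_G.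
have phi01 u : 0 <= u -> 0 <= phi u <= 1 by move=> u0; rewrite phi_ge0 phi_le1.
have q01 u : 0 <= u -> 0 <= Pt u k i <= 1.
  by move=> u0; rewrite (transition_ge0 Pt_trans) ?transition_le1.
have lim2 := riemann_sum_cvg (K := K) phi01 phi_nincr mphi mq q01 L0 qL.
have lim3 : (\int[P]_(om in start_at k) (gs n i j om)%:E)%E @[n --> \oo] -->
   ((fine (P (start_at k)) *
     (Lam i j * Rintegral (@lebesgue_measure R) `[0%R, K%:R] (fun u => phi u * Pt u k i)))%:E)%E.
  under eq_cvg do rewrite /gs integral_grid_sum.
  apply: cvg_EFin; first exact: nearW.
  by apply: cvgMr; apply: cvgM lim2; exact: transition_mesh_cvg.
exact: cvg_unique lim1 lim3.
Qed.

End Weighted.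
End MarkovJumps.

(** * From bounded horizons to the infinite horizon *)

Section TotalJumpSum.
Context {R : realType} {S : finType}.
Variables (z : R -> S) (phi : R -> R).

Definition total_jump_sum (i j : S) : \bar R :=
  \esum_(v in path_jump z i j) (phi v)%:E.

Lemma esum_subset (A B : set R) (f : R -> \bar R) : A `<=` B ->
  (\esum_(v in A) f v <= \esum_(v in B) f v)%E.
Proof.
move=> AB; apply: ge_ereal_sup => _ [X [finX XA] <-]; apply: esum_ge.
by exists X => //; split=> //; exact: subset_trans AB.
Qed.

Lemma jump_sum_nondecreasing i j :
  nondecreasing_seq (fun K => jump_sum z phi K i j).
Proof.
move=> K K' KK'; apply: esum_subset => v [J vK]; split=> //=.
by rewrite (le_trans vK)// ler_nat.
Qed.

(** A finite set of jump times lies below some K, so the supremum over finite subsets is approached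
    along bounded horizons. *)
Lemma total_jump_sum_cvg i j :
  jump_sum z phi K i j @[K --> \oo] --> total_jump_sum i j.
Proof.
rewrite (_ : total_jump_sum i j = ereal_sup (range (fun K => jump_sum z phi K i j))).
  exact/ereal_nondecreasing_cvgn/jump_sum_nondecreasing.
apply/eqP; rewrite eq_le; apply/andP; split; last first.
  by apply: ge_ereal_sup => _ [K _ <-]; apply: esum_subset => v [].
apply: ge_ereal_sup => _ [X [finX XJ] <-].
have [K hK] : exists K : nat, forall v, X v -> v <= K%:R.
  have [M hM] : exists M : R, forall v, v \in finmap.enum_fset (fset_set X) -> v <= M.
    elim: (finmap.enum_fset _) => [|x s [M hM]]; first by exists 0.
    exists (Num.max x M) => v; rewrite inE le_max => /predU1P[->|/hM ->]; last by rewrite orbT.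
    by rewrite lexx.
  have [K hK] := exists_nat_gt M; exists K.+1 => v Xv; rewrite (le_trans _ hK)//.
  by apply: hM; rewrite in_fset_set//; exact/mem_set.
apply: (@le_trans _ _ (jump_sum z phi K i j)).
  by apply: esum_ge; exists X => //; split=> // v Xv; split; [exact: XJ|exact: hK].
by apply: ereal_sup_ubound; exists K.
Qed.

End TotalJumpSum.

Section MarkovTotalJumps.
Context {R : realType} {d} {Omega : measurableType d} (P : probability Omega R).
Variables (N : nat) (Lam : 'M[R]_N) (Pt : R -> 'M[R]_N) (Z : R -> Omega -> 'I_N).
Hypotheses (Pt_trans : transition_function Lam Pt)
  (Z_mjp : markov_jump_process P Pt Z).
Variable (phi : R -> R).
Hypothesis phi_ge0 : forall u, 0 <= phi u.
Hypothesis phi_le1 : forall u, 0 <= u -> phi u <= 1.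
Hypothesis phi_nincr : forall u v, 0 <= u -> u <= v -> phi v <= phi u.
Hypothesis phi_right : forall u e, 0 <= u -> 0 < e ->
  exists2 d : R, 0 < d & forall v, u <= v < u + d -> phi u - e <= phi v.
Local Notation half := (`[(0 : R), +oo[%classic).
Local Notation mu := (@lebesgue_measure R).
Local Notation start := (start_at Z).

Lemma measurable_total_jump_sum i j : i != j ->
  measurable_fun setT (fun om => total_jump_sum (Z ^~ om) phi i j).
Proof.
move=> ij; apply: (emeasurable_fun_cvg (fun K om => jump_sum (Z ^~ om) phi K i j)).
  by move=> K; apply: (measurable_jump_sum Z_mjp).
by move=> om _; exact: total_jump_sum_cvg.
Qed.

(** Both sides grow with the horizon K, so monotone convergence takes the place of domination. *)
Lemma integral_total_jump_sum k i j (L : R) : i != j -> 0 <= L ->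
  measurable_fun half phi -> measurable_fun half (fun u => Pt u k i) ->
  (forall s h, 0 <= s -> 0 <= h <= 1 -> `|Pt (s + h) k i - Pt s k i| <= L * h) ->
  mu.-integrable half (EFin \o (fun u => phi u * Pt u k i)) ->
  (\int[P]_(om in start k) total_jump_sum (Z ^~ om) phi i j =
   (fine (P (start k)) *
     (Lam i j * Rintegral mu half (fun u => phi u * Pt u k i)))%:E)%E.
Proof.
move=> ij L0 mphi mq qL iq; set f := fun u => phi u * Pt u k i in iq *.
have mk := measurable_start_at Z_mjp k.
have lim1 : (\int[P]_(om in start k) jump_sum (Z ^~ om) phi K i j)%E @[K --> \oo] -->
    (\int[P]_(om in start k) total_jump_sum (Z ^~ om) phi i j)%E.
  rewrite (_ : (\int[P]_(om in start k) total_jump_sum (Z ^~ om) phi i j)%E =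
     (\int[P]_(om in start k) limn (fun K => jump_sum (Z ^~ om) phi K i j))%E); last first.
    by apply: eq_integral => om _; apply/esym/cvg_lim => //; exact: total_jump_sum_cvg.
  apply: cvg_monotone_convergence => //.
  - by move=> K; apply: measurable_funTS; apply: (measurable_jump_sum Z_mjp).
  - by move=> K om _; exact: jump_sum_ge0.
  - by move=> om _; exact: jump_sum_nondecreasing.
have f0 u : 0 <= u -> 0 <= f u.
  by move=> u0; rewrite mulr_ge0// (transition_ge0 Pt_trans).
have ifK (K : nat) : mu.-integrable `[0, K%:R] (EFin \o f).
  apply: integrableS iq; [exact: measurable_itv|exact: measurable_itv|].
  by move=> u /=; rewrite !in_itv/= andbT => /andP[].
have lim2 : (\int[mu]_(u in `[0%R, K%:R]) (f u)%:E)%E @[K --> \oo] -->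
    (\int[mu]_(u in half) (f u)%:E)%E.
  have -> : half = \bigcup_(K : nat) `[(0 : R), K%:R]%classic.
    apply/seteqP; split=> u /=; rewrite ?in_itv/= ?andbT.
      move=> u0; have [K hK] := exists_nat_gt u; exists K.+1 => //=.
      by rewrite in_itv/= u0.
    by move=> [K _] /=; rewrite in_itv/= => /andP[].
  apply: ge0_nondecreasing_set_cvg_integral.
  - move=> m n mn; apply/subsetPset; apply: subset_itvl.
    by rewrite bnd_simp ler_nat.
  - by move=> n; exact: measurable_itv.
  - move=> n; exact: measurable_int (ifK n).
  - by move=> n u /=; rewrite in_itv/= => /andP[u0 _]; rewrite lee_fin f0.
have lim3 : (\int[P]_(om in start k) jump_sum (Z ^~ om) phi K i j)%E @[K --> \oo] -->
   ((fine (P (start k)) * (Lam i j * Rintegral mu half f))%:E)%E.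
  under eq_cvg => K do rewrite (integral_jump_sum Pt_trans Z_mjp K phi_ge0 phi_le1 phi_nincr
    phi_right ij L0 mphi mq qL).
  apply: cvg_EFin; first exact: nearW.
  apply: cvgMr; apply: cvgMr; apply: fine_cvg.
  by rewrite /Rintegral fineK//; exact: integrable_fin_num.
exact: cvg_unique lim1 lim3.
Qed.

End MarkovTotalJumps.

(** * Occupation times and joint measurability in time and outcome *)

Section Occupation.
Context {R : realType} {d} {Omega : measurableType d} (P : probability Omega R).
Variables (N : nat) (Lam : 'M[R]_N) (Pt : R -> 'M[R]_N) (Z : R -> Omega -> 'I_N).
Hypotheses (Pt_trans : transition_function Lam Pt)
  (Z_mjp : markov_jump_process P Pt Z).
Local Notation half := (`[(0 : R), +oo[%classic).
Local Notation mu := (@lebesgue_measure R).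
Local Notation start := (start_at Z).

Definition occupied i : set (measurableTypeR R * Omega) :=
  [set z | 0 <= z.1 /\ Z z.1 z.2 = i].

Let cell n (m : nat) : set (measurableTypeR R) :=
  `[m%:R * mesh n, m.+1%:R * mesh n[%classic.

(** The state at time s is replaced by that at the right end of its cell: the right is the side on
    which paths are continuous. *)
Let cells n i : set (measurableTypeR R * Omega) :=
  \bigcup_m (cell n m `*` [set om | Z (m.+1%:R * mesh n) om = i]).

Let in_cells n i (z : measurableTypeR R * Omega) : 0 <= z.1 ->
  exists t, z.1 < t <= z.1 + mesh n /\ (cells n i z <-> Z t z.2 = i).
Proof.
move=> z0; have x0 : 0 <= z.1 / mesh n by rewrite divr_ge0// ltW// mesh_gt0.
have /andP[] := truncn_itv x0; set m := Num.truncn _.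
rewrite ler_pdivlMr ?mesh_gt0// ltr_pdivrMr ?mesh_gt0// => m1 m2.
exists (m.+1%:R * mesh n); split.
  by rewrite m2 mesh_succ lerD2r.
split=> [[m' _ [/= + zi]]|zi]; last first.
  by exists m => //; split=> //; rewrite /cell /= in_itv/= m1 m2.
rewrite /cell /= in_itv/= => /andP[m1' m2']; rewrite -zi.
suff -> : m = m' by [].
have le k l : k%:R * mesh n < l.+1%:R * mesh n :> R -> (k <= l)%N.
  by rewrite ltr_pM2r ?mesh_gt0// ltr_nat ltnS.
by apply/eqP; rewrite eqn_leq !le// ?(le_lt_trans m1 m2') ?(le_lt_trans m1' m2).
Qed.

Let mhalf_fst : measurable [set z : measurableTypeR R * Omega | half z.1].
Proof.
rewrite (_ : [set z | _] = (half : set (measurableTypeR R)) `*` setT).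
  by apply: measurableX => //; exact: measurable_itv.
by apply/seteqP; split=> z /=; [split|case].
Qed.

(** By right-continuity, membership in [cells n i] eventually coincides with membership in
    [occupied i], which is thus a lower limit of countable unions of measurable rectangles. *)
Lemma measurable_occupied i : measurable (occupied i).
Proof.
have -> : occupied i = [set z | half z.1] `&`
    \bigcup_n0 \bigcap_(n in [set n | (n0 <= n)%N]) cells n i.
  have ev (z : measurableTypeR R * Omega) : 0 <= z.1 ->
      \forall n \near \oo, cells n i z <-> Z z.1 z.2 = i.
    move=> z0; have [e e0 he] := at_right_ex (mjp_right_continuous Z_mjp z.2 z0).
    have := mesh_small e0; apply: filterS => n /andP[_ hn].
    have [t [/andP[t1 t2] ->]] := in_cells n i z0.
    rewrite he//; rewrite t1/= (le_lt_trans t2)//.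
    by rewrite ltrD2l.
  apply/seteqP; split=> z /=; rewrite in_itv/= andbT.
    move=> [z0 zi]; split=> //; have [n0 _ hn0] := ev z z0.
    by exists n0 => // n /= hn; apply/hn0.
  move=> [z0 [n0 _ hz]]; split=> //; have [n1 _ hn1] := ev z z0.
  apply/(hn1 (n0 + n1)%N); first by rewrite /= leq_addl.
  by apply: hz; rewrite /= leq_addr.
apply: measurableI.
  exact: mhalf_fst.
apply: bigcupT_measurable => n0; apply: bigcap_measurable; first by exists n0 => /=.
move=> n _; apply: bigcupT_measurable => m; apply: measurableX.
  exact: measurable_itv.
by apply: (mjp_measurable Z_mjp); exact: mesh_pt_ge0.
Qed.

Variables (g ginv : R -> R) (r : R).
Hypotheses (tc : time_change g ginv) (r0 : 0 < r).

Definition occupation i om : \bar R :=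
  (\int[mu]_(s in half) (expR (- r * s) * (Z (ginv s) om == i)%:R)%:E)%E.

Let G (s : measurableTypeR R) : measurableTypeR R := time_change_ext ginv s.

Let mG : measurable_fun setT G.
Proof. exact: measurable_time_change_ext (time_change_sym tc). Qed.

(** [G] extends [ginv] to the line, so the second condition is a preimage under a measurable map;
    the first cuts off the negative times. *)
Let E i : set (measurableTypeR R * Omega) := [set z | half z.1 /\ occupied i (G z.1, z.2)].

Let mE i : measurable (E i).
Proof.
apply: measurableI.
  exact: mhalf_fst.
rewrite -[X in measurable X]setTI.
change (measurable (setT `&` (fun z : measurableTypeR R * Omega => (G z.1, z.2)) @^-1` occupied i)).
have mGp : measurable_fun setT (fun z : measurableTypeR R * Omega => (G z.1, z.2)).
  apply: measurable_fun_pair; last exact: measurable_snd.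
  exact: measurableT_comp mG measurable_fst.
exact: mGp measurableT _ (measurable_occupied i).
Qed.

(** The indicators of the half-line and of D are part of the integrand, so that Tonelli's theorem
    applies on the full product space. *)
Let F i (D : set Omega) (z : measurableTypeR R * Omega) : \bar R :=
  (expR (- r * z.1) * (\1_(E i) z * \1_D z.2))%:E.

Let F0 i D z : (0 <= F i D z)%E.
Proof. by rewrite lee_fin !mulr_ge0 ?expR_ge0. Qed.

Let mF i D : measurable D -> measurable_fun setT (F i D).
Proof.
move=> mD; apply/measurable_EFinP; rewrite -setXTT; apply: measurable_funM.
  apply: (measurable_fst_on (f := fun s : measurableTypeR R => expR (- r * s))) => //.
  by apply: measurableT_comp => //; apply: measurable_funM.
apply: measurable_funM; first by rewrite setXTT; exact: measurable_indic.
apply: (measurable_snd_on (f := (\1_D : Omega -> R))) => //.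
Qed.

Let indicE_half i om s : 0 <= s -> \1_(E i) (s, om) = (Z (ginv s) om == i)%:R :> R.
Proof.
move=> s0; rewrite indicE; congr ((nat_of_bool _)%:R).
apply/idP/eqP => [/set_mem[_ [_]]|zi]; rewrite /G /= ?time_change_extE//.
apply/mem_set; split=> /=; first by rewrite in_itv/= andbT.
by rewrite /G time_change_extE//; split=> //=; exact: (tc_inv_ge0 tc).
Qed.

Let indicE_neg i om s : s < 0 -> \1_(E i) (s, om) = 0 :> R.
Proof.
move=> s0; rewrite indicE memNset// => -[/=]; rewrite in_itv/= andbT.
by rewrite leNgt s0.
Qed.

Let F_half i D om s : 0 <= s ->
  F i D (s, om) = (expR (- r * s) * (Z (ginv s) om == i)%:R * \1_D om)%:E.
Proof. by move=> s0; rewrite /F /= indicE_half// mulrA. Qed.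

Let F_neg i D om s : s < 0 -> F i D (s, om) = 0%E.
Proof. by move=> s0; rewrite /F /= indicE_neg// mul0r mulr0. Qed.

Let integral_half (f h : measurableTypeR R -> \bar R) :
    (forall s, 0 <= s -> f s = h s) -> (forall s, s < 0 -> f s = 0%E) ->
  (\int[mu]_s f s = \int[mu]_(s in half) h s)%E.
Proof.
move=> fh f0; rewrite [RHS]integral_mkcond; apply: eq_integral => s _; rewrite patchE.
case: ifPn => [/set_mem|/negP hs] /=.
  by rewrite in_itv/= andbT => /fh.
rewrite f0// ltNge; apply/negP => s0; apply: hs.
by apply/mem_set; rewrite /= in_itv/= andbT.
Qed.

Let moc i om : measurable_fun half
  (fun s => (expR (- r * s) * (Z (ginv s) om == i)%:R)%:E).
Proof.
have : measurable_fun (half : set (measurableTypeR R)) (fun s => F i setT (s, om)).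
  apply: (measurable_funTS (f := F i setT \o (fun s : measurableTypeR R => (s, om)))).
  apply: measurableT_comp; first exact: mF.
  exact: pair2_measurable.
apply: eq_measurable_fun => s /set_mem /=; rewrite in_itv/= andbT => s0.
by rewrite F_half// indicE mem_set// mulr1.
Qed.

Let occupationE i D om :
  (\int[mu]_s F i D (s, om) = occupation i om * (\1_D om)%:E)%E.
Proof.
rewrite /occupation -ge0_integralZr//.
- by apply: integral_half => s s0; [rewrite F_half|rewrite F_neg].
- exact: moc.
Qed.

Lemma integrable_discounted_state i om : mu.-integrable half
  (fun s => (expR (- r * s) * (Z (ginv s) om == i)%:R)%:E).
Proof.
apply: le_integrable (expR_integrable r0); first exact: measurable_itv.
  exact: moc.
move=> s _; rewrite lee_fin normrM mulNr ler_piMr//.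
by rewrite normr_nat lern1 leq_b1.
Qed.

Lemma occupation_ge0 i om : (0 <= occupation i om)%E.
Proof. by apply: integral_ge0 => s _; rewrite lee_fin mulr_ge0 ?expR_ge0. Qed.

Lemma occupation_le i om :
  (occupation i om <= \int[mu]_(s in half) (expR (- (r * s)))%:E)%E.
Proof.
apply: ge0_le_integral.
- exact: measurable_itv.
- by move=> s _; rewrite lee_fin mulr_ge0 ?expR_ge0.
- exact: moc.
- exact: measurable_int (expR_integrable r0).
- by move=> s _; rewrite lee_fin mulNr ler_piMr ?expR_ge0// lern1 leq_b1.
Qed.

Lemma measurable_occupation i : measurable_fun setT (occupation i).
Proof.
have := @measurable_fun_fubini_tonelli_G _ _ (measurableTypeR R) Omega R mu _ (mF i measurableT) (F0 i setT).
apply: eq_measurable_fun => om _; rewrite /fubini_G occupationE.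
by rewrite indicE mem_set// mule1.
Qed.

Lemma integrable_occupation i : P.-integrable setT (occupation i).
Proof.
have fin : (\int[mu]_(s in half) (expR (- (r * s)))%:E)%E \is a fin_num.
  by apply: integrable_fin_num (expR_integrable r0); exact: measurable_itv.
apply: (le_integrable measurableT (measurable_occupation i)); last first.
  exact: (finite_measure_integrable_cst P
    (fine (\int[mu]_(s in half) (expR (- (r * s)))%:E)%E)).
move=> om _; rewrite (gee0_abs (occupation_ge0 i om)) /=.
rewrite ger0_norm; last by apply: fine_ge0; apply: integral_ge0 => s _; rewrite lee_fin expR_ge0.
by rewrite fineK//; exact: occupation_le.
Qed.

Lemma integral_occupation i k :
  mu.-integrable half (EFin \o (fun s => expR (- r * s) * Pt (ginv s) k i)) ->
  (\int[P]_(om in start k) occupation i om = (fine (P (start k)) *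
    Rintegral mu half (fun s => expR (- r * s) * Pt (ginv s) k i))%:E)%E.
Proof.
move=> iq; have mk := measurable_start_at Z_mjp k.
rewrite (_ : (\int[P]_(om in start k) _)%E =
    (\int[P]_om \int[mu]_s F i (start k) (s, om))%E); last first.
  rewrite integral_mkcond; apply: eq_integral => om _; rewrite occupationE patchE indicE.
  by case: ifPn => _; rewrite ?mule1 ?mule0.
rewrite -(@fubini_tonelli _ _ (measurableTypeR R) Omega R mu P _ (mF i mk) (F0 i (start k))).
rewrite (integral_half (h := fun s => ((fine (P (start k)))%:E *
    (expR (- r * s) * Pt (ginv s) k i)%:E)%E)).
- rewrite integralZl//.
  have fq : (\int[mu]_(s in half) (expR (- r * s) * Pt (ginv s) k i)%:E)%E \is a fin_num.
    by apply: integrable_fin_num iq; exact: measurable_itv.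
  by rewrite EFinM /Rintegral (fineK fq).
- move=> s s0.
  rewrite (eq_integral (fun om => ((expR (- r * s))%:E *
      (\1_(start k `&` [set om | Z (ginv s) om = i]) om)%:E)%E)); last first.
    move=> om _; rewrite F_half// -EFinM -mulrA; congr ((_ * _)%:E).
    rewrite indicI mulrC; congr (_ * _); rewrite indicE; congr ((nat_of_bool _)%:R).
    by apply/eqP/idP => [zi|/set_mem//]; apply/mem_set.
  have gs := tc_inv_ge0 tc s0.
  have mI : measurable (start k `&` [set om | Z (ginv s) om = i]).
    by apply: measurableI => //; exact: (mjp_measurable Z_mjp).
  rewrite ge0_integralZl//.
  rewrite integral_indic// setIT.
    transitivity ((expR (- r * s))%:E * (P (start k) * (Pt (ginv s) k i)%:E))%E.
      by congr (_ * _)%E; have h := prob_start_at Z_mjp k i gs; exact: h.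
    by rewrite EFinM fineK ?fin_num_measure// muleCA.
  by apply/measurable_EFinP; exact: measurable_indic.
- by move=> s s0; apply: integral0_eq => om _; rewrite F_neg.
Qed.

End Occupation.

(** * The transient block of the transition function *)

Section TransientBlock.
Context {R : realType}.
Variables (p : nat) (T : 'M[R]_p) (Pt : R -> 'M[R]_(p + 1)).
Hypothesis Pt_trans : transition_function (phase_intensity T) Pt.
Local Notation top := (absorbing_state p).

Let Pt0 t i j : 0 <= t -> 0 <= Pt t i j.
Proof. by move=> t0; exact: (transition_ge0 Pt_trans). Qed.

Let Pt1 t i j : 0 <= t -> Pt t i j <= 1.
Proof. exact: (transition_le1 Pt_trans). Qed.

(** That the state is never left is deduced from its zero intensity: f(s) = 1 - [Pt s top top] is
    subadditive and o(s) at 0, so f(t) <= N f(t / N) tends to 0. *)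
Lemma absorbing_stays t : 0 <= t -> Pt t top top = 1.
Proof.
move=> t0; pose f s := 1 - Pt s top top.
have fD s u : 0 <= s -> 0 <= u -> f (s + u) <= f s + f u.
  move=> s0 u0; rewrite /f (transition_semigroup Pt_trans)// mxE (bigD1 top)//=.
  have : 0 <= \sum_(k | k != top) Pt s top k * Pt u k top.
    by apply: sumr_ge0 => k _; rewrite mulr_ge0// Pt0.
  by have := Pt1 top top s0; have := Pt1 top top u0; nra.
have fn m s : 0 <= s -> f (m%:R * s) <= m%:R * f s.
  move=> s0; elim: m => [|m IH].
    by rewrite !mul0r /f (transition_0 Pt_trans) mxE eqxx subrr.
  rewrite -natr1 !mulrDl !mul1r (le_trans (fD _ _ _ s0)) ?mulr_ge0//.
  by rewrite lerD2r.
suff f0 : f t <= 0 by apply/eqP; rewrite eq_le Pt1//=; rewrite /f subr_le0 in f0.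
have [->|tn0] := eqVneq t 0.
  by rewrite /f (transition_0 Pt_trans) mxE eqxx subrr.
have tgt0 : 0 < t by rewrite lt_neqAle eq_sym tn0.
apply/ler_addgt0Pl => e e0; rewrite addr0.
have : (fun h => h^-1 * (Pt h top top - (top == top)%:R)) @ 0^'+ --> phase_intensity T top top.
  exact: (transition_intensity Pt_trans).
rewrite /phase_intensity block_mxEdr mxE eqxx => /cvgrPdist_lt/(_ (e / t)).
rewrite divr_gt0// => /(_ isT)/at_right0_ex[dl dl0 hd].
(* The factor 2 makes t / (N + 1) strictly smaller than [dl]. *)
have [N hN] := exists_nat_gt (2 * t / dl).
have h0 : 0 < t / N.+1%:R by rewrite divr_gt0.
have := hd (t / N.+1%:R); rewrite h0/= ltr_pdivrMr// mulrC.
have -> : t < N.+1%:R * dl.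
  by rewrite -ltr_pdivrMr// (lt_le_trans _ hN)// ltr_pM2r ?invr_gt0//; lra.
move=> /(_ isT); rewrite sub0r normrN => h.
have := fn N.+1 _ (ltW h0); rewrite mulrC divfK// => /le_trans; apply.
have : `|Pt (t / N.+1%:R) top top - 1| <= e / t * (t / N.+1%:R).
  by rewrite -ler_pdivrMr// mulrC -[X in X * _]gtr0_norm ?invr_gt0// -normrM ltW.
rewrite mulrA divfK// => h2; rewrite mulrC -ler_pdivlMr// (le_trans _ h2)//.
by rewrite /f distrC ler_norm.
Qed.

Lemma absorbing_row0 t j : 0 <= t -> j != top -> Pt t top j = 0.
Proof.
move=> t0 jt; have := transition_sum1 Pt_trans top t0.
rewrite (bigD1 top)//= absorbing_stays// (bigD1 j)//= => /eqP.
rewrite -subr_eq0 addrAC subrr add0r paddr_eq0 ?Pt0//; first by case/andP => /eqP.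
by apply: sumr_ge0 => k _; exact: Pt0.
Qed.

Definition transient_block t : 'M[R]_p := ulsubmx (Pt t).

Lemma transient_blockE t i j :
  transient_block t i j = Pt t (transient_state i) (transient_state j).
Proof. by rewrite !mxE. Qed.

Lemma transient_block0 : transient_block 0 = 1%:M.
Proof.
apply/matrixP => i j; rewrite transient_blockE (transition_0 Pt_trans) !mxE.
by rewrite (inj_eq (@lshift_inj _ _)).
Qed.

(** There is no return from the absorbing state, so its term in the semigroup sum vanishes. *)
Lemma transient_blockD s t : 0 <= s -> 0 <= t ->
  transient_block (s + t) = transient_block s *m transient_block t.
Proof.
move=> s0 t0; apply/matrixP => i j.
rewrite transient_blockE (transition_semigroup Pt_trans)// !mxE big_split_ord/=.
rewrite big_ord1 (absorbing_row0 t0) ?eq_lrshift// mulr0 addr0.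
by apply: eq_bigr => k _; rewrite !transient_blockE.
Qed.

Lemma transient_block_ge0 t i j : 0 <= t -> 0 <= transient_block t i j.
Proof. by move=> t0; rewrite transient_blockE Pt0. Qed.

Lemma transient_block_le1 t i j : 0 <= t -> `|transient_block t i j| <= 1.
Proof. by move=> t0; rewrite transient_blockE ger0_norm ?Pt0 ?Pt1. Qed.

Lemma transient_block_derivative i j :
  (fun h => h^-1 * (transient_block h i j - (i == j)%:R)) @ 0^'+ --> T i j.
Proof.
have : (fun h => h^-1 * (Pt h (transient_state i) (transient_state j) -
    (transient_state i == transient_state j)%:R)) @ 0^'+ -->
    phase_intensity T (transient_state i) (transient_state j).
  exact: (transition_intensity Pt_trans).
rewrite /phase_intensity block_mxEul (inj_eq (@lshift_inj _ _)).
by rewrite (_ : (fun h => _) = (fun h => h^-1 * (transient_block h i j - (i == j)%:R)))//;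
  apply/funext => h; rewrite transient_blockE.
Qed.

End TransientBlock.

(** * Discounting and jumps under the time change *)

Section TimeChangedJumps.
Context {R : realType} {Omega : Type}.
Variables (p : nat) (Z : R -> Omega -> 'I_(p + 1)) (g ginv : R -> R) (r : R).
Hypotheses (tc : time_change g ginv) (r0 : 0 < r).

(** The values of X as a function of the states of Z; its injectivity turns statements about X into
    statements about Z. *)
Definition state_row (k : 'I_(p + 1)) : option 'rV[R]_p :=
  if fintype.split k is inl i then Some (unit_row i) else None.

Lemma state_row_transient i : state_row (transient_state i) = Some (unit_row i).
Proof. by rewrite /state_row (unsplitK (inl _ i)). Qed.

Lemma state_row_absorbing : state_row (absorbing_state p) = None.
Proof. by rewrite /state_row (unsplitK (inr _ ord0)). Qed.

Lemma state_row_inj : injective state_row.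
Proof.
move=> k l; rewrite /state_row -{2}(splitK k) -{2}(splitK l).
case: (fintype.split k) => i; case: (fintype.split l) => j //=; last by rewrite !ord1.
move=> [/matrixP/(_ 0 i)]; rewrite !mxE !eqxx/=.
by case: eqVneq => [->//|_] /eqP; rewrite oner_eq0.
Qed.

Lemma changed_processE t om : changed_process Z ginv t om = state_row (Z (ginv t) om).
Proof. by []. Qed.

Lemma state_row_eqE t om k : (changed_process Z ginv t om = state_row k) = (Z (ginv t) om = k).
Proof. by apply/propext; split=> [/state_row_inj|<-]. Qed.

Definition time_changed_discount (u : R) : R := expR (- r * g u).

Lemma time_changed_discount_ge0 u : 0 <= time_changed_discount u.
Proof. exact: expR_ge0. Qed.

Lemma time_changed_discount_le1 u : 0 <= u -> time_changed_discount u <= 1.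
Proof.
move=> u0; rewrite -expR0 ler_expR mulNr oppr_le0.
by rewrite mulr_ge0 ?(tc_ge0 tc)// ltW.
Qed.

Lemma time_changed_discount_nincr u v : 0 <= u -> u <= v ->
  time_changed_discount v <= time_changed_discount u.
Proof.
move=> u0 uv; rewrite ler_expR !mulNr lerN2 ler_wpM2l ?(ltW r0)//.
exact: (time_change_le tc).
Qed.

(** Right-continuity of g comes from its being an increasing bijection: between u and ginv(g u + e /
    r), it stays below g u + e / r. *)
Lemma time_changed_discount_right u e : 0 <= u -> 0 < e ->
  exists2 d : R, 0 < d &
    forall v, u <= v < u + d -> time_changed_discount u - e <= time_changed_discount v.
Proof.
move=> u0 e0; have er0 : 0 < e / r by rewrite divr_gt0.
have gu0 := tc_ge0 tc u0; pose w := ginv (g u + e / r).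
have g0 : 0 <= g u + e / r by rewrite addr_ge0// ltW.
have uw : u < w.
  rewrite -(time_change_ltE tc u0); last exact: (tc_inv_ge0 tc).
  by rewrite /w (tc_K tc)// ltrDl.
exists (w - u) => [|v]; first by rewrite subr_gt0.
rewrite subrKC => /andP[uv vw]; have v0 := le_trans u0 uv.
have : g v < g u + e / r.
  by rewrite -[ltRHS](tc_K tc g0) (time_change_ltE tc v0)// (tc_inv_ge0 tc).
rewrite -(ltr_pM2l r0) mulrDr mulrCA mulfV ?gt_eqF// mulr1 => gv.
(* Here e^(-e) >= 1 - e is used, together with the fact that the discount is at most 1. *)
apply: (@le_trans _ _ (time_changed_discount u * expR (- e))).
  have := time_changed_discount_le1 u0; have := time_changed_discount_ge0 u.
  have := expR_ge1Dx (- e); nra.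
by rewrite -expRD ler_expR; lra.
Qed.

Lemma measurable_time_changed_discount : measurable_fun `[(0 : R), +oo[ time_changed_discount.
Proof.
have := measurable_expRN r (measurable_time_change tc).
by apply: eq_measurable_fun => u _; rewrite /time_changed_discount mulNr.
Qed.

End TimeChangedJumps.

Section JumpTimesTimeChange.
Context {R : realType} {Omega : Type}.

Lemma left_near_time_change (g ginv : R -> R) (Q : R -> Prop) v :
  time_change g ginv -> 0 < v ->
  (\forall u \near v^'-, Q u) -> \forall s \near (g v)^'-, Q (ginv s).
Proof.
move=> tc v0 /at_left_ex[e e0 he]; have tcs := time_change_sym tc.
(* The term v / 2 keeps [v'] positive, in the range where the time change is controlled. *)
pose v' := Num.max (v / 2) (v - e).
have v'0 : 0 < v' by rewrite lt_max divr_gt0.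
have v'v : v' < v by rewrite gt_max; apply/andP; split; lra.
have gv : g v' < g v by rewrite (time_change_ltE tc)// ltW.
near=> s; have sv : s < g v by near: s; exact: nbhs_left_lt.
have v's : g v' < s by near: s; exact: nbhs_left_gt.
have s0 : 0 <= s by rewrite ltW// (le_lt_trans _ v's)// (tc_ge0 tc)// ltW.
apply: he; apply/andP; split.
  rewrite (@le_lt_trans _ _ v')//; first by rewrite le_max lexx orbT.
  rewrite -[ltLHS](tc_invK tc (ltW v'0)) (time_change_ltE tcs)//.
  by rewrite (tc_ge0 tc)// ltW.
rewrite -[ltRHS](tc_invK tc (ltW v0)) (time_change_ltE tcs)//.
by rewrite (tc_ge0 tc)// ltW.
Unshelve. all: end_near. Qed.

Variables (p : nat) (Z : R -> Omega -> 'I_(p + 1)) (g ginv : R -> R).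
Hypothesis tc : time_change g ginv.

(** g and its inverse map left neighbourhoods to left neighbourhoods, so left limits are transported
    in both directions. *)
Lemma jump_times_time_change i j om :
  jump_times (changed_process Z ginv) (state_row i) (state_row j) om =
  g @` path_jump (Z ^~ om) i j.
Proof.
have tcs := time_change_sym tc.
apply/seteqP; split=> s /=.
  move=> [s0 hl]; rewrite state_row_eqE => hr.
  have vs0 : 0 < ginv s by have := tc_increasing tcs (lexx 0) s0; rewrite (tc_0 tcs).
  exists (ginv s); last by rewrite (tc_K tc)// ltW.
  split=> //; have := left_near_time_change tcs s0 hl.
  apply: filterS2 (nbhs_left_gt vs0) => v v0.
  by rewrite state_row_eqE (tc_invK tc)// ltW.
move=> [v [v0 hl hr] <-]; split.
- by have := tc_increasing tc (lexx 0) v0; rewrite (tc_0 tc).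
- have := left_near_time_change tc v0 hl.
  by apply: filterS => u; rewrite state_row_eqE.
- by rewrite state_row_eqE (tc_invK tc)// ltW.
Qed.

Lemma discounted_jumps_time_change r i j om :
  discounted_jumps (changed_process Z ginv) r (state_row i) (state_row j) om =
  total_jump_sum (Z ^~ om) (time_changed_discount g r) i j.
Proof.
rewrite /discounted_jumps jump_times_time_change esum_image//.
move=> u v /set_mem[u0 _ _] /set_mem[v0 _ _] guv.
by rewrite -(tc_invK tc (ltW u0)) guv (tc_invK tc (ltW v0)).
Qed.

End JumpTimesTimeChange.

(** * Conditional expectation given a variable with finitely many values *)

Section FiniteConditioning.
Context {R : realType} {d} {Omega : measurableType d} (P : probability Omega R).
Variables (S : finType) (W : Omega -> S).

(** Unions of fibres of W. As W has finitely many values, these are exactly the events that it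
    generates. *)
Definition saturated (A : set Omega) := forall om om', W om = W om' -> A om -> A om'.

Lemma saturated_sigma_algebra : sigma_algebra setT saturated.
Proof.
split=> //.
- by move=> A sA om om' e /= [_ nA]; split=> // /(sA _ _ (esym e)).
- by move=> F sF om om' e [n _ Fn]; exists n => //; exact: sF e Fn.
Qed.

Local Notation atom k := [set om | W om = k].

Lemma saturated_bigcup A : saturated A ->
  A = \bigcup_(k in [set k | A `&` atom k !=set0]) atom k.
Proof.
move=> sA; apply/seteqP; split=> om /= => [Aom|[k [om' [Aom' <-]] /esym e]].
  by exists (W om) => //; exists om.
exact: sA e Aom'.
Qed.

Lemma saturated_sigma_generated (G : set (set Omega)) :
  (forall A, G A -> saturated A) -> (forall k, G (atom k)) ->
  <<s G >> = saturated.
Proof.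
move=> Gsat Gatom; apply/seteqP; split.
  by apply: smallest_sub; [exact: saturated_sigma_algebra|exact: Gsat].
move=> A /saturated_bigcup ->.
pose T := g_sigma_algebraType G.
apply: (@fin_bigcup_measurable _ T S) => //.
by move=> k _; exact: sub_gen_smallest.
Qed.

Hypothesis mW : forall k, measurable (atom k).

Lemma measurable_saturated A : saturated A -> measurable A.
Proof.
by move=> /saturated_bigcup ->; exact: fin_bigcup_measurable.
Qed.

Lemma saturated_atom A k : saturated A ->
  A `&` atom k = atom k \/ A `&` atom k = set0.
Proof.
move=> sA; have [[om [Aom Wk]]|/set0P/negP/negPn/eqP] := pselect (A `&` atom k !=set0);
  last by right.
left; apply/seteqP; split=> om' /=; first by case.
by move=> Wk'; split=> //; apply: sA Aom; rewrite Wk.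
Qed.

Lemma integral_atoms (f : Omega -> \bar R) A : P.-integrable setT f -> measurable A ->
  (\int[P]_(om in A) f om = \sum_k \int[P]_(om in A `&` atom k) f om)%E.
Proof.
move=> fi mA; rewrite integral_mkcond.
have mAk k : measurable (A `&` atom k) by exact: measurableI mA (mW k).
rewrite (eq_integral (fun om => \sum_k (f \_ (A `&` atom k)) om)%E).
  rewrite integral_sum//; last first.
    move=> k; apply/(integrable_mkcond _ (mAk k)).
    exact: integrableS measurableT (mAk k) _ fi.
  by apply: eq_bigr => k _; rewrite -integral_mkcond.
move=> om _; rewrite (bigD1 (W om))//= big1 ?adde0.
  rewrite !patchE; congr (if _ then _ else _).
  by apply/idP/idP => /set_mem h; apply/mem_set; [split|case: h].
by move=> k kW; rewrite patchE memNset// => -[_ /= e]; rewrite e eqxx in kW.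
Qed.

Lemma ge0_integrable_atoms (f : Omega -> \bar R) : measurable_fun setT f ->
  (forall om, (0 <= f om)%E) ->
  (forall k, (\int[P]_(om in atom k) f om < +oo)%E) -> P.-integrable setT f.
Proof.
move=> mf f0 flty; apply/integrableP; split=> //.
under eq_integral do rewrite gee0_abs//.
rewrite (_ : setT = \big[setU/set0]_(k <- enum S) atom k).
  rewrite ge0_integral_bigsetU//.
  - by apply: lte_sum_pinfty => k _; exact: flty.
  - exact: enum_uniq.
  - by move=> k l _ _ [om [/= <- <-]].
  - exact: measurable_funTS.
by apply/seteqP; split=> // om _; rewrite -bigcup_seq; exists (W om) => //=; rewrite mem_enum.
Qed.

Variables (V : Omega -> \bar R) (y : S -> R).
Hypotheses (Vi : P.-integrable setT V)
  (Vy : forall k, (\int[P]_(om in atom k) V om = (y k)%:E * P (atom k))%E).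

(** Integrals over a saturated set split into integrals over whole atoms, where V and the constant y
    have the same integral. *)
Lemma cond_exp_finite : is_cond_exp P saturated V (y \o W).
Proof.
have mYi : P.-integrable setT (EFin \o (y \o W)).
  pose C := \sum_k `|y k|.
  apply: (le_integrable measurableT _ _ (finite_measure_integrable_cst P C measurableT)).
    apply/measurable_EFinP => _ B mB; rewrite setTI; apply: measurable_saturated.
    by move=> om om' /= ->.
  move=> om _ /=; rewrite lee_fin [leRHS]ger0_norm ?sumr_ge0//.
  by rewrite /C (bigD1 (W om))//= lerDl sumr_ge0.
split=> //; first by move=> A mA om om' /= ->.
move=> A sA; have mA := measurable_saturated sA.
rewrite !integral_atoms//; apply: eq_bigr => k _.
have [->|->] := saturated_atom k sA; last by rewrite !integral_set0.
rewrite Vy (eq_integral (cst (y k)%:E)); last by move=> om /set_mem /= ->.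
by rewrite integral_cst.
Qed.

(** A version is constant on each atom, and where the atom has positive probability the integral
    over it forces the value. *)
Lemma cond_exp_finite_unique (Y : Omega -> R) : is_cond_exp P saturated V Y ->
  forall om, P (atom (W om)) != 0%E -> Y om = y (W om).
Proof.
move=> [_ _ mY YV] om P0; pose k := W om.
have sk : saturated (atom k) by move=> o o' /= ->.
have := YV _ sk; rewrite Vy (eq_integral (cst (Y om)%:E)); last first.
  move=> om' /set_mem /= Wk; congr (_%:E).
  (* The preimage of the singleton of [Y om] is saturated, so it contains the atom of om. *)
  by have /(_ om om' (esym Wk) erefl) := mY [set Y om] (measurable_set1 _).
rewrite integral_cst// => h.
have {h} : ((y k)%:E * P (atom k) = (Y om)%:E * P (atom k))%E by exact: h.
have qE : P (atom k) = (fine (P (atom k)))%:E by rewrite fineK// fin_num_measure.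
rewrite qE in P0 *; rewrite -!EFinM => -[] /mulIf ->//.
Qed.

End FiniteConditioning.

(** * Expected discounted payments from each initial state *)

Section ExpectedPayments.
Context {R : realType} {d} {Omega : measurableType d} (P : probability Omega R).
Local Notation mu := (@lebesgue_measure R).
Local Notation half := (`[(0 : R), +oo[%classic).
Local Notation toC := (map_mx (real_complex R)).
Variables (p : nat) (T : 'M[R]_p) (Pt : R -> 'M[R]_(p + 1))
  (Z : R -> Omega -> 'I_(p + 1)) (g ginv : R -> R)
  (a c : 'cV[R]_p) (B : 'M[R]_p) (b : 'cV[R]_p) (r : R).
Hypotheses (Pt_trans : transition_function (phase_intensity T) Pt)
  (Z_mjp : markov_jump_process P Pt Z)
  (Z_init : P (start_at Z (absorbing_state p)) = 0%E)
  (tc : time_change g ginv) (r0 : 0 < r).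
Variable gam : R -> R[i].
Hypothesis gam_adm : admissible_path right_half_plane (toC (- T)) gam.

Local Notation tr := (@transient_state p).
Local Notation top := (absorbing_state p).
Local Notation Q := (transient_block Pt).
Local Notation phi := (time_changed_discount g r).
Local Notation jumps i j om := (total_jump_sum (Z ^~ om) phi i j).
Local Notation start := (start_at Z).
Local Notation occ k i := (discounted_occupation Q ginv r k i).
Local Notation exit k i := (discounted_exit Q g r k i).

Let gamC : piecewise_C1 gam. Proof. by case: gam_adm => -[]. Qed.
Let gam01 : gam 0 = gam 1. Proof. by case: gam_adm => -[]. Qed.
Let gam_rhp z : on_path gam z -> 0 < Re z.
Proof. by case: gam_adm => _ h _ _ /h. Qed.
Let gamA z : eigenvalue (toC (- T)) z -> off_path gam z /\ winding gam z = 1.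
Proof. by case: gam_adm => _ _ _; apply. Qed.
Let Q0 := transient_block0 Pt_trans.
Let QD := transient_blockD Pt_trans.
Let Qge0 := transient_block_ge0 Pt_trans.
Let Qle1 := transient_block_le1 Pt_trans.
Let Qder := transient_block_derivative Pt_trans.

Let mQ k i : measurable_fun half (fun u => Pt u (tr k) (tr i)).
Proof.
have := semigroup_measurable gamC gam_rhp gam01 gamA Q0 QD Qle1 Qder k i.
by apply: eq_measurable_fun => u _; rewrite transient_blockE.
Qed.

Let integrable_exit k i :
  mu.-integrable half (EFin \o (fun u => phi u * Pt u (tr k) (tr i))).
Proof.
have [K [e [K0 e0 hK]]] := semigroup_decay gamC gam_rhp gam01 gamA Q0 QD Qle1 Qder.
apply: le_integrable (integrableZl_real K (measurable_itv _) (expR_integrable e0)).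
- exact: measurable_itv.
- apply/measurable_EFinP; apply: measurable_funM (mQ k i).
  exact: (measurable_time_changed_discount r tc).
- move=> u; rewrite /= in_itv/= andbT => u0; rewrite lee_fin normrM.
  rewrite ger0_norm ?time_changed_discount_ge0// -transient_blockE.
  rewrite [leRHS]ger0_norm ?mulr_ge0 ?expR_ge0// -[leRHS]mul1r.
  by rewrite ler_pM// ?hK// ?time_changed_discount_ge0 ?(time_changed_discount_le1 tc r0).
Qed.

Lemma integral_transient_jumps k i j : tr i != j ->
  (\int[P]_(om in start (tr k)) jumps (tr i) j om = (fine (P (start (tr k))) *
    (phase_intensity T (tr i) j * exit k i))%:E)%E.
Proof.
move=> ij.
have [L L0 hL] := semigroup_lipschitz gamC gam_rhp gam01 gamA Q0 QD Qle1 Qder.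
rewrite (integral_total_jump_sum Pt_trans Z_mjp (time_changed_discount_ge0 g r)
  (time_changed_discount_le1 tc r0) (time_changed_discount_nincr tc r0)
  (time_changed_discount_right tc r0) ij L0 _ (mQ k i) _ (integrable_exit k i)).
- congr ((_ * (_ * _))%:E); congr (Rintegral _ _ _).
  by apply/funext => u; rewrite transient_blockE.
- exact: (measurable_time_changed_discount r tc).
- by move=> s h s0 h1; rewrite -!transient_blockE; exact: hL.
Qed.

Lemma integrable_transient_jumps i j : tr i != j ->
  P.-integrable setT (fun om => jumps (tr i) j om).
Proof.
move=> ij; have mj : measurable_fun setT (fun om => jumps (tr i) j om).
  exact: (measurable_total_jump_sum Z_mjp (time_changed_discount_ge0 g r)
    (time_changed_discount_le1 tc r0) (time_changed_discount_nincr tc r0)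
    (time_changed_discount_right tc r0)).
apply: (ge0_integrable_atoms (W := Z 0)) => //.
- exact: measurable_start_at Z_mjp.
- by move=> om; apply: esum_ge0 => v _; rewrite lee_fin time_changed_discount_ge0.
- move=> k; case: (split_ordP k) => [k' ->|k' ->].
    by rewrite (integral_transient_jumps k' ij) ltry.
  (* Starting in the absorbing state is an event of probability 0. *)
  rewrite (ord1 k') null_set_integral//.
  + exact: measurable_start_at Z_mjp _.
  + exact: measurable_funTS.
Qed.

Local Notation X := (changed_process Z ginv).
Local Notation V := (discounted_payments X r a c B b).

(** The condition j != i is moved into the summand, so that both sums run over all transient
    states. *)
Let lump_sum i j om : \bar R :=
  (if j != i then (B i j)%:E * jumps (tr i) (tr j) om else 0)%E.

(** Occupation times stay on the clock of X, while jumps are moved to the clock of Z, where their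
    expectation is known. *)
Lemma discounted_paymentsE om : V om =
  (\sum_i (a i 0 - c i 0)%:E * occupation Z ginv r (tr i) om
   + \sum_i \sum_j lump_sum i j om
   + \sum_i (b i 0)%:E * jumps (tr i) top om)%E.
Proof.
rewrite /discounted_payments; congr (_ + _ + _)%E.
- have iX i := integrable_discounted_state Z_mjp tc r0 (tr i) om.
  rewrite /occupation.
  have mh : measurable (half : set (measurableTypeR R)) by exact: measurable_itv.
  rewrite [RHS](eq_bigr _ (fun i _ => esym (integralZl mh (iX i) (a i 0 - c i 0)))).
  rewrite -integral_sum//; last by move=> i; exact: (integrableZl mh (a i 0 - c i 0) (iX i)).
  apply: eq_integral => s _; rewrite mulr_sumr -sumEFin; apply: eq_bigr => i _.
  rewrite -state_row_transient changed_processE (inj_eq (@state_row_inj _ _)).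
  by rewrite -EFinM mulrA [in RHS]mulrC.
- apply: eq_bigr => i _; rewrite big_mkcond; apply: eq_bigr => j _.
  by rewrite /lump_sum -!state_row_transient (discounted_jumps_time_change _ tc).
- apply: eq_bigr => i _.
  by rewrite -state_row_transient -state_row_absorbing (discounted_jumps_time_change _ tc).
Qed.

Let tr_inj i j : j != i -> tr i != tr j.
Proof. by rewrite (inj_eq (@lshift_inj _ _)) eq_sym. Qed.

Let tr_top i : tr i != top.
Proof. by rewrite eq_lrshift. Qed.

Let iO i : P.-integrable setT (fun om => ((a i 0 - c i 0)%:E * occupation Z ginv r (tr i) om)%E).
Proof. by apply: integrableZl => //; exact: (integrable_occupation Z_mjp tc r0). Qed.

Let iJ i j : tr i != j -> forall x : R,
  P.-integrable setT (fun om => (x%:E * jumps (tr i) j om)%E).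
Proof. by move=> ij x; apply: integrableZl => //; exact: integrable_transient_jumps. Qed.

Let iL i j : P.-integrable setT (lump_sum i j).
Proof.
rewrite /lump_sum; have [_|/tr_inj ij] := eqVneq j i; first exact: integrable0.
exact: iJ.
Qed.

Lemma integrable_discounted_payments : P.-integrable setT V.
Proof.
rewrite (funext discounted_paymentsE).
apply: integrableD => //; first apply: integrableD => //.
- exact: integrable_sum.
- by apply: integrable_sum => // i _; exact: integrable_sum.
- by apply: integrable_sum => // i _; exact: iJ.
Qed.

(** The reserve given the initial state k: annuity and premium rates against occupation, lump sums
    weighted by intensities against exits. *)
Definition expected_payments k : R :=
  \sum_i (a i 0 - c i 0) * occ k i
  + \sum_i (\sum_(j | j != i) B i j * T i j + b i 0 * exit_rates T i 0) * exit k i.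

Lemma integral_discounted_payments k :
  (\int[P]_(om in start (tr k)) V om = (expected_payments k)%:E * P (start (tr k)))%E.
Proof.
have mk := measurable_start_at Z_mjp (tr k); set D := start (tr k) in mk *.
have iD f : P.-integrable setT f -> P.-integrable D f.
  exact: integrableS measurableT mk (@subsetT _ _).
have eO i : (\int[P]_(om in D) ((a i 0 - c i 0)%:E * occupation Z ginv r (tr i) om) =
    ((a i 0 - c i 0) * (fine (P D) * occ k i))%:E)%E.
  rewrite integralZl//; last exact/iD/(integrable_occupation Z_mjp tc r0).
  rewrite (integral_occupation Z_mjp tc).
    rewrite -EFinM; congr ((_ * (_ * _))%:E); congr (Rintegral _ _ _).
    by apply/funext => s; rewrite transient_blockE.
  have := occupation_integrable gam_adm Q0 QD Qle1 Qder tc r0 k i.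
  rewrite (_ : (fun s => _) = (fun s => expR (- r * s) * Pt (ginv s) (tr k) (tr i)))//.
  by apply/funext => s; rewrite transient_blockE.
have eJ i j (ij : tr i != j) x : (\int[P]_(om in D) (x%:E * jumps (tr i) j om) =
    (x * (fine (P D) * (phase_intensity T (tr i) j * exit k i)))%:E)%E.
  rewrite integralZl//; last exact/iD/integrable_transient_jumps.
  by rewrite integral_transient_jumps.
rewrite (funext discounted_paymentsE).
rewrite integralD//; last 2 first.
- apply: iD; apply: integrableD => //; first exact: integrable_sum.
  by apply: integrable_sum => // i _; exact: integrable_sum.
- by apply: iD; apply: integrable_sum => // i _; exact: iJ.
rewrite integralD//; last 2 first.
- by apply: iD; exact: integrable_sum.
- by apply: iD; apply: integrable_sum => // i _; exact: integrable_sum.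
rewrite !integral_sum//; last 3 first.
- by move=> i; apply: iD; exact: iJ.
- by move=> i; exact: iD.
- by move=> i; apply: iD; exact: integrable_sum.
under eq_bigr => i _ do rewrite eO.
rewrite sumEFin.
rewrite [X in (_ + X + _)%E](eq_bigr (fun i => (\sum_(j | j != i)
    B i j * (fine (P D) * (T i j * exit k i)))%:E)); last first.
  move=> i _; rewrite integral_sum//; last by move=> j; exact: iD.
  rewrite -sumEFin [RHS]big_mkcond; apply: eq_bigr => j _.
  rewrite /lump_sum; have [_|/tr_inj ij] := eqVneq j i; first by rewrite integral0.
  by rewrite eJ// /phase_intensity block_mxEul.
rewrite sumEFin (eq_bigr _ (fun i _ => eJ i top (tr_top i) (b i 0))) sumEFin.
rewrite -!EFinD -[P D]fineK ?fin_num_measure// -EFinM; congr (_%:E).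
rewrite /expected_payments mulrDl !mulr_suml -addrA -big_split/=.
congr (_ + _); apply: eq_bigr => i _; first by ring.
rewrite /phase_intensity block_mxEur mulrDl mulrDl !mulr_suml; congr (_ + _); last by ring.
by apply: eq_bigr => j _; ring.
Qed.

End ExpectedPayments.

(** * The initial sigma-algebra, the matrix formula, and the reserve *)

Lemma natural_filtration0 {R : realType} {d} {Omega : measurableType d} p
    (Z : R -> Omega -> 'I_(p + 1)) (g ginv : R -> R) :
  time_change g ginv ->
  natural_filtration (changed_process Z ginv) 0 = saturated (Z 0).
Proof.
move=> tc; have ginv0 := tc_0 (time_change_sym tc).
apply: saturated_sigma_generated.
  move=> _ [s [x [s0 ->]]]; have -> : s = 0 by apply/esym/le_anti.
  by move=> om om' /= e; rewrite !changed_processE ginv0 e.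
move=> k; exists 0, (state_row k); rewrite lexx; split=> //.
by apply/seteqP; split=> om /=; rewrite state_row_eqE ginv0.
Qed.

(** Both matrix functions turn out to be real: r times the occupation matrix, and -T times the exit
    matrix. Neither value depends on the contour, so two different contours are allowed. *)
Lemma mxfun_payments {R : realType} p (T : 'M[R]_p) (Pt : R -> 'M[R]_(p + 1))
    (g ginv : R -> R) (a c : 'cV[R]_p) (B : 'M[R]_p) (b : 'cV[R]_p) (r : R)
    (gam1 gam2 : R -> R[i]) (toC := fun m n => @map_mx _ _ (real_complex R) m n) :
  transition_function (phase_intensity T) Pt -> time_change g ginv -> 0 < r ->
  (forall i, B i i = 0) ->
  admissible_path right_half_plane (toC _ _ (- T)) gam1 ->
  admissible_path right_half_plane (toC _ _ (- T)) gam2 ->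
  (r^-1)%:C *:
       (mxfun gam1 (fun s => laplace (h1 r g) s) (toC _ _ (- T))
          *m toC _ _ (a - c))
    + invmx (toC _ _ (- T))
        *m mxfun gam2 (fun w => laplace (h2 w ginv) r%:C) (toC _ _ (- T))
        *m toC _ _ (hadamard T B *m const_mx 1 + hadamard (exit_rates T) b)
  = \col_k (expected_payments T Pt g ginv a c B b r k)%:C.
Proof.
move=> Pt_trans tc r0 B_diag adm1 adm2.
have Q0 := transient_block0 Pt_trans; have QD := transient_blockD Pt_trans.
have Qge0 := transient_block_ge0 Pt_trans; have Qle1 := transient_block_le1 Pt_trans.
have Qder := transient_block_derivative Pt_trans.
pose O := \matrix_(i, j) discounted_occupation (transient_block Pt) ginv r i j.
pose E := \matrix_(i, j) discounted_exit (transient_block Pt) g r i j.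
have -> : mxfun gam1 (fun s => laplace (h1 r g) s) (toC _ _ (- T)) = toC _ _ (r *: O).
  by apply/matrixP => i j; rewrite (mxfun_laplace_h1 adm1 Q0 QD Qge0 Qle1 Qder tc r0) !mxE.
have -> : mxfun gam2 (fun w => laplace (h2 w ginv) r%:C) (toC _ _ (- T)) =
    toC _ _ (- T) *m toC _ _ E.
  apply/matrixP => i j; rewrite (mxfun_laplace_h2 adm2 Q0 QD Qge0 Qle1 Qder tc r0).
  by congr ((_ *m _) _ _); apply/matrixP => k l; rewrite !mxE.
(* The inverse in the formula cancels the factor -T. *)
rewrite mulKmx ?(admissible_unitmx adm1)// -!map_mxM -map_mxZ -map_mxD.
apply/matrixP => k l; rewrite ord1 !mxE; congr (_%:C).
congr (_ + _); last first.
  apply: eq_bigr => i _; rewrite !mxE mulrC; congr ((_ + _) * _); last by rewrite mulrC.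
  (* The zero diagonal of B removes the diagonal entry of T, which is no jump rate, from the row
     sum. *)
  rewrite (bigD1 i)//= !mxE B_diag mulr0 mul0r add0r.
  by apply: eq_bigr => j _; rewrite !mxE mulr1 mulrC.
rewrite mulr_sumr; apply: eq_bigr => i _; rewrite !mxE.
by field; rewrite gt_eqF.
Qed.
Theorem corollary3p3 (R : realType) (d : measure_display)
  (Omega : measurableType d) (P : probability Omega R)
  (p : nat) (T : 'M[R]_p) (Pt : R -> 'M[R]_(p + 1))
  (Z : R -> Omega -> 'I_(p + 1)) (g ginv : R -> R)
  (a c : 'cV[R]_p) (B : 'M[R]_p) (b : 'cV[R]_p) (r : R)
  (T_sub : sub_intensity T)
  (Pt_trans : transition_function (phase_intensity T) Pt)
  (Z_markov : markov_jump_process P Pt Z)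
  (Z_transient : forall k : 'I_p, transient Pt (transient_state k))
  (Z_init : P [set om | Z 0 om = absorbing_state p] = 0%E)
  (g_tc : time_change g ginv)
  (B_diag : forall i, B i i = 0)
  (r_gt0 : 0 < r)
  (gam1 gam2 : R -> R[i])
  (gam1_adm : admissible_path right_half_plane (map_mx (real_complex R) (- T))
                gam1)
  (gam2_adm : admissible_path right_half_plane (map_mx (real_complex R) (- T))
                gam2) :
  let X := changed_process Z ginv in
  let V := discounted_payments X r a c B b in
  let toC := fun (m n : nat) (M : 'M[R]_(m, n)) => map_mx (real_complex R) M in
  let rhs : 'cV[R[i]]_p :=
    (r^-1)%:C *:
       (mxfun gam1 (fun s => laplace (h1 r g) s) (toC _ _ (- T))
          *m toC _ _ (a - c))
    + invmx (toC _ _ (- T))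
        *m mxfun gam2 (fun w => laplace (h2 w ginv) r%:C) (toC _ _ (- T))
        *m toC _ _ (hadamard T B *m const_mx 1 + hadamard (exit_rates T) b) in
  (exists Y0 : Omega -> R, is_cond_exp P (natural_filtration X 0) V Y0) /\
  forall Y0 : Omega -> R, is_cond_exp P (natural_filtration X 0) V Y0 ->
    {ae P, forall om, forall x : 'rV[R]_p, X 0 om = Some x ->
       (Y0 om)%:C = (toC _ _ x *m rhs) 0 0}.
Proof.
move=> X V toC rhs; have ginv0 := tc_0 (time_change_sym g_tc).
have mW k : measurable [set om | Z 0 om = k] by exact: measurable_start_at Z_markov k.
have rhsE : rhs = \col_k (expected_payments T Pt g ginv a c B b r k)%:C.
  exact: (mxfun_payments a c b Pt_trans g_tc r_gt0 B_diag gam1_adm gam2_adm).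
(* The value 0 at the absorbing state is a default on a null set. *)
pose y (k : 'I_(p + 1)) : R := if fintype.split k is inl i
  then expected_payments T Pt g ginv a c B b r i else 0.
have Vi : P.-integrable setT V.
  exact: (integrable_discounted_payments a c B b Pt_trans Z_markov Z_init g_tc r_gt0 gam1_adm).
have Vy k : (\int[P]_(om in [set om | Z 0%R om = k]) V om =
    (y k)%:E * P [set om | Z 0%R om = k])%E.
  rewrite /y -{1 3}(splitK k); case: (fintype.split k) => [i|i] /=.
    exact: (integral_discounted_payments a c B b Pt_trans Z_markov Z_init g_tc r_gt0 gam1_adm).
  rewrite (ord1 i) mul0e null_set_integral//.
  have mV : measurable_fun setT V by exact: measurable_int Vi.
  exact: measurable_funTS mV.
rewrite (natural_filtration0 Z g_tc); split.
  by exists (y \o Z 0); exact: (@cond_exp_finite R d Omega P _ (Z 0) mW V y Vi Vy).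
move=> Y0 Y0E.
(* There are finitely many atoms, so those of probability 0 are discarded together. *)
have h : {ae P, forall om, forall k, Z 0 om = k -> P [set om | Z 0 om = k] != 0%E}.
  apply: filter_forall => k; have [Pk0|Pk0] := eqVneq (P [set om | Z 0 om = k]) 0%E.
    by exists [set om | Z 0 om = k]; split=> // om /= /not_implyP[].
  exact: aeW.
apply: filterS h => om h x; rewrite /X changed_processE ginv0.
have P0 := h _ erefl; rewrite (cond_exp_finite_unique mW Vy Y0E P0) rhsE /y /state_row.
case: (fintype.split _) => // i [<-].
rewrite !mxE (bigD1 i)//= big1 ?addr0.
  by rewrite !mxE !eqxx rmorph1 mul1r.
by move=> j ji; rewrite !mxE (negbTE ji) andbF rmorph0 mul0r.
Qed.
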